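(* Consider the $L_\infty$ approximation problem ${\rm APP}=\{{\rm APP}_{\infty,d}\}_{d\in\mathbb N}$, ${\rm APP}_{\infty,d}:H(K_{d,\mathbf a,\mathbf b})\to L_\infty([0,1]^d)$, $f\mapsto f$, in the worst case setting, where $\omega\in(0,1)$ and $0<a_1\le a_2\le\cdots$, $\inf_i b_i>0$. The following hold for $\Lambda^{\rm std}$ and for $\Lambda^{\rm all}$, under ABS or NOR. 1. EXP-UWT holds iff $\lim_{j\to\infty}\frac{\ln a_j}{\ln j}=\infty$. 2. EXP-$(s,t)$-WT with $s>0$, $t>1$ always holds. 3. EXP-$(s,t)$-WT with $0<s<1$ and $0<t\le1$ holds iff $\lim_{j\to\infty}\frac{a_j}{j^{(1-s)/s}}=\infty$. 4. EXP-$(1,t)$-WT with $t<1$ holds iff $\lim_{j\to\infty}\frac{a_j}{\ln j}=\infty$. 5. EXP-$(s,t)$-WT with $s>1$ and $t<1$ holds iff $\lim_{j\to\infty}j^{1-t}a_j\omega^{a_j}=0$.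
   Context: $H(K_{d,\mathbf a,\mathbf b})$ is the reproducing kernel Hilbert space of complex-valued 1-periodic continuous functions on $[0,1]^d$ with kernel $K_{d,\mathbf a,\mathbf b}(\mathbf x,\mathbf y)=\sum_{\mathbf h\in\mathbb Z^d}\omega_{\mathbf h}e^{2\pi i\mathbf h\cdot(\mathbf x-\mathbf y)}$, $\omega_{\mathbf h}=\omega^{\sum_{k=1}^d a_k|h_k|^{b_k}}$, and norm $\|f\|^2=\sum_{\mathbf h}\omega_{\mathbf h}^{-1}|\hat f(\mathbf h)|^2$, $\hat f(\mathbf h)=\int_{[0,1]^d}f(\mathbf x)e^{-2\pi i\mathbf h\cdot\mathbf x}d\mathbf x$. $L_\infty$ carries the sup norm. $\Lambda^{\rm all}$: all continuous linear functionals; $\Lambda^{\rm std}$: point evaluations. $e(n,{\rm APP}_{\infty,d};\Lambda)$: infimum over algorithms $A(f)=\phi(L_1f,\dots,L_nf)$, $L_i\in\Lambda$, $\phi$ arbitrary, of $\sup_{\|f\|\le1}\|f-A(f)\|_\infty$; $e(0,{\rm APP}_{\infty,d})=\sup_{\|f\|\le1}\|f\|_\infty$. $n^\star(\varepsilon,d;\Lambda)=\inf\{n\ge0:e(n,{\rm APP}_{\infty,d};\Lambda)\le\varepsilon{\rm CRI}_d\}$ with ${\rm CRI}_d=1$ (ABS) or $e(0,{\rm APP}_{\infty,d})$ (NOR). With $n=n^\star(\varepsilon,d;\Lambda)$, $d\in\mathbb N$, $\varepsilon\in(0,1)$, limits as $\varepsilon^{-1}+d\to\infty$: EXP-UWT: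 $\ln n/((1+\ln\varepsilon^{-1})^\alpha+d^\beta)\to0$ for all $\alpha,\beta>0$; EXP-$(s,t)$-WT: $\ln n/((1+\ln\varepsilon^{-1})^s+d^t)\to0$.
   Formalization: In items 4 and 5, ''t<1'' is read as 0<t<1: for t≤0 the equivalences fail, since with ε fixed and small the denominator stays bounded as d→∞ while n≥2, so EXP-(s,t)-WT never holds although the limit conditions can (e.g. a_j=j). *)

(* Defs.v *)
From HB Require Import structures.
From mathcomp Require Import all_boot all_order all_algebra.
From mathcomp Require Import all_classical all_reals all_analysis.
From mathcomp Require Import complex.

Set Implicit Arguments.
Unset Strict Implicit.
Unset Printing Implicit Defensive.

Import Order.TTheory GRing.Theory Num.Theory.
Local Open Scope classical_set_scope.
Local Open Scope ring_scope.

Section Defs.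
Variable R : realType.

Definition Zd (d : nat) := {ffun 'I_d -> int}.

(* omega_h = omega ^ (sum_k a_k |h_k|^{b_k}); the sequences a, b are
   indexed from 1 (coordinate k : 'I_d uses a_(k+1), b_(k+1)). *)
Definition weight (om : R) (a b : nat -> R) (d : nat) (h : Zd d) : R :=
  om `^ (\sum_(k < d) a k.+1 * (`|(h k)%:~R : R| `^ b k.+1)).

Definition rsum (T : choiceType) (g : T -> R) : R :=
  fine (\esum_(i in [set: T]) (Num.max (g i) 0)%:E)%E
  - fine (\esum_(i in [set: T]) (Num.max (- g i) 0)%:E)%E.

Definition csum (T : choiceType) (g : T -> R[i]) : R[i] :=
  (rsum (fun i => complex.Re (g i)) +i* rsum (fun i => complex.Im (g i)))%C.

Definition dotp (d : nat) (h : Zd d) (x : 'I_d -> R) : R :=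
  \sum_(k < d) (h k)%:~R * x k.

Definition cexp2pi (th : R) : R[i] :=
  (cos (2 * pi * th) +i* sin (2 * pi * th))%C.

(* An element of H(K_{d,a,b}) is represented by its family of Fourier
   coefficients c = (\hat f(h))_h; its value at x is
   f(x) = sum_h \hat f(h) e^{2 pi i h.x}. *)
Definition fval (d : nat) (c : Zd d -> R[i]) (x : 'I_d -> R) : R[i] :=
  csum (fun h => c h * cexp2pi (dotp h x)).

Definition sqnorm (om : R) (a b : nat -> R) (d : nat) (c : Zd d -> R[i]) : \bar R :=
  (\esum_(h in [set: Zd d]) ((ComplexField.Normc.normc (c h)) ^+ 2 / weight om a b h)%:E)%E.

Definition inH om a b d (c : Zd d -> R[i]) : Prop := (sqnorm om a b c < +oo)%E.

Definition Hnorm om a b d (c : Zd d -> R[i]) : R := Num.sqrt (fine (sqnorm om a b c)).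

Definition unitball om a b d (c : Zd d -> R[i]) : Prop := (sqnorm om a b c <= 1)%E.

Definition cube (d : nat) : set ('I_d -> R) := [set x | forall k, 0 <= x k <= 1].

Definition cont_lin_functional om a b d (L : (Zd d -> R[i]) -> R[i]) : Prop :=
  (forall (al : R[i]) (c1 c2 : Zd d -> R[i]), inH om a b c1 -> inH om a b c2 ->
     L (fun h => al * c1 h + c2 h) = al * L c1 + L c2) /\
  (exists C : R, forall c, inH om a b c -> ComplexField.Normc.normc (L c) <= C * Hnorm om a b c).

Inductive info_class := Lall | Lstd.

Definition in_Lambda om a b d (cls : info_class) (L : (Zd d -> R[i]) -> R[i]) : Prop :=
  match cls with
  | Lall => cont_lin_functional om a b L
  | Lstd => exists x, cube x /\ L = (fun c => fval c x)
  end.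

Definition alg_error om a b d (A : (Zd d -> R[i]) -> ('I_d -> R) -> R[i]) : \bar R :=
  ereal_sup [set r | exists c x, unitball om a b c /\ cube x /\
                       r = (ComplexField.Normc.normc (fval c x - A c x))%:E].

Definition init_error om a b d : \bar R :=
  ereal_sup [set r | exists (c : Zd d -> R[i]) x, unitball om a b c /\ cube x /\
                       r = (ComplexField.Normc.normc (fval c x))%:E].

Definition min_error om a b d (cls : info_class) (n : nat) : \bar R :=
  if n is 0 then init_error om a b d else
  ereal_inf [set r | exists (Ls : 'I_n -> (Zd d -> R[i]) -> R[i])
                            (phi : ('I_n -> R[i]) -> ('I_d -> R) -> R[i]),
      (forall i, in_Lambda om a b cls (Ls i)) /\
      r = alg_error om a b (fun c => phi (fun i => Ls i c))].

Inductive criterion := ABS | NOR.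

Definition CRI om a b d (cr : criterion) : \bar R :=
  match cr with ABS => 1%E | NOR => init_error om a b d end.

(* information complexity n*(eps, d; Lambda), as an extended real
   (+oo if no n works) *)
Definition nstar om a b (cls : info_class) (cr : criterion) (eps : R) (d : nat) : \bar R :=
  ereal_inf [set (n%:R)%:E | n in
    [set n : nat | (min_error om a b d cls n <= eps%:E * CRI om a b d cr)%E]].

Definition exp_tends0 om a b cls cr (T : nat -> R -> R) : Prop :=
  forall eta : R, 0 < eta -> exists M : R, forall (d : nat) (eps : R),
    (0 < d)%N -> 0 < eps < 1 -> M < eps^-1 + d%:R ->
    exists n : nat, nstar om a b cls cr eps d = (n%:R)%:E /\
                    `|ln (n%:R) / T d eps| < eta.

Definition EXP_UWT om a b cls cr : Prop :=
  forall al be : R, 0 < al -> 0 < be ->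
    exp_tends0 om a b cls cr (fun d eps => (1 + ln eps^-1) `^ al + d%:R `^ be).

Definition EXP_WT om a b cls cr (s t : R) : Prop :=
  exp_tends0 om a b cls cr (fun d eps => (1 + ln eps^-1) `^ s + d%:R `^ t).

End Defs.

(* Main.v *)
(* The error of optimal sampling is squeezed between two sums of weights.

   Upper bound: for a set A of frequencies bounded by m there is a rank-1
   lattice with (2m + 1)(|A|^2 + 1) nodes on which the frequencies of A do not
   alias, and the lattice rule has error at most
   4 (sum of the weights outside A)^(1/2).  For A = {omega_h >= la}, the
   numbers m, |A| and the tail are controlled by
   S_tau = sum_h omega_h^tau = prod_k (1 + rho_k(tau)) with 0 < tau < 1, so
   that ln n <= 3 + 3/(1-tau) (2 tau ln(1/eps) + 4 tau + ln S_tau).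

   Lower bound: the information f |-> (L_1 f, ..., L_n f) vanishes on the
   orthogonal complement of a space of dimension at most n, and averaging the
   squared error over lattice nodes gives e(n)^2 >= sum_h omega_h (1 - q_h)
   over any finite set of frequencies, with 0 <= q_h <= 1 and sum_h q_h <= n.

   Sufficiency follows by letting tau depend on (eps, d): tau = 1/(2(1 + x))
   (part 2), tau = ka (1 + x)^(s-1) (parts 1 and 3), tau constant (part 4) and
   tau = 1 - 1/(2 + ln d) (part 5), where x = ln(1/eps).  Necessity follows by
   counting the indices in {0,1}^d with r nonzero entries (parts 3 and 4), and
   from an entropy bound on the number of indices needed to carry three quarters
   of the mass of (omega_h) (part 5). *)

(* The lattice rule uses only point values, and the lower bound allows arbitrary continuous linear
   information, so both classes are treated at once. So are both criteria, since [CRI] lies between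
   1 and 2 S_1^(1/2). Upper bounds only use that it is at least 1. Lower bounds need control of S_1
   as d grows: e^(K d) suffices in part 3, while parts 4 and 5 use the assumption itself at eps =
   1/8, where S_1 <= 4 n.

   The delicate case is part 5. Its condition only forces a_j to be at least about (1 - t) ln j /
   ln(1/omega), so for constant tau the sum of omega^(tau a_j) over j <= d could exceed d^t.
   Therefore tau tends to 1 at the rate 1/ln d. The price 1/(1 - tau) = 2 + ln d multiplies
   ln(1/eps), and s > 1 absorbs the product. Conversely, S_1 <= 4 n misses a factor ln d, which the
   entropy bound recovers by comparing the exponents 1 and 1 + 1/ln d.

   Part 1 is part 3 for all small s, because ln a_j / ln j tends to infinity iff a_j / j^q does for
   every q > 0. *)
Require Import Defs.
From HB Require Import structures.
From mathcomp Require Import all_boot all_order all_algebra.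
From mathcomp Require Import all_classical all_reals all_analysis.
From mathcomp Require Import complex.
From mathcomp Require Import ring lra zify.
Set Implicit Arguments.
Unset Strict Implicit.
Unset Printing Implicit Defensive.
Import Order.TTheory GRing.Theory Num.Theory.
Local Open Scope classical_set_scope.
Local Open Scope ring_scope.

(** * Absolutely summable families *)

Section AbsolutelySummable.
Variables (R : realType) (T : choiceType).
Implicit Types (f g : T -> R).
Local Notation normc := (@ComplexField.Normc.normc R).

Definition abs_summable f := (\esum_(i in [set: T]) `|f i|%:E < +oo)%E.

Lemma ge0_esumZl (k : R) f : 0 <= k -> (forall i, 0 <= f i) ->
  (\esum_(i in [set: T]) (k * f i)%:E = k%:E * \esum_(i in [set: T]) (f i)%:E)%E.
Proof.
move=> k0 f0; rewrite /esum -ereal_supZl//; last first.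
  by apply/set0P; exists (\sum_(x \in set0) (f x)%:E)%E; exists set0 => //; exact: fsets_set0.
congr ereal_sup; apply/seteqP; split => [_ [F [finF _] <-]|_ [_ [F [finF _] <-] <-]] /=.
  exists (\sum_(x \in F) (f x)%:E)%E; first by exists F.
  by rewrite ge0_mule_fsumr// => i; rewrite lee_fin.
exists F => //.
by rewrite ge0_mule_fsumr// => i; rewrite lee_fin.
Qed.

Lemma esum_EFin_lty f g : (forall i, 0 <= f i <= g i) ->
  (\esum_(i in [set: T]) (g i)%:E < +oo -> \esum_(i in [set: T]) (f i)%:E < +oo)%E.
Proof.
move=> fg; apply: le_lt_trans; apply: le_esum => i _.
by rewrite lee_fin; case/andP: (fg i).
Qed.

Lemma esum_fin_num f : (forall i, 0 <= f i) ->
  (\esum_(i in [set: T]) (f i)%:E < +oo)%E ->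
  (\esum_(i in [set: T]) (f i)%:E \is a fin_num)%E.
Proof.
move=> f0 foo; rewrite ge0_fin_numE//; apply: esum_ge0 => i _.
by rewrite lee_fin.
Qed.

(** Any splitting into summable nonnegative families gives the same value as the splitting into
    positive and negative parts. Additivity of [rsum] then follows by adding the parts of f and g
    separately. *)
Lemma rsumB f g : (forall i, 0 <= f i) -> (forall i, 0 <= g i) ->
  (\esum_(i in [set: T]) (f i)%:E < +oo)%E ->
  (\esum_(i in [set: T]) (g i)%:E < +oo)%E ->
  rsum (fun i => f i - g i) =
    fine (\esum_(i in [set: T]) (f i)%:E) - fine (\esum_(i in [set: T]) (g i)%:E).
Proof.
move=> f0 g0 foo goo.
have fg0 i : 0 <= Num.max (f i - g i) 0 <= f i.
  by rewrite le_max lexx orbT /= ge_max f0 andbT lerBlDr lerDl.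
have gf0 i : 0 <= Num.max (- (f i - g i)) 0 <= g i.
  by rewrite le_max lexx orbT /= ge_max g0 andbT opprB lerBlDr lerDl.
have h1 : summable [set: T] (EFin \o f).
  by rewrite /summable (eq_esum (b := fun i => (f i)%:E))// => i _ /=; rewrite ger0_norm.
have h2 : summable [set: T] (EFin \o g).
  by rewrite /summable (eq_esum (b := fun i => (g i)%:E))// => i _ /=; rewrite ger0_norm.
have := esumB h1 h2 (fun i _ => f0 i) (fun i _ => g0 i).
move=> E; rewrite /rsum -!fineB; last 4 first.
- exact: esum_fin_num.
- exact: esum_fin_num.
- by apply: esum_fin_num => [i|]; [case/andP: (fg0 i)|exact: (esum_EFin_lty fg0)].
- by apply: esum_fin_num => [i|]; [case/andP: (gf0 i)|exact: (esum_EFin_lty gf0)].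
congr fine; rewrite -E; congr (_ - _)%E; apply: eq_esum => i _ /=.
  by rewrite funeposE EFin_max.
by rewrite funenegE EFin_max EFinN.
Qed.

Lemma subr_max_opp (x : R) : x = Num.max x 0 - Num.max (- x) 0.
Proof.
case: (leP x 0) => h; first by rewrite max_l ?oppr_ge0// opprK add0r.
by rewrite max_r ?subr0// oppr_le0 ltW.
Qed.

Lemma abs_summable_pos f : abs_summable f ->
  (\esum_(i in [set: T]) (Num.max (f i) 0)%:E < +oo)%E.
Proof.
apply: esum_EFin_lty => i; rewrite le_max lexx orbT /= ge_max normr_ge0 andbT.
exact: ler_norm.
Qed.

Lemma abs_summableN f : abs_summable f -> abs_summable (fun i => - f i).
Proof. by apply: esum_EFin_lty => i; rewrite normrN normr_ge0 lexx. Qed.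

Lemma abs_summableZ (k : R) f : abs_summable f -> abs_summable (fun i => k * f i).
Proof.
move=> f1; rewrite /abs_summable; under eq_esum do rewrite normrM.
by rewrite ge0_esumZl// lte_mul_pinfty// lee_fin.
Qed.

Lemma max0_ge0 (x : R) : 0 <= Num.max x 0. Proof. by rewrite le_max lexx orbT. Qed.

Lemma rsumD f g : abs_summable f -> abs_summable g ->
  rsum (fun i => f i + g i) = rsum f + rsum g.
Proof.
move=> f1 g1.
have fp := abs_summable_pos f1; have fn := abs_summable_pos (abs_summableN f1).
have gp := abs_summable_pos g1; have gn := abs_summable_pos (abs_summableN g1).
have -> : (fun i => f i + g i) = (fun i => (Num.max (f i) 0 + Num.max (g i) 0)
    - (Num.max (- f i) 0 + Num.max (- g i) 0)).
  by apply/funext => i; rewrite {1}(subr_max_opp (f i)) {1}(subr_max_opp (g i)) opprD addrACA.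
have DE (u v : T -> R) : (forall i, 0 <= u i) -> (forall i, 0 <= v i) ->
  (\esum_(i in [set: T]) (u i + v i)%:E =
   \esum_(i in [set: T]) (u i)%:E + \esum_(i in [set: T]) (v i)%:E)%E.
  by move=> u0 v0; under eq_esum do rewrite EFinD; rewrite esumD// => i _; rewrite lee_fin.
rewrite rsumB.
- rewrite !DE//; try by move=> ?; exact: max0_ge0.
  rewrite /rsum !fineD; last 4 first.
  + by apply: esum_fin_num => // i; exact: max0_ge0.
  + by apply: esum_fin_num => // i; exact: max0_ge0.
  + by apply: esum_fin_num => // i; exact: max0_ge0.
  + by apply: esum_fin_num => // i; exact: max0_ge0.
  by rewrite opprD addrACA.
- by move=> i; rewrite addr_ge0// max0_ge0.
- by move=> i; rewrite addr_ge0// max0_ge0.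
- by rewrite DE; [exact: lte_add_pinfty|move=> ?; exact: max0_ge0|move=> ?; exact: max0_ge0].
- by rewrite DE; [exact: lte_add_pinfty|move=> ?; exact: max0_ge0|move=> ?; exact: max0_ge0].
Qed.

Lemma rsumN f : rsum (fun i => - f i) = - rsum f.
Proof.
rewrite /rsum opprB; congr (_ - fine _).
by apply: eq_esum => i _; rewrite opprK.
Qed.

Lemma rsumZ (k : R) f : abs_summable f -> rsum (fun i => k * f i) = k * rsum f.
Proof.
move=> f1.
wlog k0 : k / 0 <= k.
  move=> H; case: (leP 0 k) => [/H //|k0].
  have -> : (fun i => k * f i) = (fun i => - (- k * f i)).
    by apply/funext => i; rewrite mulNr opprK.
  by rewrite rsumN H ?oppr_ge0 ?ltW// mulNr opprK.
have ME g i : Num.max (k * g i) 0 = k * Num.max (g i) 0 :> R.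
  by rewrite maxr_pMr// mulr0.
rewrite /rsum.
under eq_esum do rewrite ME.
under [in X in _ - X]eq_esum do rewrite -mulrN (ME (fun i => - f i)).
have F1 : (\esum_(i in [set: T]) (Num.max (f i) 0)%:E \is a fin_num)%E.
  by apply: esum_fin_num; [move=> i; exact: max0_ge0|exact: abs_summable_pos].
have F2 : (\esum_(i in [set: T]) (Num.max (- f i) 0)%:E \is a fin_num)%E.
  apply: esum_fin_num; first by move=> i; exact: max0_ge0.
  exact: (abs_summable_pos (abs_summableN f1)).
rewrite (ge0_esumZl k0 (fun i => max0_ge0 (f i))) (ge0_esumZl k0 (fun i => max0_ge0 (- f i))).
by rewrite !fineM//= mulrBr.
Qed.

Lemma rsum_bound f (B : R) : (\esum_(i in [set: T]) `|f i|%:E <= B%:E)%E ->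
  `|rsum f| <= B.
Proof.
move=> fB.
have K g : (forall i, `|g i| = `|f i|) ->
    0 <= fine (\esum_(i in [set: T]) (Num.max (g i) 0)%:E) <= B.
  move=> gf; have h : (\esum_(i in [set: T]) (Num.max (g i) 0)%:E <= B%:E)%E.
    apply: le_trans fB; apply: le_esum => i _.
    by rewrite lee_fin ge_max -gf normr_ge0 andbT ler_norm.
  have h0 : (0 <= \esum_(i in [set: T]) (Num.max (g i) 0)%:E)%E.
    by apply: esum_ge0 => i _; rewrite lee_fin max0_ge0.
  rewrite fine_ge0//= -lee_fin fineK// ge0_fin_numE//.
  exact: le_lt_trans h (ltry _).
have /andP[p0 pB] := K f (fun=> erefl).
have /andP[n0 nB] := K (fun i => - f i) (fun i => normrN _).
rewrite /rsum ler_norml; apply/andP; split; lra.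
Qed.

Implicit Types (u v : T -> R[i]).

Definition cabs_summable u := (\esum_(i in [set: T]) (normc (u i))%:E < +oo)%E.

Lemma normc_ge0 (z : R[i]) : 0 <= normc z.
Proof. by case: z => x y; rewrite sqrtr_ge0. Qed.

Lemma normc_Re (z : R[i]) : `|complex.Re z| <= normc z.
Proof.
by case: z => x y /=; rewrite -sqrtr_sqr ler_wsqrtr// lerDl sqr_ge0.
Qed.

Lemma normc_Im (z : R[i]) : `|complex.Im z| <= normc z.
Proof.
by case: z => x y /=; rewrite -sqrtr_sqr ler_wsqrtr// lerDr sqr_ge0.
Qed.

Lemma normc_le_ReIm (x y : R) : normc (x +i* y)%C <= `|x| + `|y|.
Proof.
rewrite /= -[leRHS]ger0_norm ?addr_ge0// -sqrtr_sqr ler_wsqrtr//.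
rewrite sqrrD !real_normK ?num_real// [leRHS]addrAC lerDl.
by rewrite mulrn_wge0// mulr_ge0.
Qed.

Lemma cabs_summable_Re u : cabs_summable u -> abs_summable (fun i => complex.Re (u i)).
Proof. by apply: esum_EFin_lty => i; rewrite normr_ge0 normc_Re. Qed.

Lemma cabs_summable_Im u : cabs_summable u -> abs_summable (fun i => complex.Im (u i)).
Proof. by apply: esum_EFin_lty => i; rewrite normr_ge0 normc_Im. Qed.

Lemma cabs_summableD u v : cabs_summable u -> cabs_summable v ->
  cabs_summable (fun i => u i + v i).
Proof.
move=> u1 v1; have : (\esum_(i in [set: T]) (normc (u i) + normc (v i))%:E < +oo)%E.
  under eq_esum do rewrite EFinD.
  by rewrite esumD ?lte_add_pinfty// => i _; rewrite lee_fin normc_ge0.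
apply: esum_EFin_lty => i; rewrite normc_ge0 /=.
exact: (@le_normcD R).
Qed.

Lemma cabs_summableZ (k : R[i]) u : cabs_summable u -> cabs_summable (fun i => k * u i).
Proof.
move=> u1; rewrite /cabs_summable; under eq_esum do rewrite ComplexField.Normc.normcM.
rewrite ge0_esumZl ?lte_mul_pinfty// ?lee_fin ?normc_ge0// => i.
exact: normc_ge0.
Qed.

Lemma csumD u v : cabs_summable u -> cabs_summable v ->
  csum (fun i => u i + v i) = csum u + csum v.
Proof.
move=> u1 v1; rewrite /csum.
have -> : (fun i => complex.Re (u i + v i)) = (fun i => complex.Re (u i) + complex.Re (v i)).
  by apply/funext => i; case: (u i) (v i) => ? ? [].
have -> : (fun i => complex.Im (u i + v i)) = (fun i => complex.Im (u i) + complex.Im (v i)).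
  by apply/funext => i; case: (u i) (v i) => ? ? [].
by rewrite !rsumD//; [exact: cabs_summable_Im|exact: cabs_summable_Im
  |exact: cabs_summable_Re|exact: cabs_summable_Re].
Qed.

Lemma csumZ (k : R[i]) u : cabs_summable u ->
  csum (fun i => k * u i) = k * csum u.
Proof.
move=> u1; rewrite /csum; case: k => k l.
have -> : (fun i => complex.Re ((k +i* l)%C * u i)) =
    (fun i => k * complex.Re (u i) + (- l) * complex.Im (u i)).
  by apply/funext => i; case: (u i) => x y /=; rewrite mulNr.
have -> : (fun i => complex.Im ((k +i* l)%C * u i)) =
    (fun i => k * complex.Im (u i) + l * complex.Re (u i)).
  by apply/funext => i; case: (u i) => x y /=.
have r1 := cabs_summable_Re u1; have i1 := cabs_summable_Im u1.
rewrite !rsumD ?rsumZ//; try exact: abs_summableZ.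
by simpc.
Qed.

Lemma csum_sum (I : Type) (r : seq I) (w : I -> R[i]) (u : I -> T -> R[i]) :
  (forall j, cabs_summable (u j)) ->
  cabs_summable (fun i => \sum_(j <- r) w j * u j i) /\
  csum (fun i => \sum_(j <- r) w j * u j i) = \sum_(j <- r) w j * csum (u j).
Proof.
move=> u1; elim: r => [|j r [IH1 IH2]].
  have E : (fun i => \sum_(j <- [::]) w j * u j i) = (fun i => 0).
    by apply/funext => i; rewrite big_nil.
  have z1 : cabs_summable (fun i : T => 0 : R[i]).
    rewrite /cabs_summable esum1 ?ltry// => i _.
    by rewrite ComplexField.Normc.normc0.
  rewrite E big_nil; split => //.
  by have := csumZ 0 z1; rewrite !mul0r.
have E : (fun i => \sum_(j <- j :: r) w j * u j i) =
    (fun i => w j * u j i + \sum_(j <- r) w j * u j i).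
  by apply/funext => i; rewrite big_cons.
rewrite E big_cons; split; first by apply: cabs_summableD => //; exact: cabs_summableZ.
by rewrite csumD//; [rewrite csumZ// IH2|exact: cabs_summableZ].
Qed.

(** Real and imaginary parts are bounded separately, whence the two copies of [B]. This is the 2 in
    [fval_bound] and one factor 2 of the 4 in [lattice_upper_bound]. *)
Lemma csum_bound u (B : R) : (\esum_(i in [set: T]) (normc (u i))%:E <= B%:E)%E ->
  normc (csum u) <= B + B.
Proof.
move=> uB; rewrite /csum; apply: le_trans (normc_le_ReIm _ _) _.
by apply: lerD; apply: rsum_bound; apply: le_trans uB; apply: le_esum => i _;
  rewrite lee_fin ?normc_Re ?normc_Im.
Qed.

End AbsolutelySummable.

(** * Lattice rules *)

Section Exponentials.
Variable R : realType.
Local Notation normc := (@ComplexField.Normc.normc R).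
Local Notation e := (@cexp2pi R).

Lemma cexp2piD (s t : R) : e (s + t) = e s * e t.
Proof.
rewrite /cexp2pi mulrDr cosD sinD; simpc; congr (_ +i* _)%C.
by rewrite addrC [X in X + _]mulrC.
Qed.

Lemma cexp2pi0 : e 0 = 1.
Proof. by rewrite /cexp2pi mulr0 cos0 sin0. Qed.

Lemma normc_cexp2pi (t : R) : normc (e t) = 1.
Proof. by rewrite /cexp2pi /= cos2Dsin2 sqrtr1. Qed.

Lemma cexp2piN (t : R) : e (- t) = conjc (e t).
Proof. by rewrite /cexp2pi mulrN cosN sinN. Qed.

Lemma cexp2piMn (t : R) n : e (n%:R * t) = e t ^+ n.
Proof.
elim: n => [|n IH]; first by rewrite mul0r cexp2pi0 expr0.
by rewrite -natr1 mulrDl mul1r cexp2piD IH exprSr.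
Qed.

Lemma cexp2pi1 : e 1 = 1.
Proof. by rewrite /cexp2pi mulr1 mulr_natl cos2pi sin2pi. Qed.

Lemma cexp2pi_int (z : int) : e z%:~R = 1.
Proof.
have P n : e n%:R = 1 by rewrite -[n%:R]mulr1 cexp2piMn cexp2pi1 expr1n.
case: z => n; first by rewrite -pmulrn P.
by rewrite NegzE mulrNz cexp2piN -pmulrn P conjc1.
Qed.

(** The half angle pi t lies in (0, pi), where the sine is positive, whereas cos(2 pi t) = 1 would
    make it vanish. *)
Lemma cexp2pi_neq1 (t : R) : 0 < t < 1 -> e t != 1.
Proof.
move=> /andP[t0 t1]; apply/eqP => -[+ _].
have -> : 2 * pi * t = (pi * t) *+ 2 by rewrite -mulrA mulr_natl.
rewrite cos_mulr2n => h.
have : 0 < sin (pi * t).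
  by apply: sin_gt0_pi; rewrite mulr_gt0 ?pi_gt0// gtr_pMr ?pi_gt0.
have : sin (pi * t) ^+ 2 = 0.
  by rewrite sin2cos2; move: h; rewrite -mulr_natr; lra.
by move/eqP; rewrite sqrf_eq0 => /eqP->; rewrite ltxx.
Qed.

(** Orthogonality of the characters of Z/N: a geometric sum whose ratio is an N-th root of unity,
    equal to 1 exactly when N divides m. *)
Lemma sum_cexp2pi (N : nat) (m : int) : (0 < N)%N ->
  \sum_(j < N) e (j%:R * (m%:~R / N%:R)) = if (N%:Z %| m)%Z then N%:R else 0.
Proof.
move=> N0; have N0R : (N%:R : R) != 0 by rewrite pnatr_eq0 -lt0n.
set x := e (m%:~R / N%:R).
have -> : \sum_(j < N) e (j%:R * (m%:~R / N%:R)) = \sum_(j < N) x ^+ j.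
  by apply: eq_bigr => j _; rewrite cexp2piMn.
have ME : m%:~R = (m %/ N%:Z)%Z%:~R * N%:R + (m %% N%:Z)%Z%:~R :> R.
  by rewrite {1}(divz_eq m N%:Z) intrD intrM -pmulrn.
have xE : x = e ((m %% N%:Z)%Z%:~R / N%:R).
  by rewrite /x ME mulrDl mulfK// cexp2piD cexp2pi_int mul1r.
case: ifPn => [/dvdzP[q mE]|ndiv].
  have -> : x = 1 by rewrite /x mE intrM mulfK// cexp2pi_int.
  by under eq_bigr do rewrite expr1n; rewrite sumr_const card_ord.
have x1 : x != 1.
  rewrite xE; apply: cexp2pi_neq1; apply/andP; split.
    apply: divr_gt0; last by rewrite ltr0n.
    rewrite ltr0z lt_neqAle modz_ge0 ?andbT; last by lia.
    by rewrite eq_sym; apply: contra ndiv => /eqP h; apply/dvdz_mod0P.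
  rewrite ltr_pdivrMr ?ltr0n// mul1r -[N%:R]/(N%:Z%:~R) ltr_int.
  by rewrite ltz_pmod.
have : x ^+ N - 1 = 0.
  by rewrite /x -cexp2piMn mulrC divfK// cexp2pi_int subrr.
by rewrite subrX1 => /eqP; rewrite mulf_eq0 subr_eq0 (negbTE x1) => /eqP.
Qed.

Variable d : nat.
Implicit Types (h : Zd d) (x : 'I_d -> R).

Lemma cexp2pi_dotpB h h' x :
  e (dotp (h - h') x) = e (dotp h x) * conjc (e (dotp h' x)).
Proof.
rewrite -cexp2piN -cexp2piD; congr e.
rewrite /dotp -sumrN -big_split /=; apply: eq_bigr => k _.
by rewrite !ffunE intrD mulrDl mulrNz mulNr.
Qed.

Definition zdot (z : nat -> nat) h : int := \sum_(k < d) h k * (z k)%:Z.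

Lemma zdotB z h h' : zdot z (h - h') = zdot z h - zdot z h'.
Proof.
by rewrite /zdot -sumrN -big_split /=; apply: eq_bigr => k _; rewrite !ffunE mulrDl mulNr.
Qed.

Definition lattice_node (N : nat) (z : nat -> nat) (j : nat) : 'I_d -> R :=
  fun k => ((j * z k) %% N)%:R / N%:R.

Lemma cube_lattice_node N z j : (0 < N)%N -> cube (lattice_node N z j).
Proof.
move=> N0 k; rewrite /lattice_node divr_ge0//=.
by rewrite ler_pdivrMr ?ltr0n// mul1r ler_nat ltnW// ltn_pmod.
Qed.

(** Reducing the node modulo 1, which keeps it in the cube, changes its product with h only by an
    integer. *)
Lemma cexp2pi_node N z j h : (0 < N)%N ->
  e (dotp h (lattice_node N z j)) = e (j%:R * ((zdot z h)%:~R / N%:R)).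
Proof.
move=> N0; have N0R : (N%:R : R) != 0 by rewrite pnatr_eq0 -lt0n.
have -> : j%:R * ((zdot z h)%:~R / N%:R) = dotp h (lattice_node N z j) +
    (\sum_(k < d) h k * ((j * z k) %/ N)%N%:Z)%:~R :> R.
  rewrite /dotp /zdot !raddf_sum /= mulr_suml mulr_sumr -big_split /=.
  apply: eq_bigr => k _; rewrite !intrM /lattice_node -!pmulrn.
  have -> : ((j * z k) %% N)%:R = j%:R * (z k)%:R - ((j * z k) %/ N)%:R * N%:R :> R.
    by rewrite -!natrM {2}(divn_eq (j * z k) N) natrD addrC addKr.
  by field.
by rewrite cexp2piD cexp2pi_int mulr1.
Qed.

Lemma sum_cexp2pi_node N z h h' : (0 < N)%N ->
  \sum_(j < N) e (dotp h (lattice_node N z j)) * conjc (e (dotp h' (lattice_node N z j))) =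
  if (N%:Z %| zdot z h - zdot z h')%Z then N%:R else 0.
Proof.
move=> N0; rewrite -zdotB -sum_cexp2pi//; apply: eq_bigr => j _.
by rewrite -cexp2pi_dotpB cexp2pi_node.
Qed.

End Exponentials.

(* The generating vector is chosen one coordinate at a time: a pair of indices
   that differ in the new coordinate excludes at most one value of [z n], as
   two excluded values would differ by a multiple of N that is too small. *)
Lemma reconstructing_lattice (d M : nat) (I : finType) (H : I -> Zd d) :
  injective H -> (forall i k, (`|H i k| <= M)%N) ->
  exists z : nat -> nat, forall i i', i != i' ->
    ~~ (((2 * M + 1) * (#|I| ^ 2 + 1))%N%:Z %| zdot z (H i) - zdot z (H i'))%Z.
Proof.
move=> Hinj HM; set T := (#|I| ^ 2 + 1)%N; set N := ((2 * M + 1) * T)%N.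
pose v i i' k := H i k - H i' k.
pose part (z : nat -> nat) (n : nat) i i' := \sum_(l < d | (l < n)%N) v i i' l * (z l : nat)%:Z.
have vM i i' k : (`|v i i' k| <= 2 * M)%N.
  by have := HM i k; have := HM i' k; rewrite /v; lia.
suff P n : (n <= d)%N -> exists z : nat -> nat, forall i i',
    (exists2 l : 'I_d, (l < n)%N & v i i' l != 0) -> ~~ (N%:Z %| part z n i i')%Z.
  have [z zP] := P d (leqnn d); exists z => i i' ii'.
  have [l lP] : exists l, H i l != H i' l.
    apply/existsP; apply: contraR ii' => /existsPn h; apply/eqP/Hinj/ffunP => l.
    by apply/eqP; move: (h l); rewrite negbK.
  have := zP i i'; rewrite /part.
  rewrite (eq_bigl xpredT) => [|k]; last by rewrite ltn_ord.
  have -> : \sum_(l < d) v i i' l * (z l)%:Z = zdot z (H i) - zdot z (H i').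
    by rewrite /zdot -sumrB; apply: eq_bigr => k _; rewrite /v mulrBl.
  by apply; exists l; rewrite ?subr_eq0.
elim: n => [_|n IH nd]; first by exists (fun=> 0%N) => i i' [].
have [z zP] := IH (ltnW nd).
pose bad (t : 'I_T) (p : I * I) := (v p.1 p.2 (Ordinal nd) != 0) &&
  (N%:Z %| part z n p.1 p.2 + v p.1 p.2 (Ordinal nd) * (t : nat)%:Z)%Z.
(* Pigeonhole: there are |I|^2 + 1 candidates t but only |I|^2 pairs, and a pair excludes at most
   one candidate. *)
have [t tP] : exists t, forall p, ~~ bad t p.
  case: (pselect (exists t, forall p, ~~ bad t p)) => // h; exfalso.
  have f t : {p | bad t p}.
    apply/sigW/existsP; apply: contrapT => /negP/existsPn h1.
    by apply: h; exists t => p; exact: h1.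
  have finj : injective (fun t => sval (f t)).
    move=> t t' tt'; have [/andP[v0 /dvdzP[q1 E1]] /andP[_ /dvdzP[q2 E2]]] :=
      (svalP (f t), svalP (f t')).
    rewrite -tt' /= in E2 v0.
    set w := v _ _ _ in E1 E2 v0; set s := part _ _ _ _ in E1 E2.
    have D : w * ((t : nat)%:Z - (t' : nat)%:Z) = (q1 - q2) * N%:Z.
      by rewrite [RHS]mulrBl -E1 -E2; ring.
    have wM : (`|w| <= 2 * M)%N by exact: vM.
    have tT := ltn_ord t; have t'T := ltn_ord t'.
    apply/val_inj/eqP => /=; apply: contraT => ntt'.
    have q0 : q1 - q2 != 0.
      apply: contra ntt' => /eqP q0; move: D; rewrite q0 mul0r => /eqP.
      by rewrite mulf_eq0 (negbTE v0) /= subr_eq0 eqz_nat.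
    have := congr1 absz D; rewrite !abszM => D'.
    have : (`|w| * `|((t : nat)%:Z - (t' : nat)%:Z)| <= 2 * M * T)%N.
      by apply: leq_mul => //; lia.
    rewrite D' => h2; have : (1 * N <= 2 * M * T)%N.
      by apply: leq_trans h2; apply: leq_mul; rewrite ?absz_nat// absz_gt0.
    by rewrite mul1n /N leq_mul2r /T; lia.
  have := leq_card _ finj; rewrite card_ord card_prod /T expnS expn1.
  by rewrite addn1 ltnn.
exists (fun k => if k == n then t : nat else z k) => i i' [l ln l0].
have -> : part (fun k => if k == n then t : nat else z k) n.+1 i i' =
    part z n i i' + v i i' (Ordinal nd) * (t : nat)%:Z.
  rewrite /part (bigD1 (Ordinal nd)) /=; last by rewrite ltnSn.
  rewrite eqxx addrC; congr (_ + _).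
  apply: eq_big => [k|k /andP[_ kn]].
    rewrite ltnS -[k == Ordinal nd](inj_eq val_inj) /=; lia.
  have := kn; rewrite -[k == Ordinal nd](inj_eq val_inj) /= => /negbTE-> //.
have := tP (i, i'); rewrite /bad /=; case: eqP => [v0 _|_ //].
rewrite v0 mul0r addr0; apply: zP; exists l => //.
have : (l : nat) != n by apply: contra l0 => /eqP ln'; rewrite -v0; apply/eqP; congr v; apply: val_inj.
by move: ln; rewrite ltnS leq_eqVlt => /orP[->|].
Qed.

(** * Sums over boxes and the function space *)

Section BoxSums.
Variable R : realType.

Lemma fsum_injective (T : choiceType) (I : finType) (H : I -> T) (g : T -> R) :
  injective H -> (\sum_(x \in range H) (g x)%:E = (\sum_i g (H i))%:E)%E.
Proof.
move=> Hinj; rewrite fsbig_finite; last exact/finite_image/finite_finset.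
rewrite (perm_big (map H (index_enum I))) /=; first by rewrite big_map sumEFin.
apply: uniq_perm; first exact: finmap.fset_uniq.
  by rewrite map_inj_uniq// index_enum_uniq.
move=> x; rewrite in_fset_set; last exact/finite_image/finite_finset.
apply/idP/mapP => [|[i _ ->]]; last by rewrite inE; exists i.
by rewrite inE => -[i _ <-]; exists i => //; rewrite mem_index_enum.
Qed.

Lemma sum_le_esum (T : choiceType) (I : finType) (H : I -> T) (g : T -> R) :
  injective H -> ((\sum_i g (H i))%:E <= \esum_(x in [set: T]) (g x)%:E)%E.
Proof.
move=> Hinj; rewrite -fsum_injective//; apply: esum_ge; exists (range H) => //.
by split => //; exact/finite_image/finite_finset.
Qed.

Lemma esum_finsupp (T : choiceType) (I : finType) (H : I -> T) (g : T -> R) :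
  injective H -> (forall x, 0 <= g x) -> (forall x, (forall i, H i <> x) -> g x = 0) ->
  (\esum_(x in [set: T]) (g x)%:E = (\sum_i g (H i))%:E)%E.
Proof.
move=> Hinj g0 gH; rewrite -fsum_injective//.
rewrite (esumID (range H))//; last by move=> *; rewrite lee_fin.
rewrite !setTI [X in (_ + X)%E]esum1 ?adde0; last first.
  by move=> x /= nx; rewrite gH// => i Hi; apply: nx; exists i.
by rewrite esum_fset//; [exact/finite_image/finite_finset|move=> *; rewrite lee_fin].
Qed.

(** Lagrange's identity: the difference of the two sides is half of the double sum of squares
    below. *)
Lemma CauchySchwarz_sum (I : finType) (x y : I -> R) :
  (\sum_i x i * y i) ^+ 2 <= (\sum_i x i ^+ 2) * (\sum_i y i ^+ 2).
Proof.
have : 0 <= \sum_i \sum_j (x i * y j - x j * y i) ^+ 2.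
  by apply: sumr_ge0 => i _; apply: sumr_ge0 => j _; exact: sqr_ge0.
have -> : \sum_i \sum_j (x i * y j - x j * y i) ^+ 2 =
    \sum_i \sum_j (x i ^+ 2 * y j ^+ 2) + \sum_i \sum_j (y i ^+ 2 * x j ^+ 2)
    - 2 * \sum_i \sum_j ((x i * y i) * (x j * y j)).
  rewrite mulr_sumr -sumrN -!big_split /=; apply: eq_bigr => i _.
  rewrite mulr_sumr -sumrN -!big_split /=; apply: eq_bigr => j _.
  by ring.
have D (u v : I -> R) : \sum_i \sum_j u i * v j = (\sum_i u i) * (\sum_i v i).
  by rewrite mulr_suml; apply: eq_bigr => i _; rewrite mulr_sumr.
by rewrite !D; lra.
Qed.

Variable d : nat.
Implicit Types (g : Zd d -> R) (M : nat).

(** The box of radius [M] is indexed by a finite function type, so that sums over it factor over the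
    coordinates by distributivity. *)
Definition unbox M (i : {ffun 'I_d -> 'I_(2 * M).+1}) : Zd d :=
  [ffun k => (i k : nat)%:Z - M%:Z].

Lemma unbox_inj M : injective (@unbox M).
Proof.
move=> i j /ffunP ij; apply/ffunP => k; apply: val_inj => /=.
by have := ij k; rewrite !ffunE; lia.
Qed.

Lemma unbox_bounded M i k : (`|@unbox M i k| <= M)%N.
Proof. by rewrite ffunE; have := ltn_ord (i k); lia. Qed.

Lemma unbox_surj M (h : Zd d) : (forall k, (`|h k| <= M)%N) -> exists i, @unbox M i = h.
Proof.
move=> hM; exists [ffun k => inord (absz (h k + M%:Z))]; apply/ffunP => k.
have hk := hM k; have [h1 h2] : - M%:Z <= h k /\ h k <= M%:Z.
  by move: hk; move: (h k) => z; lia.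
by rewrite !ffunE inordK; move: h1 h2; move: (h k) => z; lia.
Qed.

Definition boxsum g M : R := \sum_i g (@unbox M i).

(** Every finite set of frequencies lies in a box, so infinite sums over Z^d can be controlled
    through box sums alone. *)
Lemma esum_le_boxsum g (B : R) : (forall h, 0 <= g h) ->
  (forall M, boxsum g M <= B) -> (\esum_(h in [set: Zd d]) (g h)%:E <= B%:E)%E.
Proof.
move=> g0 gB; apply: ge_ereal_sup => _ [F [finF _] <-].
rewrite fsbig_finite// sumEFin lee_fin.
set s := finmap.enum_fset _; have us : uniq s by exact: finmap.fset_uniq.
pose M := (\max_(h <- s) \max_(k < d) `|h k|)%N.
have sM h : h \in s -> exists i, @unbox M i = h.
  move=> hs; apply: unbox_surj => k.
  apply: (@leq_trans (\max_(k < d) `|h k|)%N); first by rewrite (leq_bigmax k).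
  exact: (leq_bigmax_seq (P := xpredT) (F := fun h : Zd d => (\max_(k < d) `|h k|)%N)).
apply: le_trans (gB M).
have -> : boxsum g M = \sum_(h <- map (@unbox M) (index_enum _)) g h by rewrite big_map.
rewrite [leRHS](bigID (mem s)) /=.
rewrite -[leLHS]addr0 lerD ?sumr_ge0//.
rewrite -[leRHS]big_filter [leRHS](perm_big s)// uniq_perm ?filter_uniq//.
  by rewrite map_inj_uniq ?index_enum_uniq//; exact: unbox_inj.
move=> h; rewrite mem_filter; apply/andb_idr => /sM[i <-].
by apply: map_f; rewrite mem_index_enum.
Qed.

Lemma boxsum_le_esum g M (B : R) : (\esum_(h in [set: Zd d]) (g h)%:E <= B%:E)%E ->
  boxsum g M <= B.
Proof. by move=> gB; rewrite -lee_fin; apply: le_trans gB; exact/sum_le_esum/unbox_inj. Qed.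

End BoxSums.

(** * Continuity of point evaluations on the function space *)

Section FunctionSpace.
Variables (R : realType) (om : R) (a b : nat -> R).
Hypothesis om0 : 0 < om.
Local Notation normc := (@ComplexField.Normc.normc R).
Variable d : nat.
Implicit Types (c : Zd d -> R[i]) (x : 'I_d -> R).
Local Notation weight := (@weight R om a b d).
Local Notation e := (@cexp2pi R).

Lemma weight_gt0 (h : Zd d) : 0 < weight h. Proof. exact: powR_gt0. Qed.

Lemma sqnormE_ge0 c h : 0 <= normc (c h) ^+ 2 / weight h.
Proof. by rewrite divr_ge0 ?sqr_ge0 ?ltW ?weight_gt0. Qed.

(** Cauchy-Schwarz for |c_h| = (|c_h| / w_h^(1/2)) w_h^(1/2). Taking all frequencies for [A] makes
    point evaluations continuous; taking the frequencies missed by an algorithm bounds its error. *)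
Lemma esum_normc_sub c (A : pred (Zd d)) (Q B : R) :
  (sqnorm om a b c <= Q%:E)%E ->
  (forall M, boxsum (fun h => if A h then weight h else 0) M <= B) ->
  (\esum_(h in [set: Zd d]) (if A h then normc (c h) else 0)%:E
     <= (Num.sqrt (Q * B))%:E)%E.
Proof.
move=> cQ AB; apply: esum_le_boxsum => [h|M]; first by case: ifP => // _; exact: normc_ge0.
have S0 : 0 <= boxsum (fun h => if A h then normc (c h) else 0) M.
  by apply: sumr_ge0 => i _; case: ifP => // _; exact: normc_ge0.
rewrite -[leLHS]ger0_norm// -sqrtr_sqr ler_wsqrtr//.
rewrite /boxsum; set H := @unbox d M.
pose u i := normc (c (H i)) / Num.sqrt (weight (H i)).
pose v i := if A (H i) then Num.sqrt (weight (H i)) else 0.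
have sw i : Num.sqrt (weight (H i)) ^+ 2 = weight (H i).
  by rewrite sqr_sqrtr// ltW ?weight_gt0.
have -> : \sum_i (if A (H i) then normc (c (H i)) else 0) = \sum_i u i * v i.
  apply: eq_bigr => i _; rewrite /u /v; case: ifP; rewrite ?mulr0// => _.
  by rewrite divfK// gt_eqF// sqrtr_gt0 weight_gt0.
apply: le_trans (CauchySchwarz_sum _ _) _; apply: ler_pM.
- by apply: sumr_ge0 => i _; exact: sqr_ge0.
- by apply: sumr_ge0 => i _; exact: sqr_ge0.
- have -> : \sum_i u i ^+ 2 = boxsum (fun h => normc (c h) ^+ 2 / weight h) M.
    by apply: eq_bigr => i _; rewrite /u exprMn exprVn sw.
  exact: boxsum_le_esum cQ.
- apply: le_trans (AB M); apply: ler_sum => i _; rewrite /v -/H.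
  by case: ifP => _; rewrite ?expr0n//= sw.
Qed.

Variable B : R.
Hypothesis weightB : forall M, boxsum weight M <= B.

Lemma sqnorm_ge0 c : (0 <= sqnorm om a b c)%E.
Proof. by apply: esum_ge0 => h _; rewrite lee_fin sqnormE_ge0. Qed.

Lemma inH_fin c : inH om a b c -> (sqnorm om a b c = (fine (sqnorm om a b c))%:E)%E.
Proof. by move=> cH; rewrite fineK// ge0_fin_numE// sqnorm_ge0. Qed.

Lemma inH_esum_normc c (Q : R) : (sqnorm om a b c <= Q%:E)%E ->
  (\esum_(h in [set: Zd d]) (normc (c h))%:E <= (Num.sqrt (Q * B))%:E)%E.
Proof. by move=> cQ; have := esum_normc_sub (A := predT) cQ weightB. Qed.

Lemma inH_cabs c x : inH om a b c -> cabs_summable (fun h => c h * e (dotp h x)).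
Proof.
move=> cH; rewrite /cabs_summable.
under eq_esum do rewrite ComplexField.Normc.normcM normc_cexp2pi mulr1.
apply: le_lt_trans (ltry (Num.sqrt (fine (sqnorm om a b c) * B))).
by apply: inH_esum_normc; rewrite -inH_fin.
Qed.

Lemma unitball_inH c : unitball om a b c -> inH om a b c.
Proof. by move=> c1; apply: le_lt_trans c1 (ltry _). Qed.

Lemma fval_lin (al : R[i]) c1 c2 x : inH om a b c1 -> inH om a b c2 ->
  fval (fun h => al * c1 h + c2 h) x = al * fval c1 x + fval c2 x.
Proof.
move=> c1H c2H; rewrite /fval -csumZ ?inH_cabs// -csumD//; last 2 first.
- exact/cabs_summableZ/inH_cabs.
- exact: inH_cabs.
by congr csum; apply/funext => h; rewrite mulrDl mulrA.
Qed.

Lemma fval_bound c x (Q : R) : (sqnorm om a b c <= Q%:E)%E ->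
  normc (fval c x) <= 2 * Num.sqrt (Q * B).
Proof.
move=> cQ; rewrite mulr_natl mulr2n; apply: csum_bound.
under eq_esum do rewrite ComplexField.Normc.normcM normc_cexp2pi mulr1.
exact: inH_esum_normc.
Qed.

Lemma init_error_le : (init_error om a b d <= (2 * Num.sqrt B)%:E)%E.
Proof.
apply: ge_ereal_sup => _ [c [x [c1 [_ ->]]]]; rewrite lee_fin.
by have := fval_bound x c1; rewrite mul1r.
Qed.

(** Since point evaluations are continuous functionals, lower bounds need only be proved for
    [Lall]. *)
Lemma in_Lambda_all cls L : in_Lambda om a b (d := d) cls L -> in_Lambda om a b Lall L.
Proof.
case: cls => //= -[x [_ ->]]; split=> [al c1 c2|]; first exact: fval_lin.
exists (2 * Num.sqrt B) => c cH; rewrite /Hnorm -mulrA -sqrtrM; last first.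
  apply: le_trans (weightB 0); apply: sumr_ge0 => i _; exact/ltW/weight_gt0.
rewrite [B * _]mulrC; apply: fval_bound; by rewrite -inH_fin.
Qed.

Lemma in_Lambda_std cls x : cube x ->
  in_Lambda om a b (d := d) cls (fun c => fval c x).
Proof.
by case: cls => cx; [apply: (@in_Lambda_all Lstd); exists x|exists x].
Qed.

End FunctionSpace.

(** * Error of the lattice rule *)

Section UpperBound.
Variables (R : realType) (om : R) (a b : nat -> R).
Hypothesis om0 : 0 < om.
Local Notation normc := (@ComplexField.Normc.normc R).
Local Notation e := (@cexp2pi R).

Lemma min_error_le (d : nat) cls n (Ls : 'I_n -> (Zd d -> R[i]) -> R[i])
    (phi : ('I_n -> R[i]) -> ('I_d -> R) -> R[i]) : (0 < n)%N ->
  (forall i, in_Lambda om a b cls (Ls i)) ->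
  (min_error om a b d cls n <= alg_error om a b (fun c => phi (fun i => Ls i c)))%E.
Proof.
by case: n Ls phi => // n Ls phi _ LsP; apply: ereal_inf_lbound; exists Ls, phi.
Qed.

Variables (d : nat) (B : R).
Hypothesis weightB : forall M, boxsum (@weight R om a b d) M <= B.

(* The lattice rule reproduces the frequencies [H i] and maps any other
   frequency to at most one of them, whence the factor 2 on the tail. *)
Lemma lattice_upper_bound cls (I : finType) (H : I -> Zd d) (M : nat) (BA : R) :
  injective H -> (forall i k, (`|H i k| <= M)%N) ->
  (forall M', boxsum (fun h => if [forall i, H i != h] then weight om a b h else 0) M' <= BA) ->
  (min_error om a b d cls ((2 * M + 1) * (#|I| ^ 2 + 1)) <= (4 * Num.sqrt BA)%:E)%E.
Proof.
move=> Hinj HM tail; set N := ((2 * M + 1) * (#|I| ^ 2 + 1))%N.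
have N0 : (0 < N)%N by rewrite muln_gt0 !addn1.
have [z zP] := reconstructing_lattice Hinj HM.
pose y (j : 'I_N) := lattice_node R N z j : 'I_d -> R.
(* The algorithm approximates each coefficient with frequency [H i] by its discrete analogue, the
   mean of f(y_j) conj(e(H_i . y_j)) over the nodes, and sums the resulting trigonometric
   polynomial. *)
pose w (x : 'I_d -> R) (j : 'I_N) : R[i] :=
  N%:R^-1 * \sum_i e (dotp (H i) x) * conjc (e (dotp (H i) (y j))).
pose phi (v : 'I_N -> R[i]) x := \sum_(j <- index_enum 'I_N) w x j * v j.
apply: le_trans (min_error_le (Ls := fun j c => fval c (y j)) phi N0 _) _.
  by move=> j; apply: in_Lambda_std => //; exact: cube_lattice_node.
apply: ge_ereal_sup => _ [c [x [c1 [cx ->]]]]; rewrite lee_fin.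
have cH := unitball_inH c1.
have S1 j := inH_cabs om0 weightB (y j) cH.
have [s1 s2] := csum_sum (index_enum 'I_N) (w x) S1.
(* [D h] is the error of the rule at x on the single exponential of frequency h. *)
pose D h := e (dotp h x) - \sum_(j <- index_enum 'I_N) w x j * e (dotp h (y j)).
have -> : fval c x - phi (fun j => fval c (y j)) x = csum (fun h => c h * D h).
  rewrite /phi /fval -s2.
  have -> : forall u v : R[i], u - v = u + -1 * v by move=> u v; rewrite mulN1r.
  rewrite -csumZ// -csumD//; last 2 first.
  - exact: (inH_cabs om0 weightB x cH).
  - exact: cabs_summableZ.
  congr csum; apply/funext => h; rewrite /D mulrBr mulN1r; congr (_ - _).
  by rewrite mulr_sumr; apply: eq_bigr => j _; rewrite mulrCA.
have DE h : D h = e (dotp h x) -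
    \sum_i (if (N%:Z %| zdot z h - zdot z (H i))%Z then e (dotp (H i) x) else 0).
  congr (_ - _).
  transitivity (\sum_(j < N) \sum_i N%:R^-1 * (e (dotp (H i) x) *
      (e (dotp h (y j)) * conjc (e (dotp (H i) (y j)))))).
    apply: eq_bigr => j _; rewrite /w -mulrA mulr_suml mulr_sumr.
    by apply: eq_bigr => i _; congr (_ * _); rewrite -mulrA; congr (_ * _); rewrite mulrC.
  rewrite exchange_big /=; apply: eq_bigr => i _.
  rewrite -mulr_sumr -mulr_sumr sum_cexp2pi_node//.
  case: ifP => _; last by rewrite !mulr0.
  by rewrite mulrC mulfK// pnatr_eq0 -lt0n.
have uniqi (h : Zd d) i i' : (N%:Z %| zdot z h - zdot z (H i))%Z ->
    (N%:Z %| zdot z h - zdot z (H i'))%Z -> i = i'.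
  move=> h1 h2; apply/eqP; apply: contraT => /zP /negP; case.
  have -> : zdot z (H i) - zdot z (H i') =
    (zdot z h - zdot z (H i')) - (zdot z h - zdot z (H i)) by ring.
  exact: rpredB.
have Dle h : normc (D h) <= if [forall i, H i != h] then 2 else 0.
  rewrite DE; case: ifPn => [_|/forallPn[i0]].
    apply: le_trans (@le_normcD R _ _) _; rewrite normc_cexp2pi normcN.
    rewrite (_ : 2 = 1 + 1)// lerD2l.
    have [/existsP[i0 i0P]|/existsPn no] := boolP [exists i, (N%:Z %| zdot z h - zdot z (H i))%Z].
      rewrite (bigD1 i0)//= i0P big1 ?addr0 ?normc_cexp2pi// => i ii0.
      by case: ifP => // iP; move: ii0; rewrite (uniqi h i0 i i0P iP) eqxx.
    by rewrite big1 ?ComplexField.Normc.normc0// => i _; rewrite (negbTE (no i)).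
  rewrite negbK => /eqP <-; rewrite (bigD1 i0)//= subrr dvdz0.
  rewrite big1 ?addr0 ?subrr ?ComplexField.Normc.normc0// => i ii0.
  by case: ifP => // iP; move: ii0; rewrite (uniqi (H i0) i0 i) ?eqxx// subrr dvdz0.
rewrite (_ : 4 * Num.sqrt BA = 2 * Num.sqrt BA + 2 * Num.sqrt BA); last by ring.
apply: csum_bound.
have := esum_normc_sub (A := fun h => [forall i, H i != h]) om0 c1 tail.
rewrite mul1r EFinM => T1.
rewrite -lee_pdivrMl//; apply: le_trans T1.
rewrite -ge0_esumZl//; last by move=> h; exact: normc_ge0.
apply: le_esum => h _; rewrite lee_fin ComplexField.Normc.normcM.
rewrite ler_pdivrMl//; apply: le_trans (ler_wpM2l (normc_ge0 _) (Dle h)) _.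
by case: ifP => _; rewrite ?mulr0// mulrC.
Qed.

End UpperBound.

(** * Lower bound for the error *)

Section Projection.
Variable R : realType.
Local Notation C := R[i].
Local Notation normc := (@ComplexField.Normc.normc R).
Local Open Scope sesquilinear_scope.

Lemma sqr_normcE (z : C) : ((normc z ^+ 2)%:C)%C = z * conjc z.
Proof. by rewrite -sqr_normc normc_def rmorphXn /= -normc_def; case: z. Qed.

Lemma mxE_trC m n (A : 'M[C]_(m, n)) i j : (A ^t*) i j = conjc (A j i).
Proof. by rewrite !mxE. Qed.

Lemma dot_selfE m (u : 'cV[C]_m) :
  (u ^t* *m u) 0 0 = ((\sum_l normc (u l 0) ^+ 2)%:C)%C.
Proof.
rewrite !mxE raddf_sum /=; apply: eq_bigr => l _.
by rewrite mxE_trC sqr_normcE mulrC.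
Qed.

(** Gram-Schmidt on the row space. As L factors through Q on the right, every vector annihilated by
    Q is annihilated by L. *)
Lemma orthonormal_row_basis n m (L : 'M[C]_(n, m)) :
  exists r, exists2 Q : 'M[C]_(r, m), (r <= n)%N /\ Q *m Q ^t* = 1%:M &
    exists X, L = X *m Q.
Proof.
exists (\rank L), (schmidt (row_base L)).
  split; first exact: rank_leq_row.
  by apply/unitarymxP/schmidt_unitarymx/rank_leq_col.
apply/submxP; apply: submx_trans (schmidt_sub _).
by rewrite eq_row_base.
Qed.

Variables (r m : nat) (Q : 'M[C]_(r, m)).
Hypothesis QQ : Q *m Q ^t* = 1%:M.

(** As Q has orthonormal rows, this is the orthogonal projection P onto the kernel of Q. *)
Definition coproj (u : 'cV[C]_m) : 'cV[C]_m := u - Q ^t* *m (Q *m u).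

Lemma mul_coproj u : Q *m coproj u = 0.
Proof. by rewrite mulmxBr mulmxA QQ mul1mx subrr. Qed.

Lemma dot_coproj u : (coproj u) ^t* *m coproj u = u ^t* *m coproj u.
Proof.
have -> : (coproj u) ^t* = u ^t* - (Q *m u) ^t* *m Q.
  rewrite /coproj linearB /= map_mxB; congr (_ - _).
  by rewrite trmx_mul map_mxM /= trmxCK.
by rewrite mulmxBl -mulmxA mul_coproj mulmx0 subr0.
Qed.

(** The inner product of P u and u is |P u|^2. In [lower_bound] the left side is the value at a node
    of the function with coordinates P u, and the right side its squared norm. *)
Lemma sum_mul_conj_coproj u :
  \sum_l coproj u l 0 * conjc (u l 0) = ((\sum_l normc (coproj u l 0) ^+ 2)%:C)%C.
Proof.
rewrite -dot_selfE dot_coproj mxE; apply: eq_bigr => l _.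
by rewrite mxE_trC mulrC.
Qed.

Lemma sqnorm_coproj u : \sum_l normc (coproj u l 0) ^+ 2 =
  \sum_l normc (u l 0) ^+ 2 - \sum_i normc ((Q *m u) i 0) ^+ 2.
Proof.
apply: (@complexI R); rewrite rmorphB /= -!dot_selfE dot_coproj.
rewrite /coproj mulmxBr trmx_mul map_mxM /= !mulmxA.
by move: (_ *m _) (_ *m _) => A1 A2; rewrite !mxE.
Qed.

(** The diagonal entries (leverage scores) of the projection onto the row space of Q. They become
    the q_h of the lower bound: the share of frequency h that the information captures. *)
Definition leverage (l : 'I_m) : R := \sum_i normc (Q i l) ^+ 2.

Lemma leverage_ge0 l : 0 <= leverage l.
Proof. by apply: sumr_ge0 => i _; exact: sqr_ge0. Qed.

Lemma leverage_le1 l : leverage l <= 1.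
Proof.
have := sqnorm_coproj (delta_mx l 0).
rewrite [X in _ = X - _](bigD1 l)//= [X in _ = _ + X - _]big1 => [|k kl]; last first.
  by rewrite mxE (negbTE kl) ComplexField.Normc.normc0 expr0n.
rewrite mxE !eqxx ComplexField.Normc.normc1 expr1n addr0.
under [X in _ = _ - X]eq_bigr do rewrite -colE mxE.
rewrite -/(leverage l) => E; rewrite -subr_ge0 -E.
by apply: sumr_ge0 => i _; exact: sqr_ge0.
Qed.

Lemma sum_leverage : \sum_l leverage l = r%:R.
Proof.
apply: (@complexI R); rewrite exchange_big raddf_sum /=.
transitivity (\sum_(i < r) (Q *m Q ^t*) i i).
  apply: eq_bigr => i _; rewrite raddf_sum mxE /=; apply: eq_bigr => l _.
  by rewrite sqr_normcE mxE_trC.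
under eq_bigr do rewrite QQ mxE eqxx.
by rewrite sumr_const card_ord rmorph_nat.
Qed.

(** The hypothesis says that the rank-one matrices of the u_j add up to diag(w), so the left side is
    the trace of Q diag(w) times the adjoint of Q. *)
Lemma sum_sqnorm_mul (N : nat) (u : 'I_N -> 'cV[C]_m) (w : 'I_m -> R) :
  (forall l l', \sum_j u j l 0 * conjc (u j l' 0) =
    if l == l' then ((w l)%:C)%C else 0) ->
  \sum_j \sum_i normc ((Q *m u j) i 0) ^+ 2 = \sum_l leverage l * w l.
Proof.
move=> uE; apply: (@complexI R); rewrite !raddf_sum /=.
transitivity (\sum_j \sum_i \sum_l \sum_l' (Q i l * conjc (Q i l')) *
    (u j l 0 * conjc (u j l' 0))).
  apply: eq_bigr => j _; rewrite raddf_sum; apply: eq_bigr => i _ /=.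
  rewrite sqr_normcE mxE raddf_sum mulr_suml; apply: eq_bigr => l _.
  by rewrite mulr_sumr; apply: eq_bigr => l' _ /=; rewrite rmorphM /= mulrACA.
rewrite exchange_big /=.
transitivity (\sum_(i < r) \sum_l (Q i l * conjc (Q i l)) * ((w l)%:C)%C).
  apply: eq_bigr => i _; rewrite exchange_big; apply: eq_bigr => l _ /=.
  rewrite exchange_big (bigD1 l)//= -mulr_sumr uE eqxx.
  rewrite big1 ?addr0// => l' ll'.
  by rewrite -mulr_sumr uE eq_sym (negbTE ll') mulr0.
rewrite exchange_big; apply: eq_bigr => l _ /=.
rewrite rmorphM /= raddf_sum mulr_suml; apply: eq_bigr => i _.
by rewrite /= sqr_normcE.
Qed.

End Projection.

(** * Fooling functions and averaging over lattice nodes *)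

Section LowerBound.
Variables (R : realType) (om : R) (a b : nat -> R).
Hypothesis om0 : 0 < om.
Local Notation C := R[i].
Local Notation normc := (@ComplexField.Normc.normc R).
Local Notation e := (@cexp2pi R).
Variables (d : nat) (B : R).
Local Notation weight := (@weight R om a b d).
Hypothesis weightB : forall M, boxsum weight M <= B.

Definition monomial (h0 : Zd d) : Zd d -> C := fun h => (h == h0)%:R.

Lemma csum_single (T : choiceType) (t0 : T) (w : C) :
  csum (fun t => if t == t0 then w else 0) = w.
Proof.
have single (r : R) : (\esum_(t in [set: T]) (Num.max (if t == t0 then r else 0) 0)%:E
    = (Num.max r 0)%:E)%E.
  rewrite (@esum_finsupp _ _ unit (fun=> t0)).
  - by rewrite (bigD1 tt)//= big1 ?addr0 ?eqxx.
  - by case=> [] [].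
  - by move=> t; exact: max0_ge0.
  - by move=> t /(_ tt)/nesym/eqP/negbTE->; rewrite maxxx.
have rs (r : R) : rsum (fun t => if t == t0 then r else 0) = r.
  rewrite /rsum single; under eq_esum do rewrite -[- (if _ then _ else _)](@mulN1r R).
  have -> : (fun t => (Num.max (-1 * (if t == t0 then r else 0)) 0)%:E) =
      (fun t : T => (Num.max (if t == t0 then - r else 0) 0)%:E).
    by apply/funext => t; case: ifP; rewrite ?mulr0 ?mulN1r.
  by rewrite single /= -subr_max_opp.
rewrite /csum; case: w => x y.
have -> : (fun t => complex.Re (if t == t0 then (x +i* y)%C else 0)) =
  (fun t => if t == t0 then x else 0) by apply/funext => t; case: ifP.
have -> : (fun t => complex.Im (if t == t0 then (x +i* y)%C else 0)) =
  (fun t => if t == t0 then y else 0) by apply/funext => t; case: ifP.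
by rewrite !rs.
Qed.

Lemma fval_monomial h x : fval (monomial h) x = e (dotp h x).
Proof.
rewrite /fval -[RHS](csum_single h); congr csum; apply/funext => h'.
by rewrite /monomial; case: eqP => [->|_]; rewrite ?mul1r ?mul0r.
Qed.

Section FiniteSupport.
Variables (I : finType) (H : I -> Zd d).
Hypothesis Hinj : injective H.

Definition trigpoly (s : seq I) (u : I -> C) : Zd d -> C :=
  fun h => \sum_(i <- s) u i * monomial (H i) h.

Lemma trigpoly_out s u h : (forall i, H i <> h) -> trigpoly s u h = 0.
Proof.
move=> hH; rewrite /trigpoly big1// => i _.
by rewrite /monomial; case: eqP => [hi|_]; [case: (hH i)|rewrite mulr0].
Qed.

Lemma trigpolyE u i : trigpoly (index_enum I) u (H i) = u i.
Proof.
rewrite /trigpoly (bigD1 i)//= /monomial eqxx mulr1 big1 ?addr0// => j ji.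
by rewrite (inj_eq Hinj) eq_sym (negbTE ji) mulr0.
Qed.

Lemma sqnorm_finsupp (c : Zd d -> C) : (forall h, (forall i, H i <> h) -> c h = 0) ->
  sqnorm om a b c = ((\sum_i normc (c (H i)) ^+ 2 / weight (H i))%:E)%E.
Proof.
move=> cH; rewrite /sqnorm (esum_finsupp Hinj)// => h; first exact: sqnormE_ge0.
by move=> /cH ->; rewrite ComplexField.Normc.normc0 expr0n mul0r.
Qed.

Lemma inH_trigpoly s u : inH om a b (trigpoly s u).
Proof. by rewrite /inH sqnorm_finsupp ?ltry// => h; exact: trigpoly_out. Qed.

Lemma Lall_trigpoly L s u : in_Lambda om a b (d := d) Lall L ->
  L (trigpoly s u) = \sum_(i <- s) u i * L (monomial (H i)).
Proof.
move=> [Llin _]; elim: s => [|i s IH].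
  rewrite big_nil; have z : inH om a b (trigpoly [::] u) by exact: inH_trigpoly.
  have := Llin 1 _ _ z z; rewrite mul1r.
  have -> : (fun h => 1 * trigpoly [::] u h + trigpoly [::] u h) = trigpoly [::] u.
    by apply/funext => h; rewrite /trigpoly !big_nil mulr0 addr0.
  by move/eqP; rewrite -subr_eq subrr eq_sym => /eqP.
have -> : trigpoly (i :: s) u = (fun h => u i * monomial (H i) h + trigpoly s u h).
  by apply/funext => h; rewrite /trigpoly big_cons.
have m1 : monomial (H i) = trigpoly [:: i] (fun=> 1).
  by apply/funext => h; rewrite /trigpoly big_seq1 mul1r.
have mH : inH om a b (monomial (H i)) by rewrite m1; exact: inH_trigpoly.
by rewrite big_cons -IH Llin//; exact: inH_trigpoly.
Qed.

Lemma fval_trigpoly s u x : cube x ->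
  fval (trigpoly s u) x = \sum_(i <- s) u i * e (dotp (H i) x).
Proof.
move=> cx; rewrite (@Lall_trigpoly (fun c => fval c x)).
  by apply: eq_bigr => i _; rewrite fval_monomial.
exact: (in_Lambda_std om0 weightB).
Qed.

End FiniteSupport.

Lemma min_error_lt cls n (E : R) : (min_error om a b d cls n < E%:E)%E ->
  exists (Ls : 'I_n -> (Zd d -> C) -> C) (phi : ('I_n -> C) -> ('I_d -> R) -> C),
  (forall i, in_Lambda om a b Lall (Ls i)) /\
  (alg_error om a b (fun c => phi (fun i => Ls i c)) < E%:E)%E.
Proof.
case: n => [p|n] /=.
  (* With n = 0 the minimal error is the initial error, which is the error of the zero algorithm. *)
  exists (fun _ _ => 0), (fun _ _ => 0); split; first by case.
  apply: le_lt_trans p; apply: ereal_sup_le => _ [c [x [c1 [cx ->]]]].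
  by exists c, x; rewrite subr0.
move=> /ereal_inf_lt[_ [Ls [phi [LsP ->]]] lt]; exists Ls, phi; split => // i.
exact: (in_Lambda_all om0 weightB (LsP i)).
Qed.

(* For f in the unit ball annihilated by the information, f and -f are
   indistinguishable, so the error is at least |f(x)|. *)
Lemma alg_error_ge n (Ls : 'I_n -> (Zd d -> C) -> C) phi (c : Zd d -> C) x :
  (forall i, in_Lambda om a b Lall (Ls i)) -> (forall i, Ls i c = 0) ->
  unitball om a b c -> cube x ->
  ((normc (fval c x))%:E <= alg_error om a b (fun c => phi (fun i => Ls i c)))%E.
Proof.
move=> LsP Lc c1 cx.
have cH := unitball_inH c1.
pose z : Zd d -> C := fun=> 0.
have z1 : inH om a b z.
  rewrite /inH /sqnorm esum1 ?ltry// => h _.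
  by rewrite /z ComplexField.Normc.normc0 expr0n mul0r.
pose c' : Zd d -> C := fun h => -1 * c h + z h.
have c'E h : c' h = - c h by rewrite /c' /z mulN1r addr0.
have Lz i : Ls i z = 0.
  have [Llin _] := LsP i; have := Llin 1 _ _ z1 z1; rewrite mul1r.
  have -> : (fun h => 1 * z h + z h) = z by apply/funext => h; rewrite /z mulr0 addr0.
  by move/eqP; rewrite -subr_eq subrr eq_sym => /eqP.
have Lc' i : Ls i c' = 0.
  by have [Llin _] := LsP i; rewrite Llin// Lc Lz mulr0 addr0.
have c'1 : unitball om a b c'.
  rewrite /unitball /sqnorm; under eq_esum do rewrite c'E normcN.
  exact: c1.
have fz : fval z x = 0.
  have [Llin _] := in_Lambda_std om0 weightB Lall cx.
  have := Llin 1 _ _ z1 z1; rewrite mul1r.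
  have -> : (fun h => 1 * z h + z h) = z by apply/funext => h; rewrite /z mulr0 addr0.
  by move/eqP; rewrite -subr_eq subrr eq_sym => /eqP.
have fc' : fval c' x = - fval c x.
  by rewrite (fval_lin om0 weightB)// fz addr0 mulN1r.
set A := fun c => _.
have Ac : A c' x = A c x.
  rewrite /A; have -> : (fun i => Ls i c') = (fun i => Ls i c) by apply/funext => i; rewrite Lc' Lc.
  by [].
have U c0 : unitball om a b c0 -> ((normc (fval c0 x - A c0 x))%:E <= alg_error om a b A)%E.
  by move=> c01; apply: ereal_sup_ubound; exists c0, x.
have := U _ c1; have := U _ c'1; rewrite Ac fc'.
set v := A c x; set f := fval c x => h1 h2.
have : 2 * normc f <= normc (f - v) + normc (- f - v).
  have -> : normc (- f - v) = normc (f + v) by rewrite -opprD normcN.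
  apply: le_trans (@le_normcD R _ _).
  by rewrite addrACA addNr addr0 -mulr2n normcMn mulr_natl.
have [h3|h3] := leP (normc f) (normc (f - v)).
  by move=> _; apply: le_trans h2; rewrite lee_fin.
move=> h4; apply: le_trans h1; rewrite lee_fin; lra.
Qed.

(** For each node y, the reproducing kernel at y, restricted to the frequencies [H], is projected
    onto the common kernel of the functionals. The value at y and the squared norm of the result are
    both G(y), so fooling gives G(y) <= E^2. In the mean over the nodes the exponentials of distinct
    frequencies are orthogonal, which leaves only the leverage scores. *)
Lemma lower_bound cls n (E : R) (I : finType) (H : I -> Zd d) :
  injective H -> 0 < E -> (min_error om a b d cls n < E%:E)%E ->
  exists q : I -> R, [/\ forall i, 0 <= q i <= 1, \sum_i q i <= n%:R &
    \sum_i weight (H i) * (1 - q i) <= E ^+ 2].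
Proof.
move=> Hinj E0 /min_error_lt[Ls [phi [LsP errE]]].
pose M := (\max_i \max_k `|H i k|)%N.
have HM i k : (`|H i k| <= M)%N.
  apply: (@leq_trans (\max_k `|H i k|)%N); first by rewrite (leq_bigmax k).
  by rewrite /M (leq_bigmax (F := fun i => (\max_k `|H i k|)%N)).
have [z zP] := reconstructing_lattice Hinj HM.
set N := ((2 * M + 1) * (#|I| ^ 2 + 1))%N in zP.
have N0 : (0 < N)%N by rewrite muln_gt0 !addn1.
pose y (j : 'I_N) := lattice_node R N z j : 'I_d -> R.
have cy j : cube (y j) by exact: cube_lattice_node.
pose ev := @enum_val I xpredT; pose er := @enum_rank I.
pose sw i := ((Num.sqrt (weight (H i)))%:C)%C.
have swj i : conjc (sw i) = sw i by rewrite conjc_real.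
have cM (v w : C) : conjc (v * w) = conjc v * conjc w by exact: rmorphM.
have sw2 i : sw i * sw i = ((weight (H i))%:C)%C.
  by rewrite -rmorphM /= -expr2 sqr_sqrtr// ltW ?weight_gt0.
(* The functionals in the orthonormal basis of scaled exponentials w_h^(1/2) e(h . x). *)
pose L : 'M[C]_(n, #|I|) := \matrix_(i, l) (Ls i (monomial (H (ev l))) * sw (ev l)).
have [r [Q [rn QQ] [X LX]]] := orthonormal_row_basis L.
(* Coordinates in that basis of the truncated reproducing kernel at x. *)
pose u x : 'cV[C]_(#|I|) := \col_l (sw (ev l) * conjc (e (dotp (H (ev l)) x))).
pose g x := coproj Q (u x).
pose G x := \sum_l normc (g x l 0) ^+ 2.
have G0 x : 0 <= G x by apply: sumr_ge0 => l _; exact: sqr_ge0.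
pose c x := trigpoly H (index_enum I) (fun i => g x (er i) 0 * sw i).
have evK i : ev (er i) = i by exact: enum_rankK.
have reI (V : nmodType) (F : 'I_#|I| -> V) : \sum_l F l = \sum_i F (er i).
  by rewrite (reindex er)//; exists ev => l _; [exact: evK|exact: enum_valK].
have Lc x i : Ls i (c x) = 0.
  rewrite /c (Lall_trigpoly Hinj)//.
  transitivity ((L *m g x) i 0); last first.
    by rewrite LX -mulmxA mul_coproj// mulmx0 mxE.
  rewrite mxE reI; apply: eq_bigr => l _.
  by rewrite [L _ _]mxE evK; ring.
have cG x : sqnorm om a b (c x) = ((G x)%:E)%E.
  rewrite (sqnorm_finsupp Hinj) => [|h]; last exact: trigpoly_out.
  congr (_%:E)%E; rewrite /G reI; apply: eq_bigr => i _.
  rewrite /c trigpolyE// ComplexField.Normc.normcM exprMn.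
  rewrite -[RHS]mulr1 -mulrA; congr (_ * _).
  have -> : normc (sw i) = Num.sqrt (weight (H i)).
    by rewrite /sw /= expr0n addr0 sqrtr_sqr ger0_norm ?sqrtr_ge0.
  by rewrite sqr_sqrtr ?divff// ?gt_eqF ?weight_gt0// ltW ?weight_gt0.
have fcG j : fval (c (y j)) (y j) = ((G (y j))%:C)%C.
  rewrite /c (fval_trigpoly Hinj)// /G -(sum_mul_conj_coproj QQ) reI.
  apply: eq_bigr => i _; rewrite [u (y j) _ _]mxE evK.
  by rewrite cM swj conjcK mulrA.
have GE2 j : G (y j) <= E ^+ 2.
  have [->|Gn0] := eqVneq (G (y j)) 0; first exact: sqr_ge0.
  have Gp : 0 < G (y j) by rewrite lt_neqAle eq_sym Gn0 G0.
  pose t := Num.sqrt (G (y j)); have t0 : 0 < t by rewrite sqrtr_gt0.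
  have t2 : t ^+ 2 = G (y j) by rewrite sqr_sqrtr.
  have tC : normc ((t^-1)%:C)%C = t^-1.
    by rewrite /= expr0n addr0 sqrtr_sqr ger0_norm// invr_ge0 ltW.
  have cH : inH om a b (c (y j)) by rewrite /inH cG ltry.
  (* Linearity of functionals is stated for al c1 + c2, so rescaling by t^-1 needs a zero second
     summand. *)
  pose zz := trigpoly H [::] (fun=> 0 : C).
  have zz1 : inH om a b zz by exact: inH_trigpoly.
  have zz0 h : zz h = 0 by rewrite /zz /trigpoly big_nil.
  pose c1 : Zd d -> C := fun h => ((t^-1)%:C)%C * c (y j) h + zz h.
  have c11 : unitball om a b c1.
    rewrite /unitball (sqnorm_finsupp Hinj) => [|h hH]; last first.
      by rewrite /c1 zz0 addr0 /c trigpoly_out// mulr0.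
    rewrite lee_fin.
    have -> : \sum_i normc (c1 (H i)) ^+ 2 / weight (H i) =
        t^-1 ^+ 2 * \sum_i normc (c (y j) (H i)) ^+ 2 / weight (H i).
      rewrite mulr_sumr; apply: eq_bigr => i _.
      by rewrite /c1 zz0 addr0 ComplexField.Normc.normcM tC exprMn -[LHS]mulrA.
    have := cG (y j); rewrite (sqnorm_finsupp Hinj) => [[->]|h]; last exact: trigpoly_out.
    by rewrite -t2 exprVn mulVf// expf_neq0// gt_eqF.
  have zzL L0 : in_Lambda om a b Lall L0 -> L0 zz = 0.
    by move=> L0P; rewrite /zz (Lall_trigpoly Hinj)// big_nil.
  have Lc1 i : Ls i c1 = 0.
    by have [Llin _] := LsP i; rewrite Llin// Lc zzL// mulr0 addr0.
  have fc1 : normc (fval c1 (y j)) = t.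
    have fzz : fval zz (y j) = 0 by rewrite /zz (fval_trigpoly Hinj)// big_nil.
    rewrite (fval_lin om0 weightB)// fzz addr0.
    rewrite fcG -rmorphM /= expr0n addr0 sqrtr_sqr -t2 expr2 mulKf ?gt_eqF//.
    by rewrite ger0_norm// ltW.
  have := alg_error_ge phi LsP Lc1 c11 (cy j); rewrite fc1 => h1.
  have : t < E by rewrite -lte_fin; exact: le_lt_trans h1 errE.
  by move=> tE; rewrite -t2 ler_pXn2r// ?nnegrE ltW.
exists (fun i => leverage Q (er i)); split.
- by move=> i; rewrite leverage_ge0 leverage_le1.
- by rewrite -(reI _ (leverage Q)) sum_leverage// ler_nat.
have GE j : G (y j) = \sum_i weight (H i) - \sum_i normc ((Q *m u (y j)) i 0) ^+ 2.
  rewrite /G sqnorm_coproj//; congr (_ - _).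
  rewrite reI; apply: eq_bigr => i _; apply: (@complexI R).
  rewrite sqr_normcE [u (y j) _ _]mxE evK cM swj conjcK.
  rewrite mulrACA [conjc _ * _]mulrC sw2 -sqr_normcE normc_cexp2pi expr1n.
  by rewrite mulr1.
have avg : \sum_j G (y j) = N%:R * \sum_i weight (H i) * (1 - leverage Q (er i)).
  under eq_bigr do rewrite GE.
  rewrite sumrB sumr_const card_ord.
  rewrite (@sum_sqnorm_mul _ _ _ Q N (fun j => u (y j)) (fun l => N%:R * weight (H (ev l)))).
    rewrite reI mulr_sumr -[X in X - _]mulr_natl mulr_sumr -sumrB.
    by apply: eq_bigr => i _; rewrite evK; ring.
  move=> l l'; under eq_bigr do rewrite !mxE cM swj conjcK.
  under eq_bigr do rewrite mulrACA [conjc _ * _]mulrC.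
  rewrite -mulr_sumr sum_cexp2pi_node//.
  have [<-|ll'] := eqVneq l l'.
    have -> : ((N%:R * weight (H (ev l)))%:C)%C = N%:R * ((weight (H (ev l)))%:C)%C.
      by rewrite mulr_natl raddfMn mulr_natl.
    by rewrite subrr dvdz0 sw2 mulrC.
  rewrite ifN ?mulr0//; apply: zP; apply: contra ll' => /eqP h.
  by rewrite eq_sym; apply/eqP/enum_val_inj.
have : \sum_(j < N) G (y j) <= \sum_(j < N) E ^+ 2 by apply: ler_sum => j _; exact: GE2.
rewrite avg sumr_const card_ord -[leRHS]mulr_natl ler_pM2l//.
by rewrite ltr0n.
Qed.

End LowerBound.

(** * Weights *)

Lemma sum_symmetric_range (V : zmodType) (f : int -> V) M :
  \sum_(j < (2 * M).+1) f ((j : nat)%:Z - M%:Z) =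
  f 0 + \sum_(m < M) f m.+1%:Z + \sum_(m < M) f (- m.+1%:Z).
Proof.
rewrite -(big_mkord xpredT (fun j : nat => f (j%:Z - M%:Z))).
rewrite (big_cat_nat (n := M))//=; last by lia.
rewrite big_rev_mkord subn0 addrC; congr (_ + _).
  rewrite big_ltn ?subrr; last by lia.
  congr (_ + _); rewrite -{1}[M.+1]add0n big_addn.
  have -> : ((2 * M).+1 - M.+1 = M)%N by lia.
  by rewrite big_mkord; apply: eq_bigr => m _; congr f; lia.
by apply: eq_bigr => m _; congr f; have := ltn_ord m; lia.
Qed.

Section Weights.
Variables (R : realType) (om : R) (a b : nat -> R) (b0 : R).
Hypothesis hom : 0 < om < 1.
Hypothesis ha1 : 0 < a 1%N.
Hypothesis hamono : forall j : nat, (1 <= j)%N -> a j <= a j.+1.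
Hypothesis hb0 : 0 < b0.
Hypothesis hb : forall j : nat, (1 <= j)%N -> b0 <= b j.

Let om0 : 0 < om. Proof. by case/andP: hom. Qed.
Let om1 : om < 1. Proof. by case/andP: hom. Qed.

Definition decay : R := - ln om.

Lemma decay_gt0 : 0 < decay. Proof. by rewrite oppr_gt0 ln_lt0. Qed.

Lemma powR_decay y : om `^ y = expR (- (decay * y)).
Proof. by rewrite /powR gt_eqF// /decay mulNr opprK mulrC. Qed.

Lemma a_mono i j : (1 <= i)%N -> (i <= j)%N -> a i <= a j.
Proof.
move=> i1 /subnK <-; elim: (j - i)%N => [//|k IH].
by rewrite addSn (le_trans IH)// hamono// (leq_trans i1) ?leq_addl.
Qed.

Lemma a_gt0 j : (1 <= j)%N -> 0 < a j.
Proof. by move=> j1; apply: lt_le_trans ha1 _; exact: a_mono. Qed.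

Lemma powR_om_le x y : x <= y -> om `^ y <= om `^ x.
Proof. by move=> xy; apply: ger_powR => //; rewrite om0 ltW. Qed.

Lemma powR_om_sum (I : Type) (r : seq I) (F : I -> R) :
  om `^ (\sum_(i <- r) F i) = \prod_(i <- r) om `^ F i.
Proof.
elim: r => [|i r IH]; first by rewrite !big_nil powRr0.
by rewrite !big_cons powRD ?IH// (gt_eqF om0) implybT.
Qed.

(** Coordinate k contributes the factor 1 + rho to the sum of weight^tau over the box: 1 from the
    zero frequency, and the factor 2 from the two signs. *)
Definition rho (tau : R) (k M : nat) : R :=
  2 * \sum_(m < M) om `^ (tau * (a k.+1 * m.+1%:R `^ b k.+1)).

Lemma rho_ge0 tau k M : 0 <= rho tau k M.
Proof. by rewrite mulr_ge0// sumr_ge0// => i _; exact: powR_ge0. Qed.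

Definition wsum (tau : R) (d M : nat) : R :=
  boxsum (fun h : Zd d => weight om a b h `^ tau) M.

Lemma wsumE tau d M : wsum tau d M = \prod_(k < d) (1 + rho tau k M).
Proof.
pose f (k : nat) (m : int) := om `^ (tau * (a k.+1 * `|m%:~R| `^ b k.+1)).
have -> : wsum tau d M =
    \sum_(i : {ffun 'I_d -> 'I_(2 * M).+1}) \prod_(k < d) f k ((i k : nat)%:Z - M%:Z).
  apply: eq_bigr => i _; rewrite /weight -powRrM mulrC mulr_sumr powR_om_sum.
  by apply: eq_bigr => k _; rewrite /f ffunE.
rewrite -(bigA_distr_bigA (fun (k : 'I_d) (j : 'I_(2 * M).+1) => f k ((j : nat)%:Z - M%:Z))).
apply: eq_bigr => k _; rewrite sum_symmetric_range.
have bk : b k.+1 != 0 by rewrite gt_eqF// (lt_le_trans hb0) ?hb.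
have -> : f k 0 = 1 by rewrite /f normr0 powR0// !mulr0 powRr0.
have fp m : f k m.+1%:Z = om `^ (tau * (a k.+1 * m.+1%:R `^ b k.+1)).
  by rewrite /f -pmulrn ger0_norm.
have fn m : f k (- m.+1%:Z) = f k m.+1%:Z by rewrite /f mulrNz normrN.
under [X in _ + X]eq_bigr do rewrite fn.
by rewrite -addrA -mulr2n -mulr_natl /rho; under eq_bigr do rewrite fp.
Qed.

Lemma wsum_ge1 tau d M : 1 <= wsum tau d M.
Proof.
rewrite wsumE; elim/big_rec: _ => // k x _ x1.
by rewrite mulrDl mul1r (le_trans x1)// lerDl mulr_ge0 ?rho_ge0// (le_trans ler01).
Qed.

(* From [v^p / p! <= exp v] with [v = decay * theta * m^b]. *)
Lemma powR_om_bound (p : nat) (be theta : R) (m : nat) :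
  2 <= p.+1%:R * b0 -> b0 <= be -> 0 < theta ->
  om `^ (theta * m.+1%:R `^ be) <= p.+1`!%:R / (decay * theta) ^+ p.+1 / m.+1%:R ^+ 2.
Proof.
move=> pb bbe th0; rewrite powR_decay.
have dt : 0 < decay * theta by rewrite mulr_gt0 ?decay_gt0.
have m0 : (0 : R) < m.+1%:R by rewrite ltr0n.
have mb : 0 < m.+1%:R `^ be by exact: powR_gt0.
set v := decay * _; have v0 : 0 < v by rewrite /v mulrA mulr_gt0.
have vp : 0 < v ^+ p.+1 by exact: exprn_gt0.
apply: (@le_trans _ _ (p.+1`!%:R / v ^+ p.+1)).
  rewrite expRN ler_pdivlMr// ler_pdivrMl ?expR_gt0//.
  rewrite -ler_pdivrMr ?ltr0n ?fact_gt0//.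
  by apply: le_trans (expR_ge1Dxn p (ltW v0)); rewrite lerDr.
have -> : forall x y z : R, x / y / z = x * (y * z)^-1.
  by move=> x y z; rewrite invfM mulrA.
rewrite ler_wpM2l// lef_pV2 ?posrE ?mulr_gt0 ?exprn_gt0//.
rewrite /v mulrA [leRHS]exprMn ler_wpM2l//; first by rewrite exprn_ge0// ltW.
(* Here (m^be)^(p+1) >= m^2, because be (p + 1) >= 2 and m is at least 1. *)
rewrite -!powR_mulrn ?powR_ge0// -powRrM; apply: ler_powR; first by rewrite ler1n.
by apply: le_trans pb _; rewrite mulrC ler_wpM2r.
Qed.

Lemma sum_inv_sqr M : \sum_(m < M) (m.+1%:R ^+ 2)^-1 <= 2 :> R.
Proof.
case: M => [|M]; first by rewrite big_ord0.
(* Strengthened so that the induction telescopes: 1/(y+1)^2 + 1/(y+1) <= 1/y. *)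
suff : \sum_(m < M.+1) (m.+1%:R ^+ 2)^-1 + M.+1%:R^-1 <= 2 :> R.
  by apply: le_trans; rewrite lerDl invr_ge0.
elim: M => [|M IH]; first by rewrite big_ord1 expr1n invr1; lra.
rewrite big_ord_recr /=; apply: le_trans IH; rewrite -addrA lerD2l.
have h : (1 : R) <= M.+1%:R by rewrite ler1n.
have -> : M.+2%:R = M.+1%:R + 1 :> R by rewrite -natr1.
set y := M.+1%:R in h *.
have y0 : 0 < y by exact: lt_le_trans h.
have y1 : 0 < y + 1 by lra.
have -> : ((y + 1) ^+ 2)^-1 + (y + 1)^-1 = (y + 2) / (y + 1) ^+ 2.
  by field; rewrite gt_eqF.
rewrite ler_pdivrMr ?exprn_gt0// mulrC ler_pdivlMr//.
by rewrite sqrrD; nra.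
Qed.

(** The 4 is the 2 in [rho] times the 2 of [sum_inv_sqr]; the rest comes from [powR_om_bound]. *)
Definition rho_const (p : nat) : R := 4 * p.+1`!%:R / decay ^+ p.+1.

Lemma rho_const_ge0 p : 0 <= rho_const p.
Proof. by rewrite divr_ge0 ?mulr_ge0 ?exprn_ge0// ltW ?decay_gt0. Qed.

(** Suited to small tau: the loss is only a power of 1/tau, which costs a logarithm in ln S_tau. *)
Lemma rho_le_pow p tau k M : 2 <= p.+1%:R * b0 -> 0 < tau ->
  rho tau k M <= rho_const p / (tau * a k.+1) ^+ p.+1.
Proof.
move=> pb t0; have ak : 0 < a k.+1 by exact: a_gt0.
have ta : 0 < tau * a k.+1 by rewrite mulr_gt0.
set K := p.+1`!%:R / (decay * (tau * a k.+1)) ^+ p.+1 : R.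
have K0 : 0 <= K.
  by rewrite divr_ge0 ?exprn_ge0// ltW// mulr_gt0// decay_gt0.
have : rho tau k M <= 2 * \sum_(m < M) K * (m.+1%:R ^+ 2)^-1.
  rewrite /rho ler_pM2l//; apply: ler_sum => m _.
  by rewrite mulrA; apply: powR_om_bound => //; exact: hb.
move/le_trans; apply; rewrite -mulr_sumr.
apply: (@le_trans _ _ (2 * (K * 2))).
  by rewrite ler_pM2l// ler_wpM2l// sum_inv_sqr.
have dn : decay != 0 by rewrite gt_eqF// decay_gt0.
rewrite /K /rho_const exprMn le_eqVlt; apply/orP; left; apply/eqP.
by field; rewrite !expf_neq0// gt_eqF.
Qed.

(** For tau bounded below, keeps the exponential decay in a_k. With v = m^b >= 1, the inequality
    (tau a_k - tau0 a_1)(v - 1) >= 0 splits off om^(tau a_k) and leaves om^(tau0 a_1 v) to make the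
    sum over m converge. *)
Lemma rho_le_om p tau0 tau k M : 2 <= p.+1%:R * b0 -> 0 < tau0 -> tau0 <= tau ->
  rho tau k M <= rho_const p / (tau0 * a 1%N) ^+ p.+1 * om `^ (- (tau0 * a 1%N))
    * om `^ (tau * a k.+1).
Proof.
move=> pb t00 t0t; have ak : 0 < a k.+1 by exact: a_gt0.
have ta : 0 < tau0 * a 1%N by rewrite mulr_gt0.
set K := p.+1`!%:R / (decay * (tau0 * a 1%N)) ^+ p.+1 : R.
have K0 : 0 <= K.
  by rewrite divr_ge0 ?exprn_ge0// ltW// mulr_gt0// decay_gt0.
have : rho tau k M <= 2 * \sum_(m < M) (om `^ (tau * a k.+1) * om `^ (- (tau0 * a 1%N)) * K)
   * (m.+1%:R ^+ 2)^-1.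
  rewrite /rho ler_pM2l//; apply: ler_sum => m _.
  have mb1 : 1 <= m.+1%:R `^ b k.+1 :> R.
    rewrite -[leLHS](powRr0 m.+1%:R); apply: ler_powR; first by rewrite ler1n.
    by apply: ltW; apply: lt_le_trans hb0 (hb _).
  have tt : tau0 * a 1%N <= tau * a k.+1.
    by apply: ler_pM => //; [exact: ltW|exact: ltW|exact: a_mono].
  apply: (@le_trans _ _ (om `^ (tau * a k.+1 + - (tau0 * a 1%N) +
     tau0 * a 1%N * m.+1%:R `^ b k.+1))).
    by apply: powR_om_le; nra.
  have on0 : om != 0 by rewrite gt_eqF.
  have hK : om `^ (tau0 * a 1%N * m.+1%:R `^ b k.+1) <= K / m.+1%:R ^+ 2.
    by apply: powR_om_bound => //; exact: hb.
  rewrite !powRD ?on0 ?implybT// -[leRHS]mulrA.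
  by apply: ler_wpM2l hK; rewrite mulr_ge0 ?powR_ge0.
move/le_trans; apply; rewrite -mulr_sumr.
set W := om `^ (tau * _); set V := om `^ (- _).
have W0 : 0 <= W * V * K by rewrite /W /V mulr_ge0// mulr_ge0// powR_ge0.
apply: (@le_trans _ _ (2 * (W * V * K * 2))).
  by rewrite ler_pM2l// ler_wpM2l// sum_inv_sqr.
have dn : decay != 0 by rewrite gt_eqF// decay_gt0.
rewrite /K /rho_const exprMn le_eqVlt; apply/orP; left; apply/eqP.
by field; rewrite !expf_neq0// gt_eqF.
Qed.


Lemma wsum_lnE tau d M : wsum tau d M = expR (\sum_(k < d) ln (1 + rho tau k M)).
Proof.
rewrite wsumE expR_sum; apply: eq_bigr => k _; rewrite lnK// posrE.
by rewrite (lt_le_trans ltr01)// lerDl rho_ge0.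
Qed.

Lemma weight_le1 d (h : Zd d) : weight om a b h <= 1.
Proof.
rewrite /weight -[leRHS](powRr0 om); apply: powR_om_le; apply: sumr_ge0 => k _.
by rewrite mulr_ge0 ?powR_ge0// ltW ?a_gt0.
Qed.

Lemma weight_le_powR d (h : Zd d) tau : tau <= 1 -> weight om a b h <= weight om a b h `^ tau.
Proof. by move=> t1; apply: ger1_powR => //; rewrite weight_gt0// weight_le1. Qed.

Lemma boxsum_weight d M : boxsum (fun h : Zd d => weight om a b h) M = wsum 1 d M.
Proof. by apply: eq_bigr => i _; rewrite powRr1// ltW// weight_gt0. Qed.

Lemma weight_antitone d (h h' : Zd d) :
  (forall k, (`|h k| <= `|h' k|)%N) -> weight om a b h' <= weight om a b h.
Proof.
move=> hh; apply: powR_om_le; apply: ler_sum => k _; apply: ler_wpM2l.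
  by rewrite ltW ?a_gt0.
apply: ge0_ler_powR; rewrite ?nnegrE//.
  by apply: ltW; apply: lt_le_trans hb0 (hb _).
by rewrite -!intr_norm ler_int; have := hh k; lia.
Qed.

(** * Initial error and attainment of the infimum *)

Section NStar.
Variable d : nat.

(** The constant function 1 lies in the unit ball. Therefore NOR demands no more than ABS, and upper
    bounds can ignore the criterion. *)
Lemma init_error_ge1 : (1 <= init_error om a b d)%E.
Proof.
apply: ereal_sup_ubound; exists (monomial R 0), (fun=> 0); split; last split.
- pose H := fun _ : unit => 0 : Zd d.
  have Hinj : injective H by case=> [] [].
  rewrite /unitball (sqnorm_finsupp a b om0 Hinj) => [|h /(_ tt) h0]; last first.
    by rewrite /monomial; case: eqP => // hh; case: h0.
  rewrite lee_fin (bigD1 tt)//= big1 ?addr0; last by case.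
  rewrite /monomial eqxx ComplexField.Normc.normc1 expr1n /weight.
  rewrite big1 ?powRr0 ?invr1 ?mulr1// => k _.
  by rewrite ffunE normr0 powR0 ?mulr0// gt_eqF// (lt_le_trans hb0 (hb _)).
- by move=> k; rewrite lexx ler01.
- by rewrite fval_monomial normc_cexp2pi.
Qed.

Lemma CRI_ge1 cr : (1 <= CRI om a b d cr)%E.
Proof. by case: cr => //=; exact: init_error_ge1. Qed.

Lemma nat_infimum (P : set nat) : P !=set0 ->
  exists n, [/\ P n, forall m, P m -> (n <= m)%N &
    ereal_inf [set (k%:R%:E : \bar R) | k in P] = (n%:R)%:E].
Proof.
move=> [m0 Pm0].
have ex : exists n, (fun n => `[< P n >]) n by exists m0; apply/asboolP.
exists (ex_minn ex); case: ex_minnP => n /asboolP Pn min; split => // [m Pm|].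
  by apply: min; apply/asboolP.
apply/eqP; rewrite eq_le; apply/andP; split.
  by apply: ereal_inf_lbound; exists n.
apply: le_ereal_inf_tmp => _ [m Pm <-]; rewrite lee_fin ler_nat.
by apply: min; apply/asboolP.
Qed.

Lemma nstar_attained cls cr eps n : nstar om a b cls cr eps d = (n%:R)%:E ->
  (min_error om a b d cls n <= eps%:E * CRI om a b d cr)%E.
Proof.
rewrite /nstar; set P := [set n | _] => E.
have [P0|P0] := eqVneq P set0.
  by move: E; rewrite P0 image_set0 ereal_inf0.
have /nat_infimum[m [Pm _ Em]] : P !=set0 by exact/set0P.
by move: E; rewrite Em => -[/eqP]; rewrite eqr_nat => /eqP <-.
Qed.

End NStar.
End Weights.

(** * Bounds for the information complexity *)

Section UpperComplexity.
Variables (R : realType) (om : R) (a b : nat -> R) (b0 : R).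
Hypothesis hom : 0 < om < 1.
Hypothesis ha1 : 0 < a 1%N.
Hypothesis hamono : forall j : nat, (1 <= j)%N -> a j <= a j.+1.
Hypothesis hb0 : 0 < b0.
Hypothesis hb : forall j : nat, (1 <= j)%N -> b0 <= b j.

Let om0 : 0 < om. Proof. by case/andP: hom. Qed.

Variables (d : nat) (tau S : R).
Hypothesis htau : 0 < tau < 1.
Hypothesis hS : forall M, wsum om a b tau d M <= S.
Local Notation weight := (@weight R om a b d).

Let t0 : 0 < tau. Proof. by case/andP: htau. Qed.
Let t1 : tau < 1. Proof. by case/andP: htau. Qed.
Let w0 (h : Zd d) : 0 < weight h. Proof. exact: weight_gt0. Qed.

Lemma sum_powR_weight_le (I : finType) (H : I -> Zd d) : injective H ->
  \sum_i weight (H i) `^ tau <= S.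
Proof.
move=> Hinj; rewrite -lee_fin.
apply: le_trans (sum_le_esum (fun h => weight h `^ tau) Hinj) _.
by apply: esum_le_boxsum hS => h; exact: powR_ge0.
Qed.

(* Few indices have large weight; as the set of these is closed under
   shrinking a coordinate, this bounds their coordinates as well. *)
Lemma card_large_weight (la : R) (I : finType) (H : I -> Zd d) : injective H ->
  0 < la -> (forall i, la <= weight (H i)) -> #|I|%:R <= S * la `^ (- tau).
Proof.
move=> Hinj la0 HA; rewrite powRN ler_pdivlMr ?powR_gt0//.
apply: le_trans (sum_powR_weight_le Hinj).
rewrite mulr_natl -sumr_const; apply: ler_sum => i _.
by apply: ge0_ler_powR; rewrite ?nnegrE ?(ltW t0)// ltW.
Qed.

Lemma large_weight_bounded (la : R) (h : Zd d) k : 0 < la -> la <= weight h ->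
  (`|h k|.+1)%:R <= S * la `^ (- tau).
Proof.
move=> la0 hA.
pose H (j : 'I_(`|h k|%N).+1) : Zd d := [ffun l => if l == k then (j : nat)%:Z else 0].
have Hinj : injective H.
  move=> i j /ffunP /(_ k); rewrite !ffunE eqxx => -[] /val_inj.
  by [].
have := card_large_weight Hinj la0; rewrite card_ord; apply => i.
apply: le_trans hA _; apply: (weight_antitone hom ha1 hamono hb0 hb) => l.
rewrite ffunE; case: eqP => [->|//].
by have := ltn_ord i; rewrite ltnS.
Qed.

(** With X = S la^(-tau), the set of frequencies of weight at least [la] has at most X elements,
    with coordinates bounded by X, so the lattice has at most 3 X * 2 X^2 nodes. Below the threshold
    w <= la^(1 - tau) w^tau, which bounds the tail. *)
Lemma min_error_upper cls (la : R) : 0 < la -> la <= 1 -> 1 <= S ->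
  exists n : nat, [/\ (0 < n)%N, n%:R <= 6 * (S * la `^ (- tau)) ^+ 3 &
    (min_error om a b d cls n <= (4 * Num.sqrt (la `^ (1 - tau) * S))%:E)%E].
Proof.
move=> la0 la1 S1; set X := S * la `^ (- tau).
have X1 : 1 <= X.
  rewrite -[leLHS]mulr1; apply: ler_pM => //.
  rewrite -[leLHS](powRr0 la); apply: ger_powR; first by rewrite la0.
  by rewrite oppr_le0 ltW.
have X0 : 0 <= X by lra.
pose M := Num.truncn X.
pose I : finType := {i : {ffun 'I_d -> 'I_(2 * M).+1} | la <= weight (unbox i)}.
pose H (i : I) := unbox (val i).
have Hinj : injective H by move=> i j /unbox_inj /val_inj.
have HM (i : I) k : (`|H i k| <= M)%N by exact: unbox_bounded.
have cI : #|I|%:R <= X.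
  by apply: card_large_weight Hinj la0 _ => -[i iP]; exact: iP.
have MX : M%:R <= X by rewrite truncn_le.
have Hsurj h : la <= weight h -> exists i : I, H i = h.
  move=> hla; have [k|i ih] := @unbox_surj d M h _.
    rewrite truncn_ge_nat//; apply: le_trans (large_weight_bounded k la0 hla).
    by rewrite ler_nat.
  have iP : la <= weight (unbox i) by rewrite ih.
  by exists (exist _ i iP).
have weightB M' : boxsum weight M' <= S.
  apply: le_trans (hS M'); apply: ler_sum => i _.
  by apply: weight_le_powR => //; exact: ltW.
exists ((2 * M + 1) * (#|I| ^ 2 + 1))%N; split.
- by rewrite muln_gt0 !addn1.
- rewrite natrM (natrD _ (2 * M)) (natrD _ (#|I| ^ 2)) natrX natrM.
  move: (#|I|%:R : R) cI (ler0n R #|I|) (M%:R : R) MX (ler0n R M) => c cX c0 m mX m0.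
  apply: (@le_trans _ _ ((2 * X + X) * (X ^+ 2 + X ^+ 2))).
    by apply: ler_pM; nra.
  by rewrite le_eqVlt; apply/orP; left; apply/eqP; ring.
apply: (lattice_upper_bound om0 weightB cls Hinj HM) => M'.
apply: (@le_trans _ _ (la `^ (1 - tau) * wsum om a b tau d M')); last first.
  by apply: ler_wpM2l => //; exact: powR_ge0.
rewrite /wsum /boxsum mulr_sumr; apply: ler_sum => i _.
case: ifPn => [/forallP no|_]; last by rewrite mulr_ge0 ?powR_ge0.
have [hla|hla] := leP la (weight (unbox i)).
  by have [j ji] := Hsurj _ hla; have := no j; rewrite ji eqxx.
rewrite -{1}(powRr1 (ltW (w0 (unbox i)))).
have {1}-> : 1 = 1 - tau + tau by ring.
rewrite powRD; last by rewrite (gt_eqF (w0 _)) implybT.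
rewrite ler_wpM2r ?powR_ge0// ge0_ler_powR// ?nnegrE ?(ltW hla)//.
- by rewrite subr_ge0 ltW.
- exact: ltW.
- exact: ltW.
Qed.

End UpperComplexity.

(** * Upper bound for the logarithm of the information complexity *)

Section NStarUpper.
Variables (R : realType) (om : R) (a b : nat -> R) (b0 : R).
Hypothesis hom : 0 < om < 1.
Hypothesis ha1 : 0 < a 1%N.
Hypothesis hamono : forall j : nat, (1 <= j)%N -> a j <= a j.+1.
Hypothesis hb0 : 0 < b0.
Hypothesis hb : forall j : nat, (1 <= j)%N -> b0 <= b j.

Lemma ln2_le1 : ln 2 <= 1 :> R.
Proof. by have := @le_ln1Dx R 1; rewrite (_ : 1 + 1 = 2)//; apply; lra. Qed.

Lemma nstar_upper d cls cr eps tau L : 0 < eps < 1 -> 0 < tau < 1 ->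
  (forall M, \sum_(k < d) ln (1 + rho om a b tau k M) <= L) ->
  exists n : nat, nstar om a b cls cr eps d = (n%:R)%:E /\
    ln n%:R <= 3 + 3 / (1 - tau) * (2 * tau * ln eps^-1 + 4 * tau + L).
Proof.
move=> /andP[e0 e1] htau LP; have /andP[t0 t1] := htau.
have hS M : wsum om a b tau d M <= expR L.
  by rewrite (wsum_lnE a hom hb0 hb) ler_expR.
have S1 : 1 <= expR L by apply: le_trans (hS 0); exact: (wsum_ge1 a hom hb0 hb).
set x := ln eps^-1; have x0 : 0 < x by rewrite ln_gt0// invf_gt1.
have epsE : eps = expR (- x) by rewrite /x lnV ?posrE// opprK lnK.
have L0 : 0 <= L by rewrite -(expR0 R) ler_expR in S1.
(* The threshold la = e^(-l) solves 4 (la^(1 - tau) e^L)^(1/2) = eps. *)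
pose l := (2 * x + ln 16 + L) / (1 - tau).
have t1' : 0 < 1 - tau by lra.
have l16 : 0 <= ln (16 : R) <= 4.
  rewrite ln_ge0/=; last by lra.
  have -> : 16 = 2 ^+ 4 :> R by ring.
  by rewrite lnXn//; have := ln2_le1; lra.
have l0 : 0 <= l by rewrite divr_ge0 ?ltW//; lra.
have la0 : 0 < expR (- l) by exact: expR_gt0.
have la1 : expR (- l) <= 1 by rewrite expR_le1 oppr_le0.
have [N [N0 NX errN]] := min_error_upper hom ha1 hamono hb0 hb htau hS cls la0 la1 S1.
have errN' : (min_error om a b d cls N <= eps%:E)%E.
  apply: le_trans errN _; rewrite lee_fin -expRM -expRD.
  have -> : - l * (1 - tau) + L = - (2 * x + ln 16) by rewrite /l; field; rewrite gt_eqF.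
  rewrite opprD expRD [expR (- ln 16)]expRN lnK ?posrE//.
  rewrite sqrtrM ?expR_ge0//.
  have -> : - (2 * x) = 2%:R * (- x) by ring.
  rewrite expRM_natl sqrtr_sqr ger0_norm ?expR_ge0// sqrtrV//.
  have -> : 16 = 4 ^+ 2 :> R by ring.
  rewrite sqrtr_sqr ger0_norm// mulrCA divff// mulr1 -epsE.
  exact: lexx.
have [n [nP nmin nE]] : exists n, [/\ [set n : nat | (min_error om a b d cls n <= eps%:E * CRI om a b d cr)%E] n,
    forall m, [set n : nat | (min_error om a b d cls n <= eps%:E * CRI om a b d cr)%E] m -> (n <= m)%N &
    nstar om a b cls cr eps d = (n%:R)%:E].
  apply: nat_infimum; exists N => /=; apply: le_trans errN' _.
  rewrite -[leLHS]mule1 lee_pmul2l ?lte_fin//; exact: (CRI_ge1 a hom hb0 hb).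
exists n; split => //.
have nN : (n <= N)%N.
  apply: nmin => /=; apply: le_trans errN' _.
  rewrite -[leLHS]mule1 lee_pmul2l ?lte_fin//; exact: (CRI_ge1 a hom hb0 hb).
(* As ln 0 = 0 by convention, n = 0 only needs a nonnegative right side. *)
case: n nN {nP nmin nE} => [|n] nN.
  rewrite ln0//.
  apply: addr_ge0 => //; apply: mulr_ge0; first by rewrite divr_ge0// ltW.
  by rewrite !addr_ge0// ?mulr_ge0// ltW.
have P0 : 0 < 6 * (expR L * expR (- l) `^ (- tau)) ^+ 3.
  by rewrite mulr_gt0// exprn_gt0// mulr_gt0 ?expR_gt0 ?powR_gt0 ?expR_gt0.
apply: (@le_trans _ _ (ln (6 * (expR L * expR (- l) `^ (- tau)) ^+ 3))).
  by rewrite ler_ln ?posrE ?ltr0n//; apply: le_trans NX; rewrite ler_nat.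
rewrite -expRM -expRD lnM ?posrE ?exprn_gt0 ?expR_gt0// lnXn ?expR_gt0// expRK.
have l6 : ln 6 <= 3 :> R.
  apply: (@le_trans _ _ (ln (2 ^+ 3))); first by rewrite ler_ln ?posrE//; lra.
  by rewrite lnXn//; have := ln2_le1; lra.
apply: lerD => //; rewrite -[leLHS]mulr_natl.
have -> : 3%:R * (L + - l * - tau) = 3 / (1 - tau) * (2 * tau * x + tau * ln 16 + L).
  by rewrite /l; field; rewrite gt_eqF.
apply: ler_wpM2l; first by rewrite divr_ge0// ltW.
by nra.
Qed.

End NStarUpper.

(** * Lower bounds for the information complexity *)

Section LowerComplexity.
Variables (R : realType) (om : R) (a b : nat -> R) (b0 : R).
Hypothesis hom : 0 < om < 1.
Hypothesis ha1 : 0 < a 1%N.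
Hypothesis hamono : forall j : nat, (1 <= j)%N -> a j <= a j.+1.
Hypothesis hb0 : 0 < b0.
Hypothesis hb : forall j : nat, (1 <= j)%N -> b0 <= b j.

Let om0 : 0 < om. Proof. by case/andP: hom. Qed.
Local Notation rho := (rho om a b).
Local Notation wsum := (wsum om a b).

Lemma exponent_exists (c : R) : exists p : nat, c <= p.+1%:R * b0.
Proof.
exists (Num.truncn (c / b0)); rewrite -ler_pdivrMr//.
exact/ltW/truncnS_gt.
Qed.

Lemma wsum_bounded tau d : 0 < tau -> exists B, forall M, wsum tau d M <= B.
Proof.
move=> t0; have [p pb] := exponent_exists 2.
exists (\prod_(k < d) (1 + rho_const om p / (tau * a k.+1) ^+ p.+1)) => M.
rewrite (wsumE a hom hb0 hb); apply: ler_prod => k _.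
by rewrite addr_ge0 ?rho_ge0//= lerD2l (rho_le_pow hom ha1 hamono hb).
Qed.

Lemma le_rho tau k M M' : (M <= M')%N -> rho tau k M <= rho tau k M'.
Proof.
move=> /subnK <-; elim: (M' - M)%N => [//|n IH].
by rewrite addSn; apply: le_trans IH _; rewrite ler_pM2l// big_ord_recr lerDl powR_ge0.
Qed.

Lemma le_wsum tau d M M' : (M <= M')%N -> wsum tau d M <= wsum tau d M'.
Proof.
move=> MM'; rewrite !(wsumE a hom hb0 hb); apply: ler_prod => k _.
by rewrite addr_ge0 ?rho_ge0//= lerD2l le_rho.
Qed.

(** The supremum of the box sums need not be attained, and [lower_bound] takes a finite family; one
    box carrying half of the total is a substitute. *)
Lemma wsum_quasimax d : exists M0, (0 < M0)%N /\ forall M, wsum 1 d M <= 2 * wsum 1 d M0.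
Proof.
have [B BP] := wsum_bounded d (ltr01 : 0 < (1 : R)).
pose A := [set wsum 1 d M | M in [set: nat]].
have Aub : has_ubound A by exists B => _ [M _ <-].
have Asup : has_sup A by split => //; exists (wsum 1 d 0), 0%N.
have s1 : 1 <= sup A.
  apply: le_trans (wsum_ge1 a hom hb0 hb 1 d 0) _.
  by apply: ub_le_sup => //; exists 0%N.
have [|_ [M0 _ <-] hM0] := @sup_adherent R A (sup A / 2) _ Asup.
  by rewrite divr_gt0// (lt_le_trans ltr01).
(* The successor makes the radius positive, so that the box contains the frequencies 1 and -1, as
   [rho_ge] requires. *)
exists M0.+1; split => // M; apply: (@le_trans _ _ (sup A)).
  by apply: ub_le_sup => //; exists M.
by have := le_wsum 1 d (leqnSn M0); lra.
Qed.

(** Both criteria are at most 2 B^(1/2), ABS because B >= 1. The strict bound on E turns the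
    attained error bound into the strict one that [lower_bound] asks for. *)
Lemma lower_bound_nstar d cls cr eps B E n (I : finType) (H : I -> Zd d) :
  0 < eps -> (forall M, wsum 1 d M <= B) -> 2 * eps * Num.sqrt B < E ->
  nstar om a b cls cr eps d = (n%:R)%:E -> injective H ->
  exists q : I -> R, [/\ forall i, 0 <= q i <= 1, \sum_i q i <= n%:R &
    \sum_i weight om a b (H i) * (1 - q i) <= E ^+ 2].
Proof.
move=> e0 WB hE /nstar_attained errn Hinj.
have weightB M : boxsum (@weight R om a b d) M <= B by rewrite boxsum_weight.
have B1 : 1 <= B by apply: le_trans (WB 0); exact: (wsum_ge1 a hom hb0 hb).
have E0 : 0 < E.
  by apply: le_lt_trans hE; rewrite !mulr_ge0 ?sqrtr_ge0// ltW.
apply: (lower_bound om0 weightB Hinj E0 (cls := cls)); apply: le_lt_trans errn _.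
apply: (@le_lt_trans _ _ (eps * (2 * Num.sqrt B))%:E); last first.
  by rewrite lte_fin mulrA [eps * 2]mulrC.
rewrite EFinM lee_pmul2l ?lte_fin//.
case: cr; last exact: (init_error_le om0 weightB).
rewrite lee_fin; have : 1 <= Num.sqrt B by rewrite -[leLHS]sqrtr1 ler_wsqrtr.
lra.
Qed.

(** At eps = 1/8, E = W^(1/2) / 2 is admissible because 2^(1/2) < 2, so at most the mass E^2 = W / 4
    is missed. *)
Lemma nstar_eighth_mass d cls cr n M0 : (forall M, wsum 1 d M <= 2 * wsum 1 d M0) ->
  nstar om a b cls cr 8^-1 d = (n%:R)%:E ->
  exists q : {ffun 'I_d -> 'I_(2 * M0).+1} -> R,
    [/\ forall i, 0 <= q i <= 1, \sum_i q i <= n%:R &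
    3 / 4 * wsum 1 d M0 <= \sum_i weight om a b (unbox i) * q i].
Proof.
move=> hM0 nP; set W := wsum 1 d M0 in hM0 *.
have W1 : 1 <= W by exact: (wsum_ge1 a hom hb0 hb).
have W0 : 0 < W by lra.
have sW : 0 < Num.sqrt W by rewrite sqrtr_gt0.
have hE : 2 * 8^-1 * Num.sqrt (2 * W) < Num.sqrt W / 2.
  rewrite sqrtrM//; have : Num.sqrt 2 < 2 :> R.
    by rewrite -[ltRHS]ger0_norm// -sqrtr_sqr ltr_sqrt//; lra.
  by nra.
have [q [q01 qn qE]] := lower_bound_nstar (ltac:(lra) : 0 < 8^-1) hM0 hE nP (@unbox_inj d M0).
exists q; split => //.
have E1 : \sum_i weight om a b (unbox i) * (1 - q i) +
    \sum_i weight om a b (unbox i) * q i = W.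
  rewrite /W -(boxsum_weight a b hom) -big_split /=; apply: eq_bigr => i _.
  by rewrite -mulrDr subrK mulr1.
move: qE; rewrite exprMn sqr_sqrtr ?(ltW W0)//.
by rewrite exprVn; lra.
Qed.

(** No weight exceeds 1, so n indices carry a mass of at most n. This turns tractability at a fixed
    eps into a bound for S_1. *)
Lemma nstar_eighth_ge d cls cr n M : nstar om a b cls cr 8^-1 d = (n%:R)%:E ->
  wsum 1 d M <= 4 * n%:R.
Proof.
have [M0 [_ hM0]] := wsum_quasimax d.
move=> /(nstar_eighth_mass hM0)[q [q01 qn qW]].
apply: le_trans (hM0 M) _.
have : \sum_i weight om a b (unbox i) * q i <= \sum_i q i.
  apply: ler_sum => i _; have /andP[q0 _] := q01 i.
  by rewrite ler_piMl// (weight_le1 b hom ha1 hamono).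
by move=> h; move: (wsum 1 d M0) qW => W qW; have := le_trans qW (le_trans h qn); have := ler0n R n; lra.
Qed.

(* With [la] the threshold such that the indices of weight above [la] carry
   at most a quarter of the mass, half of the mass needs 1 / (2 la) indices. *)
Lemma nstar_eighth_entropy d cls cr n de : 0 < de ->
  nstar om a b cls cr 8^-1 d = (n%:R)%:E ->
  exists M0, (0 < M0)%N /\
    de^-1 * (\sum_(k < d) (ln (1 + rho 1 k M0) - ln (1 + rho (1 + de) k M0)) - ln 4) - ln 2
     <= ln n%:R.
Proof.
move=> de0; have [M0 [M00 hM0]] := wsum_quasimax d.
move=> /(nstar_eighth_mass hM0)[q [q01 qn qW]]; exists M0; split => //.
rewrite sumrB; set SW := \sum_(k < d) ln _; set SV := \sum_(k < d) ln _.
set W := wsum 1 d M0 in qW.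
have WE : W = expR SW by rewrite /W (wsum_lnE a hom hb0 hb).
have VE : wsum (1 + de) d M0 = expR SV by exact: (wsum_lnE a hom hb0 hb).
(* Above the threshold w <= la^(-de) w^(1 + de), so that part of the mass is at most la^(-de) e^SV;
   la = e^(-l) makes this W / 4. *)
pose l := de^-1 * (SW - SV - ln 4).
pose la := expR (- l).
have la0 : 0 < la by exact: expR_gt0.
have laE : la `^ (- de) * expR SV = W / 4.
  rewrite /la -expRM -expRD mulrNN /l mulrAC mulVf ?gt_eqF// mul1r.
  have -> : SW - SV - ln 4 + SV = SW - ln 4 by ring.
  by rewrite expRB lnK ?posrE// WE.
have key : \sum_i weight om a b (unbox i) * q i <= la * n%:R + W / 4.
  apply: (@le_trans _ _ (la * (\sum_i q i) + la `^ (- de) * wsum (1 + de) d M0)).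
    rewrite mulr_sumr /wsum /boxsum [X in _ + X]mulr_sumr -big_split /=.
    apply: ler_sum => i _; have /andP[q0 q1] := q01 i.
    have w0 := weight_gt0 a b om0 (unbox i).
    set w := weight om a b _ in w0 *.
    have [wla|law] := leP w la.
      by rewrite -[leLHS]addr0 lerD ?mulr_ge0 ?powR_ge0// ler_wpM2r.
    rewrite -[leLHS]add0r lerD ?mulr_ge0// ?(ltW la0)//.
    apply: (@le_trans _ _ w); first by rewrite ler_piMr// ltW.
    rewrite powRD; last by rewrite (gt_eqF w0) implybT.
    rewrite (powRr1 (ltW w0)) mulrCA ler_pMr// powRN mulrC ler_pdivlMr ?powR_gt0//.
    by rewrite mul1r ge0_ler_powR ?nnegrE// ltW.
  by rewrite VE laE lerD2r ler_wpM2l// ltW.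
have W1 : 1 <= W by exact: (wsum_ge1 a hom hb0 hb).
move: qW; set Q := \sum_i _ in key * => qW.
clear VE laE WE; clearbody Q W SW SV.
have half : 1 / 2 <= la * n%:R by lra.
have n0 : 0 < n%:R :> R.
  by rewrite -(pmulr_rgt0 _ la0); lra.
have : ln (1 / 2) <= ln (la * n%:R).
  by rewrite ler_ln ?posrE ?mulr_gt0//; lra.
rewrite lnM ?posrE// /la expRK mul1r lnV ?posrE// -/l.
by lra.
Qed.

(** The r-element sets of coordinates give C(d,r) frequencies of weight at least la = om^(r a_d). If
    n < C(d,r), the sum of 1 - q over them is at least 1, hence la <= E^2. Taking E^2 as the
    midpoint of 4 eps^2 B and la contradicts this. *)
Lemma nstar_ge_binomial d r cls cr eps B n : (r <= d)%N -> (0 < d)%N -> 0 < eps ->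
  (forall M, wsum 1 d M <= B) -> 4 * eps ^+ 2 * B < om `^ (r%:R * a d) ->
  nstar om a b cls cr eps d = (n%:R)%:E -> ('C(d, r) <= n)%N.
Proof.
move=> rd d0 e0 WB hB nP; set la := om `^ _ in hB.
have la0 : 0 < la by exact: powR_gt0.
have B1 : 1 <= B by apply: le_trans (WB 0); exact: (wsum_ge1 a hom hb0 hb).
pose E := Num.sqrt ((4 * eps ^+ 2 * B + la) / 2).
have hp : 0 <= 4 * eps ^+ 2 * B by rewrite !mulr_ge0 ?sqr_ge0//; lra.
have E2 : E ^+ 2 < la by rewrite sqr_sqrtr; lra.
have hE : 2 * eps * Num.sqrt B < E.
  rewrite -[X in X < _]ger0_norm; last by rewrite !mulr_ge0 ?sqrtr_ge0// ltW.
  rewrite -sqrtr_sqr ltr_sqrt; last by lra.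
  rewrite !exprMn sqr_sqrtr; last by lra.
  have -> : 2 ^+ 2 = 4 :> R by ring.
  lra.
pose H (A : {set 'I_d}) : Zd d := [ffun k => (k \in A : nat)%:Z].
have Hinj : injective H.
  move=> A A' /ffunP AA; apply/setP => k; have := AA k; rewrite !ffunE.
  by case: (k \in A); case: (k \in A').
have [q [q01 qn qE]] := lower_bound_nstar e0 WB hE nP Hinj.
have wA (A : {set 'I_d}) : #|A| = r -> la <= weight om a b (H A).
  move=> Ar; apply: (powR_om_le hom).
  apply: (@le_trans _ _ (\sum_(k < d | k \in A) a k.+1)).
    rewrite [leRHS]big_mkcond /=; apply: ler_sum => k _.
    rewrite ffunE; case: (k \in A) => /=; first by rewrite normr1 powR1 mulr1.
    by rewrite normr0 powR0 ?mulr0// gt_eqF// (lt_le_trans hb0 (hb _)).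
  apply: (@le_trans _ _ (\sum_(k < d | k \in A) a d)).
    by apply: ler_sum => k _; apply: (a_mono hamono).
  by rewrite sumr_const Ar mulr_natl.
have : \sum_(A : {set 'I_d} | #|A| == r) la * (1 - q A) <= E ^+ 2.
  apply: le_trans qE; rewrite [leLHS]big_mkcond /=; apply: ler_sum => A _.
  have /andP[q0 q1] := q01 A.
  case: eqP => [/wA h|_]; first by rewrite ler_wpM2r// subr_ge0.
  by rewrite mulr_ge0 ?subr_ge0// ltW// weight_gt0.
rewrite -mulr_sumr sumrB sumr_const -cardsE card_draws card_ord => h.
have {h} : 'C(d, r)%:R - \sum_(A : {set 'I_d} | #|A| == r) q A < 1.
  rewrite -(ltr_pM2l la0) mulr1; exact: le_lt_trans h E2.
have : \sum_(A : {set 'I_d} | #|A| == r) q A <= n%:R.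
  apply: le_trans qn; rewrite [leLHS]big_mkcond /=; apply: ler_sum => A _.
  by case: ifP => // _; case/andP: (q01 A).
move=> h1 h2; rewrite leqNgt -ltnS; apply/negP => h3.
have : n%:R + 1 <= 'C(d, r)%:R :> R by rewrite natr1 ler_nat.
lra.
Qed.

End LowerComplexity.

(** * Growth estimates *)

Section Growth.
Variable R : realType.
Implicit Types (s t u v y eta p : R).

(** With u = ln y, one term of the series of e^(s u) = y^s gives ka u^(q+1) <= eta y^s. Either ka u
    >= 1, and u^q is below that, or u < 1/ka and u^q is below a constant. *)
Lemma pow_ln_small s (q : nat) eta : 0 < s -> 0 < eta ->
  exists2 C, 0 <= C & forall y, 1 <= y -> ln y ^+ q <= eta * y `^ s + C.
Proof.
move=> s0 eta0; pose ka := eta * (s ^+ q.+1 / q.+1`!%:R).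
have f0 : (0 : R) < q.+1`!%:R by rewrite ltr0n fact_gt0.
have ka0 : 0 < ka by rewrite mulr_gt0// divr_gt0// exprn_gt0.
exists (ka^-1 ^+ q) => [|y y1]; first by rewrite exprn_ge0// invr_ge0 ltW.
have y0 : 0 < y by lra.
set u := ln y; have u0 : 0 <= u by exact: ln_ge0.
have ys : y `^ s = expR (s * u) by rewrite /powR gt_eqF.
have h : ka * u ^+ q.+1 <= eta * y `^ s.
  rewrite /ka -mulrA ler_wpM2l ?(ltW eta0)//.
  rewrite mulrAC -exprMn ys; apply: le_trans (expR_ge1Dxn q (mulr_ge0 (ltW s0) u0)).
  by rewrite lerDr.
have [h1|h1] := leP 1 (ka * u).
  apply: (@le_trans _ _ (ka * u ^+ q.+1)); last first.
    by rewrite (le_trans h)// lerDl exprn_ge0// invr_ge0 ltW.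
  by rewrite exprS mulrA ler_peMl// exprn_ge0.
rewrite -[leLHS]add0r lerD//; first by rewrite mulr_ge0 ?powR_ge0// ltW.
by rewrite lerXn2r ?nnegrE ?invr_ge0 ?(ltW ka0)// -[leRHS]mul1r ler_pdivlMr// mulrC ltW.
Qed.

Lemma ge1_powR y p : 1 <= y -> 0 <= p -> 1 <= y `^ p.
Proof. by move=> y1 p0; rewrite -[leLHS](powRr0 y); apply: ler_powR. Qed.

(* Young's inequality in disguise: either [1 + ln v <= eta u^(p-1)], or [u] is
   bounded by a power of [1 + ln v]. *)
Lemma mul_ln_small p s eta : 1 < p -> 0 < s -> 0 < eta ->
  exists2 C, 0 <= C & forall u v, 1 <= u -> 1 <= v ->
    u * (1 + ln v) <= eta * (u `^ p + v `^ s) + C.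
Proof.
move=> p1 s0 eta0; have p10 : 0 < p - 1 by lra.
pose K := eta `^ (- (p - 1)^-1); have K0 : 0 < K by exact: powR_gt0.
pose N := (Num.truncn (1 + (p - 1)^-1)).+1.
(* As 1 + ln v = ln(e v), [pow_ln_small] is applied at e v, and the constant offsets the factor
   e^s. *)
pose e1 := expR 1 : R; have e10 : 0 < e1 by exact: expR_gt0.
have e11 : 1 <= e1 by have := expR_ge1Dx (1 : R); rewrite -/e1; lra.
have eta'0 : 0 < eta / (K * e1 `^ s) by rewrite divr_gt0// mulr_gt0// powR_gt0.
have [C C0 CP] := pow_ln_small N s0 eta'0.
exists (K * C) => [|u v u1 v1]; first by rewrite mulr_ge0// ltW.
have u0 : 0 < u by lra.
have v0 : 0 < v by lra.
set w := 1 + ln v; have w1 : 1 <= w by rewrite lerDl ln_ge0.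
have w0 : 0 < w by lra.
have vs0 : 0 <= v `^ s by exact: powR_ge0.
have [h|h] := leP w (eta * u `^ (p - 1)).
  apply: (@le_trans _ _ (eta * u `^ p)).
    rewrite -(mulr_powRB1 (ltW u0) (lt_trans ltr01 p1)) mulrCA.
    by rewrite ler_wpM2l// ltW.
  rewrite mulrDr -addrA lerDl addr_ge0//; first by rewrite mulr_ge0// ltW.
  by rewrite mulr_ge0// ltW.
have uw : u <= K * w `^ ((p - 1)^-1).
  have -> : K * w `^ (p - 1)^-1 = (w / eta) `^ (p - 1)^-1.
    rewrite powRM ?(ltW w0) ?invr_ge0 ?(ltW eta0)//.
    by rewrite -[eta^-1]powR_inv1 ?(ltW eta0)// -powRrM mulN1r mulrC.
  have {1}-> : u = (u `^ (p - 1)) `^ (p - 1)^-1.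
    by rewrite -powRrM divff ?gt_eqF// powRr1// ltW.
  apply: ge0_ler_powR; rewrite ?nnegrE ?powR_ge0 ?invr_ge0 ?divr_ge0 ?(ltW w0) ?(ltW eta0) ?(ltW p10)//.
  by rewrite ler_pdivlMr// mulrC ltW.
have wN : w `^ (p - 1)^-1 * w <= w ^+ N.
  rewrite -[X in _ * X](powRr1 (ltW w0)) -powRD; last by rewrite (gt_eqF w0) implybT.
  by rewrite -powR_mulrn ?(ltW w0)//; apply: ler_powR => //; rewrite addrC; exact/ltW/truncnS_gt.
have wE : w = ln (e1 * v) by rewrite lnM ?posrE// expRK.
have ev1 : 1 <= e1 * v by rewrite -[leLHS]mulr1; apply: ler_pM.
have := CP _ ev1; rewrite -wE => h2.
apply: (@le_trans _ _ (K * w ^+ N)).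
  apply: le_trans (ler_wpM2r (ltW w0) uw) _.
  by rewrite -mulrA ler_wpM2l// ltW.
apply: le_trans (ler_wpM2l (ltW K0) h2) _.
rewrite mulrDr lerD2r powRM ?(ltW e10) ?(ltW v0)//.
have es0 : e1 `^ s != 0 by rewrite gt_eqF// powR_gt0.
have -> : K * (eta / (K * e1 `^ s) * (e1 `^ s * v `^ s)) = eta * v `^ s.
  by field; rewrite es0 gt_eqF.
by rewrite ler_wpM2l ?(ltW eta0)// lerDr powR_ge0.
Qed.

Lemma ln_small s eta : 0 < s -> 0 < eta ->
  exists2 C, 0 <= C & forall v, 1 <= v -> 1 + ln v <= eta * v `^ s + C.
Proof.
move=> s0 eta0; have [C C0 CP] := mul_ln_small (ltr1n R 2 : 1 < 2) s0 eta0.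
exists (eta + C) => [|v v1]; first by rewrite addr_ge0// ltW.
by have := CP 1 v (lexx 1) v1; rewrite mul1r powR1 mulrDr mulr1; lra.
Qed.

Lemma ln_le_powR s y : 0 < s -> 0 < y -> ln y <= y `^ s / s.
Proof.
move=> s0 y0; rewrite ler_pdivlMr// mulrC -ln_powR ltW// ln_sublinear//.
exact: powR_gt0.
Qed.

Lemma large_nat A : exists N : nat, forall d, (N <= d)%N -> A <= d%:R :> R.
Proof.
exists (Num.truncn A).+1 => d Nd; apply: (@le_trans _ _ ((Num.truncn A).+1)%:R).
  exact/ltW/truncnS_gt.
by rewrite ler_nat.
Qed.

Lemma large_ln A : exists N : nat, forall d, (N <= d)%N -> A <= ln (d%:R : R).
Proof.
have [N NP] := large_nat (expR A); exists N => d /NP h.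
rewrite -[A]expRK ler_ln ?posrE ?expR_gt0//; exact: lt_le_trans (expR_gt0 _) h.
Qed.

Lemma large_powR A t : 0 < t -> exists N : nat, forall d, (N <= d)%N -> A <= (d%:R : R) `^ t.
Proof.
move=> t0; have [N NP] := large_ln (A / t); exists (maxn N 1) => d.
rewrite geq_max => /andP[/NP h d0].
have d0R : (0 : R) < d%:R by rewrite ltr0n.
have := ln_le_powR t0 d0R; rewrite -(ler_pM2r t0) mulfVK ?gt_eqF// => /(le_trans _); apply.
by rewrite -ler_pdivrMr.
Qed.

Lemma sum_indicator_le (h : nat -> R) d m : (forall k, (k < m)%N -> 0 <= h k) ->
  \sum_(k < d) (if (k < m)%N then h k else 0) <= \sum_(k < m) h k.
Proof.
move=> h0; elim: d => [|d IH].
  by rewrite big_ord0 sumr_ge0// => k _; exact: h0.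
have [dm|md] := ltnP d m; last first.
  by rewrite big_ord_recr /= ltnNge md addr0.
have -> : \sum_(k < d.+1) (if (k < m)%N then h k else 0) = \sum_(k < d.+1) h k.
  by apply: eq_bigr => k _; rewrite (leq_trans (ltn_ord k)).
rewrite -[in leRHS](subnKC dm) big_split_ord /= lerDl sumr_ge0// => k _.
by apply: h0; have := ltn_ord k; lia.
Qed.

(** Exponentiated, this is m^m / m! <= e^m, a single term of the exponential series. *)
Lemma sum_ln_ratio m : \sum_(k < m) ln (m%:R / k.+1%:R) <= m%:R :> R.
Proof.
case: m => [|m]; first by rewrite big_ord0.
rewrite -ler_expR expR_sum.
have -> : \prod_(k < m.+1) expR (ln (m.+1%:R / k.+1%:R : R)) = m.+1%:R ^+ m.+1 / m.+1`!%:R.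
  under eq_bigr do rewrite lnK ?posrE ?divr_gt0 ?ltr0n//.
  rewrite prodf_div prodr_const card_ord fact_prod natr_prod; congr (_ / _).
  by rewrite big_add1 big_mkord.
apply: le_trans (expR_ge1Dxn m (ler0n _ _)).
by rewrite lerDr.
Qed.

Lemma sum_tail_inv_sqr d m : (0 < m)%N ->
  \sum_(k < d) (if (k < m)%N then 0 else (m%:R / k.+1%:R) ^+ 2) <= m%:R :> R.
Proof.
move=> m0; have m0R : (0 : R) < m%:R by rewrite ltr0n.
(* The added term, constant until d reaches m, telescopes as in [sum_inv_sqr]. *)
suff : \sum_(k < d) (if (k < m)%N then 0 else (m%:R / k.+1%:R) ^+ 2)
    + m%:R ^+ 2 / (maxn d m)%:R <= m%:R :> R.
  by apply: le_trans; rewrite lerDl divr_ge0// sqr_ge0.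
elim: d => [|d IH].
  by rewrite big_ord0 max0n add0r expr2 mulfK ?gt_eqF.
rewrite big_ord_recr /=; have [dm|md] := ltnP d m.
  by move: IH; rewrite addr0 (maxn_idPr dm) (maxn_idPr (ltnW dm)).
apply: le_trans IH; rewrite (maxn_idPl md) (maxn_idPl (leqW md)) -addrA lerD2l.
have d0 : (0 : R) < d%:R by rewrite ltr0n (leq_trans m0).
rewrite exprMn -mulrDr ler_wpM2l ?sqr_ge0//.
rewrite -natr1; set y := d%:R in d0 *; have y1 : 0 < y + 1 by lra.
rewrite exprVn; have -> : ((y + 1) ^+ 2)^-1 + (y + 1)^-1 = (y + 2) / (y + 1) ^+ 2.
  by field; rewrite gt_eqF.
by rewrite ler_pdivrMr ?exprn_gt0// mulrC ler_pdivlMr// sqrrD; nra.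
Qed.

(** Linear in K, uniformly in d. The sum is cut at m, just above K. Before it, ln(1 + G u^r) <= ln(1
    + G) + r ln u with u = m/(k+1) >= 1; after it, ln(1 + z) <= z and u^r <= u^2 because u <= 1 and
    r >= 2. *)
Lemma sum_ln_power_le (G r : R) : 0 <= G -> 2 <= r ->
  exists2 C, 0 < C & forall K d, 0 < K ->
    \sum_(k < d) ln (1 + G * (K / k.+1%:R) `^ r) <= C * (K + 1).
Proof.
move=> G0 r2; have lG : 0 <= ln (1 + G) by rewrite ln_ge0// lerDl.
exists (ln (1 + G) + r + G) => [|K d K0]; first by lra.
pose m := (Num.truncn K).+1.
have Km : K <= m%:R by exact/ltW/truncnS_gt.
have mK : m%:R <= K + 1 by rewrite /m -natr1 lerD2r truncn_le ltW.
apply: (@le_trans _ _ ((ln (1 + G) + r + G) * m%:R)); last first.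
  by rewrite ler_wpM2l//; lra.
have mR : (0 : R) < m%:R by rewrite ltr0n.
pose h k := ln (1 + G) + r * ln (m%:R / k.+1%:R).
have u1 k : (k < m)%N -> 1 <= m%:R / k.+1%:R :> R.
  by move=> km; rewrite ler_pdivlMr ?ltr0n// mul1r ler_nat.
have h0 k : (k < m)%N -> 0 <= h k.
  by move=> km; rewrite addr_ge0// mulr_ge0 ?ln_ge0 ?u1//; lra.
apply: (@le_trans _ _ (\sum_(k < d) ((if (k < m)%N then h k else 0) +
    G * (if (k < m)%N then 0 else (m%:R / k.+1%:R) ^+ 2)))).
  apply: ler_sum => k _.
  have k0 : (0 : R) < k.+1%:R by rewrite ltr0n.
  have Kk : 0 < K / k.+1%:R by rewrite divr_gt0.
  have mk : 0 < m%:R / k.+1%:R :> R by rewrite divr_gt0.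
  have Kr : (K / k.+1%:R) `^ r <= (m%:R / k.+1%:R) `^ r.
    by apply: ge0_ler_powR; rewrite ?nnegrE ?(ltW Kk) ?(ltW mk) ?ler_pM2r ?invr_gt0//; lra.
  have GK : 0 <= G * (K / k.+1%:R) `^ r by rewrite mulr_ge0 ?powR_ge0.
  case: ifPn => km; rewrite ?mulr0 ?addr0 ?add0r.
    rewrite /h -ln_powR -lnM ?posrE ?powR_gt0//; last by lra.
    rewrite ler_ln ?posrE; last 2 first.
      by rewrite ltr_wpDr.
      by rewrite mulr_gt0 ?powR_gt0//; lra.
    have := ge1_powR (u1 _ km) (ltac:(lra) : 0 <= r) => h1.
    by rewrite mulrDl mul1r lerD// ler_wpM2l.
  apply: le_trans (@le_ln1Dx _ _ _) _; first by lra.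
  rewrite ler_wpM2l//; apply: le_trans Kr _.
  rewrite -powR_mulrn ?(ltW mk)//; apply: ger_powR => //.
  by rewrite mk/= ler_pdivrMr// mul1r ler_nat leqW// leqNgt.
rewrite big_split /= -mulr_sumr 2!mulrDl; apply: lerD; last first.
  by rewrite ler_wpM2l// sum_tail_inv_sqr.
apply: le_trans (sum_indicator_le d h0) _.
rewrite big_split /= sumr_const card_ord mulr_natr lerD2l -mulr_sumr.
by rewrite ler_wpM2l ?sum_ln_ratio//; lra.
Qed.

Lemma sum_powR_le (ga : R) d : 0 < ga < 1 ->
  \sum_(k < d) k.+1%:R `^ (ga - 1) <= d%:R `^ ga / ga :> R.
Proof.
move=> /andP[g0 g1]; elim: d => [|d IH].
  by rewrite big_ord0 divr_ge0 ?powR_ge0// ltW.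
rewrite big_ord_recr /=; apply: le_trans (lerD IH (lexx _)) _.
rewrite ler_pdivlMr// mulrDl divfK ?gt_eqF//.
have y0 : (0 : R) < d.+1%:R by rewrite ltr0n.
have -> : d.+1%:R `^ (ga - 1) = d.+1%:R `^ ga / d.+1%:R :> R.
  rewrite powRB; last by rewrite (gt_eqF y0) implybT.
  by rewrite powRr1 // ltW.
have -> : d%:R = d.+1%:R * (d%:R / d.+1%:R) :> R by rewrite mulrC divfK ?gt_eqF.
rewrite powRM ?divr_ge0 ?(ltW y0)// -mulrA -mulrDr ler_piMr ?powR_ge0//.
have h0 : (0 : R) <= d%:R / d.+1%:R by rewrite divr_ge0.
(* Weighted AM-GM, v^ga <= ga v + (1 - ga) at v = d/(d+1), takes the place of a comparison with an
   integral. *)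
have := @conjugate_powR R ((d%:R / d.+1%:R) `^ ga) 1 ga^-1 (1 - ga)^-1.
rewrite powR1 mulr1 -powRrM divff ?gt_eqF// powRr1// !invrK => /(_ (powR_ge0 _ _) ler01).
rewrite !invr_gt0 => /(_ g0); rewrite subr_gt0 => /(_ g1).
have -> : ga + (1 - ga) = 1 by ring.
move=> /(_ erefl) h; apply: le_trans (lerD h (lexx _)) _.
rewrite mul1r; have -> : (d%:R : R) = d.+1%:R - 1 by rewrite -natr1 addrK.
by rewrite le_eqVlt; apply/orP; left; apply/eqP; field; rewrite gt_eqF.
Qed.

End Growth.

(** * Sufficiency *)

Section Sufficiency.
Variables (R : realType) (om : R) (a b : nat -> R) (b0 : R).
Hypothesis hom : 0 < om < 1.
Hypothesis ha1 : 0 < a 1%N.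
Hypothesis hamono : forall j : nat, (1 <= j)%N -> a j <= a j.+1.
Hypothesis hb0 : 0 < b0.
Hypothesis hb : forall j : nat, (1 <= j)%N -> b0 <= b j.
Variables (cls : info_class) (cr : criterion).

Local Notation rho := (rho om a b).

Lemma ln_nat_ge0 (n : nat) : 0 <= ln (n%:R : R).
Proof. by case: n => [|n]; [rewrite ln0|rewrite ln_ge0// ler1n]. Qed.

Lemma logeps_ge1 (eps : R) : 0 < eps < 1 -> 1 <= 1 + ln eps^-1.
Proof. by move=> /andP[e0 e1]; rewrite lerDl ln_ge0// ltW// invf_gt1. Qed.

(** An additive constant is harmless because the denominator T tends to infinity: past the bound
    chosen for eps^-1 + d, one of the two summands of T is at least K, and K makes |C| at most eta T
    / 3. *)
Lemma EXP_WT_intro s t : 0 < s -> 0 < t ->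
  (forall eta, 0 < eta -> exists C, forall d eps, (0 < d)%N -> 0 < eps < 1 ->
    exists n : nat, nstar om a b cls cr eps d = (n%:R)%:E /\
      ln n%:R <= eta * ((1 + ln eps^-1) `^ s + d%:R `^ t) + C) ->
  EXP_WT om a b cls cr s t.
Proof.
move=> s0 t0 H eta eta0.
have eta3 : 0 < eta / 3 by lra.
have [C CP] := H (eta / 3) eta3.
pose K := (`|C| + 1) / (eta / 3).
have K0 : 0 < K by rewrite divr_gt0//; have := normr_ge0 C; lra.
exists (expR (K `^ s^-1) + K `^ t^-1) => d eps d0 he hM.
have y1 := logeps_ge1 he; have /andP[e0 e1] := he.
have [n [nE nC]] := CP d eps d0 he; exists n; split => //.
set T := (1 + ln eps^-1) `^ s + d%:R `^ t in nC *.
have A0 : 0 <= (1 + ln eps^-1) `^ s by exact: powR_ge0.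
have B0 : 0 <= (d%:R : R) `^ t by exact: powR_ge0.
have KT : K <= T.
  have [h|h] := leP (expR (K `^ s^-1)) eps^-1.
    apply: (@le_trans _ _ ((1 + ln eps^-1) `^ s)); last by rewrite /T lerDl.
    have h1 : K `^ s^-1 <= 1 + ln eps^-1.
      rewrite -[leLHS]expRK; apply: (@le_trans _ _ (ln eps^-1)).
        by rewrite ler_ln ?posrE ?expR_gt0 ?invr_gt0.
      by rewrite lerDr.
    have {1}-> : K = (K `^ s^-1) `^ s by rewrite -powRrM mulVf ?gt_eqF// powRr1// ltW.
    by apply: ge0_ler_powR; rewrite ?nnegrE ?powR_ge0//; lra.
  have h1 : K `^ t^-1 <= d%:R by lra.
  apply: (@le_trans _ _ (d%:R `^ t)); last by rewrite /T lerDr.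
  have {1}-> : K = (K `^ t^-1) `^ t by rewrite -powRrM mulVf ?gt_eqF// powRr1// ltW.
  by apply: ge0_ler_powR; rewrite ?nnegrE ?powR_ge0//; lra.
have T0 : 0 < T by lra.
rewrite ger0_norm; last by rewrite divr_ge0 ?ln_nat_ge0// ltW.
rewrite ltr_pdivrMr//.
have : `|C| + 1 <= eta / 3 * T by rewrite mulrC -ler_pdivrMr//; lra.
have := ler_norm C; have : 0 < eta * T by rewrite mulr_gt0.
by lra.
Qed.

Lemma EXP_WT_upper s t : 0 < s -> 0 < t ->
  (forall eta, 0 < eta -> exists C, forall d eps, (0 < d)%N -> 0 < eps < 1 ->
    exists tau L, [/\ 0 < tau < 1,
      forall M, \sum_(k < d) ln (1 + rho tau k M) <= L &
      3 / (1 - tau) * (2 * tau * ln eps^-1 + 4 * tau + L) <=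
        eta * ((1 + ln eps^-1) `^ s + d%:R `^ t) + C]) ->
  EXP_WT om a b cls cr s t.
Proof.
move=> s0 t0 H; apply: EXP_WT_intro => // eta /H[C CP]; exists (3 + C) => d eps d0 he.
have [tau [L [htau hL hC]]] := CP d eps d0 he.
have [n [nE nL]] := nstar_upper hom ha1 hamono hb0 hb cls cr he htau hL.
by exists n; split => //; move: hC nL; set X := 3 / _ * _; set Y := eta * _; lra.
Qed.

Lemma ln_rho_le_rho tau k M : ln (1 + rho tau k M) <= rho tau k M.
Proof. by apply: le_ln1Dx; apply: lt_le_trans (rho_ge0 _ _ _ _ _ _); lra. Qed.

Lemma inv_sub_half (tau : R) : 0 < tau <= 1 / 2 -> 3 / (1 - tau) <= 6.
Proof. by move=> h; rewrite ler_pdivrMr; lra. Qed.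

Lemma le_ln_pow_bound (K y z : R) (P : nat) : 0 <= K -> 1 <= y -> 0 <= z ->
  z <= K * y ^+ P -> ln (1 + z) <= ln (1 + K) + P%:R * ln y.
Proof.
move=> K0 y1 z0 zK; have y0 : 0 < y by lra.
have yP : 1 <= y ^+ P by exact: exprn_ege1.
rewrite mulr_natl -lnXn// -lnM ?posrE ?exprn_gt0//; last by lra.
rewrite ler_ln ?posrE; [|by lra|by rewrite mulr_gt0 ?exprn_gt0//; lra].
by rewrite mulrDl mul1r; lra.
Qed.

Lemma div_exprn_le (G u v : R) P : 0 <= G -> 0 < u -> u <= v -> G / v ^+ P <= G / u ^+ P.
Proof.
move=> G0 u0 uv; have v0 : 0 < v by exact: lt_le_trans uv.
by rewrite ler_wpM2l// lef_pV2 ?posrE ?exprn_gt0// lerXn2r ?nnegrE ?(ltW u0) ?(ltW v0).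
Qed.

(** With y = 1 + ln(1/eps) and tau = 1/(2 y), tau ln(1/eps) stays bounded while ln S_tau is at most
    of order d (1 + ln y). Since t > 1, [mul_ln_small] absorbs this product. *)
Lemma EXP_WT_always s t : 0 < s -> 1 < t -> EXP_WT om a b cls cr s t.
Proof.
move=> s0 t1; apply: EXP_WT_upper => //; first by lra.
move=> eta eta0; have [p pb] := exponent_exists hb0 2.
pose K := rho_const om p / (1 / 2 * a 1%N) ^+ p.+1.
have K0 : 0 <= K.
  by rewrite divr_ge0 ?rho_const_ge0// exprn_ge0// mulr_ge0 ?(ltW ha1)//; lra.
pose K' := ln (1 + K) + p.+1%:R.
have lK : 0 <= ln (1 + K) by rewrite ln_ge0//; lra.
have pR : (1 : R) <= p.+1%:R by rewrite ler1n.
have K'0 : 0 < K' by rewrite /K'; lra.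
have eK : 0 < eta / (6 * K') by rewrite divr_gt0//; lra.
have [C C0 CP] := mul_ln_small t1 s0 eK.
(* The 18 covers 6 (2 tau x + 4 tau), as tau x and tau are at most 1/2. *)
exists (18 + 6 * K' * C) => d eps d0 he.
set y := 1 + ln eps^-1; have y1 : 1 <= y by exact: logeps_ge1.
have dR : 1 <= d%:R :> R by rewrite ler1n.
have ly : 0 <= ln y by exact: ln_ge0.
exists (1 / 2 / y), (d%:R * (K' * (1 + ln y))).
have y0 : 0 < y by lra.
have tau2 : 0 < 1 / 2 / y <= 1 / 2.
  by rewrite divr_gt0 ?ler_pdivrMr//=; lra.
split=> [|M|]; first by lra.
  rewrite mulr_natl -[d in leRHS]card_ord -sumr_const; apply: ler_sum => k _.
  have tau0 : 0 < 1 / 2 / y by lra.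
  apply: (@le_trans _ _ (ln (1 + K) + p.+1%:R * ln y)); last by rewrite /K'; nra.
  apply: le_ln_pow_bound => //; first exact: rho_ge0.
  apply: le_trans (rho_le_pow hom ha1 hamono hb _ _ pb tau0) _.
  have -> : K * y ^+ p.+1 = rho_const om p / (1 / 2 / y * a 1%N) ^+ p.+1.
    by rewrite /K [1 / 2 / y * _]mulrAC [in RHS]exprMn exprVn invfM invrK mulrA.
  apply: div_exprn_le; rewrite ?rho_const_ge0 ?(mulr_gt0 tau0)//.
  by rewrite ler_wpM2l ?(ltW tau0)// (a_mono hamono).
have h6 := inv_sub_half tau2.
set tau := 1 / 2 / y in tau2 h6 *.
have tx : tau * ln eps^-1 <= 1 / 2.
  have -> : ln eps^-1 = y - 1 by rewrite /y; ring.
  by rewrite mulrBr mulr1 {1}/tau divfK ?gt_eqF//; lra.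
have x0 : 0 <= ln eps^-1 by move: y1; rewrite /y; lra.
have L0 : 0 <= d%:R * (K' * (1 + ln y)) by rewrite mulr_ge0// mulr_ge0//; lra.
have t0' : 0 <= 2 * tau * ln eps^-1 by rewrite mulr_ge0//; lra.
set X := 2 * tau * _ + _ + _; have X0 : 0 <= X by rewrite /X; lra.
apply: (@le_trans _ _ (6 * X)); first by rewrite ler_wpM2r.
have hC := CP d%:R y dR y1.
have : 6 * (d%:R * (K' * (1 + ln y))) <= eta * (d%:R `^ t + y `^ s) + 6 * K' * C.
  have -> : eta * (d%:R `^ t + y `^ s) + 6 * K' * C =
      6 * K' * (eta / (6 * K') * (d%:R `^ t + y `^ s) + C) by field; rewrite gt_eqF.
  have -> : 6 * (d%:R * (K' * (1 + ln y))) = 6 * K' * (d%:R * (1 + ln y)) by ring.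
  by rewrite ler_pM2l ?mulr_gt0.
rewrite [d%:R `^ t + _]addrC /X; move: (eta * _) (d%:R * _) => U V.
by move: tx; rewrite -mulrA; lra.
Qed.

Lemma near_nat_infty (P : nat -> Prop) :
  (\forall j \near \oo, P j) <-> exists N, forall j, (N <= j)%N -> P j.
Proof.
split => [[N _ NP]|[N NP]]; first by exists N => j Nj; exact: NP.
by exists N => // j Nj; exact: NP.
Qed.

Lemma cvg_pinftyP (f : nat -> R) :
  f @ \oo --> +oo <-> forall A, exists N, forall j, (N <= j)%N -> A <= f j.
Proof.
rewrite cvgryPge; split => h A; first exact/near_nat_infty/h.
exact/near_nat_infty/h.
Qed.

(** Past k0, a_k >= A k^q, so rho is at most G (Kr/k)^(q(p+1)) with Kr = (tau A)^(-1/q), and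
    [sum_ln_power_le] gives ln S_tau = O(Kr) up to the first k0 factors, which cost O(1 + ln y). For
    tau = ka y^(s-1) both Kr and tau ln(1/eps) are O(y^s), and the bound is uniform in d. *)
Lemma EXP_WT_power s t : 0 < s < 1 -> 0 < t ->
  (fun j : nat => a j / (j%:R : R) `^ ((1 - s) / s)) @ \oo --> +oo ->
  EXP_WT om a b cls cr s t.
Proof.
move=> /andP[s0 s1] t0 /cvg_pinftyP ha; apply: EXP_WT_upper => // eta eta0.
set q := (1 - s) / s in ha; have q0 : 0 < q by rewrite divr_gt0//; lra.
(* Two demands on p: summability over m, and q (p + 1) >= 2 for summability over the coordinates. *)
have [p pb] : exists p : nat, Num.max 2 (2 * b0 / q) <= p.+1%:R * b0.
  exact: (exponent_exists hb0).
have pb2 : 2 <= p.+1%:R * b0 by apply: le_trans pb; rewrite le_max lexx.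
have pq : 2 <= q * p.+1%:R.
  have : 2 * b0 / q <= p.+1%:R * b0 by apply: le_trans pb; rewrite le_max lexx orbT.
  by rewrite ler_pdivrMr// mulrAC ler_pM2r// mulrC.
pose G := rho_const om p; have G0 : 0 <= G by exact: rho_const_ge0.
have [C1 C10 C1P] := sum_ln_power_le G0 pq.
pose ka := Num.min (1 / 2) (eta / 48).
have ka0 : 0 < ka by rewrite lt_min; apply/andP; split; lra.
have ka12 : ka <= 1 / 2 by rewrite ge_min lexx.
have kaeta : 12 * ka <= eta / 4.
  have : ka <= eta / 48 by rewrite ge_min lexx orbT.
  by lra.
(* Chosen so that ka cancels and C1 Kr = (eta / 24) y^s, as verified in [KrE]. *)
pose A := ka^-1 * (24 * C1 / eta) `^ q.
have A0 : 0 < A by rewrite mulr_gt0 ?invr_gt0// powR_gt0// divr_gt0// mulr_gt0.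
have [k0 k0P] := ha A.
pose G1 := G / (ka * a 1%N) ^+ p.+1.
have G10 : 0 <= G1 by rewrite divr_ge0// exprn_ge0// mulr_ge0// ltW.
pose G2 := ln (1 + G1) + p.+1%:R.
have lG1 : 0 <= ln (1 + G1) by rewrite ln_ge0//; lra.
have pR : (1 : R) <= p.+1%:R by rewrite ler1n.
have G20 : 0 < G2 by rewrite /G2; lra.
have k0R : (0 : R) <= k0%:R by exact: ler0n.
have kG : 0 <= k0%:R * G2 by rewrite mulr_ge0// ltW.
have eG : 0 < eta / (24 * (k0%:R * G2 + 1)) by rewrite divr_gt0//; lra.
have [C2 C20 C2P] := ln_small s0 eG.
exists (24 * ka + 6 * ((k0%:R * G2 + 1) * C2) + 6 * C1) => d eps d0 he.
set y := 1 + ln eps^-1; have y1 : 1 <= y by exact: logeps_ge1.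
have y0 : 0 < y by lra.
pose tau := ka * y `^ (s - 1).
have ys0 : 0 < y `^ (s - 1) by exact: powR_gt0.
have ys1 : y `^ (s - 1) <= 1 by rewrite -[leRHS](powRr0 y); apply: ler_powR => //; lra.
have tau0 : 0 < tau by rewrite mulr_gt0.
have tau2 : 0 < tau <= 1 / 2 by rewrite tau0 /tau /=; nra.
have yE : y `^ (s - 1) * y = y `^ s by rewrite mulrC mulr_powRB1 ?ltW.
pose Kr := (tau * A) `^ (- q^-1).
have Kr0 : 0 < Kr by rewrite powR_gt0// mulr_gt0.
exists tau, (k0%:R * (G2 * (1 + ln y)) + C1 * (Kr + 1)).
have ly : 0 <= ln y by exact: ln_ge0.
split=> [|M|]; first by lra.
  pose h1 (k : nat) := G2 * (1 + ln y).
  pose h2 (k : nat) := ln (1 + G * (Kr / k.+1%:R) `^ (q * p.+1%:R)).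
  apply: (@le_trans _ _ (\sum_(k < d) ((if (k < k0)%N then h1 k else 0) + h2 k))); last first.
    rewrite big_split /=; apply: lerD; last exact: C1P.
    have := @sum_indicator_le _ h1 d k0; rewrite sumr_const card_ord mulr_natl; apply.
    by move=> k _; rewrite /h1 mulr_ge0 ?(ltW G20)//; lra.
  apply: ler_sum => k _.
  have h20 : 0 <= h2 k by rewrite ln_ge0// lerDl mulr_ge0 ?powR_ge0.
  have hr := rho_le_pow hom ha1 hamono hb k M pb2 tau0.
  have ak := a_gt0 ha1 hamono (ltn0Sn k).
  case: ifPn => [_|kk0].
    rewrite -[leLHS]addr0 lerD//.
    apply: (@le_trans _ _ (ln (1 + G1) + p.+1%:R * ln y)); last by rewrite /h1 /G2; nra.
    apply: le_ln_pow_bound => //; first exact: rho_ge0.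
    apply: le_trans hr _.
    have -> : G1 * y ^+ p.+1 = G / (ka * a 1%N * y^-1) ^+ p.+1.
      by rewrite /G1 [in RHS]exprMn exprVn invfM invrK mulrA.
    apply: div_exprn_le => //; first by rewrite !mulr_gt0// invr_gt0.
    have yi : y^-1 <= y `^ (s - 1).
      by rewrite -powR_inv1 ?(ltW y0)//; apply: ler_powR => //; lra.
    have a1k : a 1%N <= a k.+1 by exact: a_mono.
    rewrite /tau [leRHS]mulrAC; apply: ler_pM => //.
    + by rewrite mulr_ge0// ltW.
    + by rewrite invr_ge0 ltW.
    + by rewrite ler_wpM2l// ltW.
  rewrite add0r /h2 ler_ln ?posrE; last 2 first.
    by rewrite ltr_wpDr ?rho_ge0.
    by rewrite ltr_wpDr// mulr_ge0 ?powR_ge0.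
  rewrite lerD2l; apply: le_trans hr _.
  have kR : (0 : R) < k.+1%:R by rewrite ltr0n.
  have -> : (Kr / k.+1%:R) `^ (q * p.+1%:R) = ((tau * A * k.+1%:R `^ q) ^+ p.+1)^-1.
    have tA : 0 < tau * A by rewrite mulr_gt0.
    rewrite powRM ?invr_ge0 ?(ltW kR) ?(ltW Kr0)// -[k.+1%:R^-1]powR_inv1 ?(ltW kR)// /Kr -!powRrM.
    have -> : - q^-1 * (q * p.+1%:R) = - p.+1%:R by field; rewrite gt_eqF.
    rewrite mulN1r !powRN -invfM.
    congr (_^-1); rewrite powRrM -powRM ?powR_ge0 ?(ltW tA)// ?powR_mulrn//.
    by rewrite mulr_ge0 ?powR_ge0// ltW.
  apply: div_exprn_le => //.
    by rewrite mulr_gt0 ?powR_gt0// mulr_gt0.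
  rewrite -mulrA ler_wpM2l ?(ltW tau0)// -ler_pdivlMr ?powR_gt0//.
  by apply: k0P; rewrite -leqNgt in kk0; exact: leqW.
have h6 := inv_sub_half tau2.
have x0 : 0 <= ln eps^-1 by move: y1; rewrite /y; lra.
have dt0 : 0 <= (d%:R : R) `^ t by exact: powR_ge0.
have yt : tau * ln eps^-1 <= ka * y `^ s.
  rewrite -yE mulrA; apply: ler_wpM2l; first exact: ltW.
  by rewrite /y lerDr.
have KrE : C1 * Kr = eta / 24 * y `^ s.
  rewrite /Kr /tau /A.
  have -> : ka * y `^ (s - 1) * (ka^-1 * (24 * C1 / eta) `^ q) =
      y `^ (s - 1) * (24 * C1 / eta) `^ q by field; rewrite gt_eqF.
  rewrite powRM ?powR_ge0// -!powRrM.
  have -> : q * - q^-1 = - 1 by field; rewrite gt_eqF.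
  rewrite powR_inv1; last by rewrite divr_ge0 ?(ltW eta0)// mulr_ge0 ?(ltW C10).
  have -> : (s - 1) * - q^-1 = s by rewrite /q; field; apply/andP; split; rewrite gt_eqF//; lra.
  by field; rewrite !gt_eqF.
set L := k0%:R * _ + _.
have L1 : 0 <= k0%:R * (G2 * (1 + ln y)) by rewrite mulr_ge0// mulr_ge0//; lra.
have L2 : 0 <= C1 * (Kr + 1) by rewrite mulr_ge0//; lra.
have L0 : 0 <= L by exact: addr_ge0.
have t0' : 0 <= 2 * tau * ln eps^-1 by rewrite mulr_ge0//; lra.
set X := 2 * tau * _ + _ + _; have X0 : 0 <= X by rewrite /X; lra.
apply: (@le_trans _ _ (6 * X)); first by rewrite ler_wpM2r.
have := C2P y y1 => h2.
have h3 : k0%:R * (G2 * (1 + ln y)) <= eta / 24 * y `^ s + (k0%:R * G2 + 1) * C2.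
  apply: (@le_trans _ _ ((k0%:R * G2 + 1) * (1 + ln y))).
    by rewrite mulrA ler_wpM2r//; lra.
  have -> : eta / 24 * y `^ s + (k0%:R * G2 + 1) * C2 =
     (k0%:R * G2 + 1) * (eta / (24 * (k0%:R * G2 + 1)) * y `^ s + C2).
    by field; rewrite gt_eqF//; lra.
  by rewrite ler_wpM2l//; lra.
have ysp : 0 <= y `^ s by exact: powR_ge0.
have h4 : 12 * (ka * y `^ s) <= eta / 4 * y `^ s by rewrite mulrA ler_wpM2r.
have h5 : tau <= ka by rewrite /tau ler_piMr// ltW.
have h7 : 0 <= eta * d%:R `^ t by rewrite mulr_ge0// ltW.
have h8 : 0 <= eta * y `^ s by rewrite mulr_ge0// ltW.
have -> : 6 * X = 12 * (tau * ln eps^-1) + 24 * tau + 6 * (k0%:R * (G2 * (1 + ln y)))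
    + 6 * (C1 * Kr) + 6 * C1 by rewrite /X /L; ring.
rewrite KrE; clear -h3 h4 h5 h7 h8 yt.
move: (k0%:R * (G2 * (1 + ln y))) h3 => V1 h3; move: ((k0%:R * G2 + 1) * C2) h3 => V2 h3.
move: (tau * ln eps^-1) yt => V3 yt; move: (ka * y `^ s) h4 yt => V4 h4 yt.
by rewrite [eta * (_ + _)]mulrDr; lra.
Qed.

End Sufficiency.

(** * Sufficiency of the logarithmic and the weighted condition *)

Section SufficiencyLog.
Variables (R : realType) (om : R) (a b : nat -> R) (b0 : R).
Hypothesis hom : 0 < om < 1.
Hypothesis ha1 : 0 < a 1%N.
Hypothesis hamono : forall j : nat, (1 <= j)%N -> a j <= a j.+1.
Hypothesis hb0 : 0 < b0.
Hypothesis hb : forall j : nat, (1 <= j)%N -> b0 <= b j.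
Variables (cls : info_class) (cr : criterion).

Local Notation rho := (rho om a b).
Local Notation decay := (decay om).

Let om0 : 0 < om. Proof. by case/andP: hom. Qed.
Let c0 : 0 < decay. Proof. exact: decay_gt0. Qed.

Lemma powR_ln (y p : R) : 0 < y -> y `^ p = expR (p * ln y).
Proof. by move=> y0; rewrite /powR gt_eqF. Qed.

Lemma sum_ln_rho_le (tau0 : R) : 0 < tau0 -> exists2 K, 0 <= K & forall tau d M,
  tau0 <= tau -> \sum_(k < d) ln (1 + rho tau k M) <= K * \sum_(k < d) om `^ (tau * a k.+1).
Proof.
move=> t0; have [p pb] := exponent_exists hb0 2.
exists (rho_const om p / (tau0 * a 1%N) ^+ p.+1 * om `^ (- (tau0 * a 1%N))).
  rewrite mulr_ge0 ?powR_ge0// divr_ge0 ?rho_const_ge0// exprn_ge0//.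
  by rewrite mulr_ge0// ltW.
move=> tau d M tt; rewrite mulr_sumr; apply: ler_sum => k _.
apply: le_trans (ln_rho_le_rho om a b _ _ _) _.
exact: (rho_le_om hom ha1 hamono hb0 hb).
Qed.

Lemma sum_indicator1_le d k0 : \sum_(k < d) (if (k < k0)%N then 1 else 0) <= k0%:R :> R.
Proof.
have := @sum_indicator_le R (fun=> 1) d k0 (fun _ _ => ler01).
by rewrite sumr_const card_ord.
Qed.

(** For constant tau, a_j >= (2 / (decay tau)) ln j eventually, so om^(tau a_j) <= j^(-2) and S_tau
    is bounded uniformly in d. Then ln n is at most 12 tau ln(1/eps) plus a constant, with 12 tau <=
    eta. *)
Lemma EXP_WT_log t : 0 < t ->
  (fun j : nat => a j / ln (j%:R : R)) @ \oo --> +oo -> EXP_WT om a b cls cr 1 t.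
Proof.
move=> t0 /cvg_pinftyP ha; apply: (EXP_WT_upper hom ha1 hamono hb0 hb) => // eta eta0.
pose tau := Num.min (1 / 2) (eta / 12).
have tau0 : 0 < tau by rewrite lt_min; apply/andP; split; lra.
have tau2 : 0 < tau <= 1 / 2 by rewrite tau0 ge_min lexx.
have taue : 12 * tau <= eta.
  have : tau <= eta / 12 by rewrite ge_min lexx orbT.
  by lra.
have [K K0 KP] := sum_ln_rho_le tau0.
have [k1 k1P] := ha (2 / (decay * tau)).
pose k0 := maxn k1 2.
exists (24 * tau + 6 * (K * (k0%:R + 2))) => d eps d0 he.
set y := 1 + ln eps^-1; have y1 : 1 <= y by exact: logeps_ge1.
have x0 : 0 <= ln eps^-1 by move: y1; rewrite /y; lra.
exists tau, (K * (k0%:R + 2)); split=> [|M|]; first by lra.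
  apply: le_trans (KP tau d M (lexx _)) _; rewrite ler_wpM2l//.
  apply: le_trans (lerD (sum_indicator1_le d k0) (sum_inv_sqr R d)).
  rewrite -big_split /=; apply: ler_sum => k _.
  have ak := a_gt0 ha1 hamono (ltn0Sn k).
  have kR : (0 : R) < k.+1%:R by rewrite ltr0n.
  case: ifPn => kk0.
    rewrite -[leLHS]addr0 lerD ?invr_ge0 ?exprn_ge0//.
    rewrite -[leRHS](powRr0 om); apply: (powR_om_le hom).
    by rewrite mulr_ge0// ltW.
  rewrite add0r -leqNgt in kk0 *.
  have k1k : (k1 <= k.+1)%N by rewrite (leq_trans _ (leqW kk0))// leq_maxl.
  have l0 : 0 < ln (k.+1%:R : R).
    by rewrite ln_gt0// ltr1n ltnS (leq_trans _ kk0)// (leq_trans _ (leq_maxr _ _)).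
  have := k1P _ k1k; rewrite ler_pdivlMr// => h.
  rewrite (powR_decay hom) -[leRHS]lnK ?posrE ?invr_gt0 ?exprn_gt0// ler_expR.
  rewrite lnV ?posrE ?exprn_gt0// lnXn// lerN2 -[leLHS]mulr_natl mulrA.
  have ct : 0 < decay * tau by rewrite mulr_gt0.
  by move: h; rewrite mulrAC ler_pdivrMr// [_ * (decay * tau)]mulrC.
have h6 := inv_sub_half tau2.
have L0 : 0 <= K * (k0%:R + 2) by rewrite mulr_ge0// addr_ge0.
rewrite powRr1; last by lra.
set X := 2 * tau * _ + _ + _; have X0 : 0 <= X.
  have : 0 <= tau * ln eps^-1 by rewrite mulr_ge0// ltW.
  by rewrite /X -[2 * tau * _]mulrA; lra.
apply: (@le_trans _ _ (6 * X)); first by rewrite ler_wpM2r.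
have h1 : 12 * tau * ln eps^-1 <= eta * y.
  by apply: ler_pM => //; [lra|rewrite /y lerDr].
have h2 : 0 <= eta * d%:R `^ t by rewrite mulr_ge0 ?powR_ge0// ltW.
rewrite /X; move: (K * _) => V.
by rewrite [eta * (_ + _)]mulrDr; lra.
Qed.

(* A point with [j^(1-t) a_j om^(a_j)] small has [a_j] at least a multiple of
   [ln j]; for those with [a_j <= (4 / decay) ln j] the exponent
   [tau = 1 - 1 / (2 + ln d)] changes [om^(tau a_j)] by a bounded factor. *)
Lemma powR_om_cutoff t eta d j : 0 < t < 1 -> 0 < eta ->
  1 <= ln (j%:R : R) -> (0 < j)%N -> (j <= d)%N ->
  (1 - t) / 2 * ln (j%:R : R) <= decay * a j ->
  (j%:R : R) `^ (1 - t) * a j * om `^ a j <= eta ->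
  (2 + ln (d%:R : R)) * om `^ ((1 - (2 + ln (d%:R : R))^-1) * a j) <=
    (2 + ln (d%:R : R)) * (j%:R ^+ 2)^-1 +
    eta * (expR 4 * (2 * decay / (1 - t)) * (3 + 2 / t)) *
      (d%:R `^ (t / 2) * j%:R `^ (t / 2 - 1)).
Proof.
move=> /andP[t0 t1] eta0 lj1 j0' jd aj hj.
have j0 : (0 : R) < j%:R by rewrite ltr0n.
have d0 : (0 : R) < d%:R by apply: lt_le_trans j0 _; rewrite ler_nat.
have ljd : ln (j%:R : R) <= ln d%:R by rewrite ler_ln ?posrE// ler_nat.
set ld := ln (d%:R : R) in ljd *; set lj := ln (j%:R : R) in lj1 ljd aj *.
have D0 : 0 < 2 + ld by lra.
have t10 : 0 < 1 - t by lra.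
have ct : 0 < 2 * decay / (1 - t) by rewrite divr_gt0// mulr_gt0.
have tt : 0 < 3 + 2 / t by rewrite addr_gt0// divr_gt0.
have e4 : (0 : R) < expR 4 by exact: expR_gt0.
set al := a j in aj hj *; have al0 : 0 < al.
  by rewrite -(pmulr_rgt0 _ c0); apply: lt_le_trans aj; rewrite mulr_gt0//; lra.
have Di : (2 + ld)^-1 <= 1 / 2 by rewrite -[leLHS]mul1r ler_pdivrMr//; lra.
have [h|h] := leP (4 * lj) (decay * al).
  rewrite -[leLHS]addr0 lerD//; last first.
    rewrite mulr_ge0 ?(mulr_ge0 (powR_ge0 _ _) (powR_ge0 _ _))//.
    by rewrite mulr_ge0 ?(ltW eta0)// mulr_ge0 ?(ltW tt)// mulr_ge0 ?(ltW e4) ?(ltW ct).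
  rewrite ler_wpM2l ?(ltW D0)// (powR_decay hom).
  rewrite -[leRHS]lnK ?posrE ?invr_gt0 ?exprn_gt0// ler_expR.
  rewrite lnV ?posrE ?exprn_gt0// lnXn// lerN2 -[leLHS]mulr_natl mulrCA -/lj.
  by apply: (@le_trans _ _ (1 / 2 * (decay * al))); [lra|rewrite ler_wpM2r; lra].
set W := om `^ al in hj.
have W0 : 0 < W by exact: powR_gt0.
have jt0 : 0 < (j%:R : R) `^ (t - 1) by exact: powR_gt0.
have WE : W <= eta * j%:R `^ (t - 1) / al.
  rewrite ler_pdivlMr// -ler_pdivrMr// -powRN opprB.
  have -> // : W * al * j%:R `^ (1 - t) = j%:R `^ (1 - t) * al * W by ring.
have -> : om `^ ((1 - (2 + ld)^-1) * al) = W * expR (decay * al / (2 + ld)).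
  by rewrite /W !(powR_decay hom) -expRD; congr expR; ring.
have E4 : expR (decay * al / (2 + ld)) <= expR 4.
  by rewrite ler_expR ler_pdivrMr//; lra.
(* Here a_j is at least a multiple of ln j, and ln d = ln j + ln(d/j) with ln(d/j) <= (2/t)
   (d/j)^(t/2). The exponent t/2 leaves j^(t/2 - 1), whose sum up to d is O(d^(t/2)). *)
have ratio : (2 + ld) / al <= 2 * decay / (1 - t) * ((3 + 2 / t) * (d%:R / j%:R) `^ (t / 2)).
  apply: (@le_trans _ _ (2 * decay / (1 - t) * ((2 + ld) / lj))).
    rewrite ler_pdivrMr//; have -> : 2 * decay / (1 - t) * ((2 + ld) / lj) * al =
        (2 + ld) * (decay * al / ((1 - t) / 2 * lj)) by field; rewrite !gt_eqF//; lra.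
    rewrite -[leLHS]mulr1 ler_wpM2l ?(ltW D0)// ler_pdivlMr ?mul1r//.
    by rewrite mulr_gt0//; lra.
  rewrite ler_wpM2l ?(ltW ct)//.
  have dj : 1 <= (d%:R / j%:R : R) by rewrite ler_pdivlMr// mul1r ler_nat.
  have p1 : 1 <= (d%:R / j%:R : R) `^ (t / 2) by apply: ge1_powR => //; lra.
  rewrite ler_pdivrMr; last by lra.
  have t2 : 0 < t / 2 by lra.
  have := ln_le_powR t2 (lt_le_trans ltr01 dj); rewrite ln_div ?posrE// -/ld -/lj.
  set V := _ `^ _ in p1 *.
  have -> : V / (t / 2) = 2 / t * V by field; rewrite gt_eqF.
  have : 0 <= 2 / t by rewrite divr_ge0// ltW.
  move: (2 / t) => z z0 hz.
  have : 0 <= (lj - 1) * (z * V) by rewrite mulr_ge0 ?subr_ge0// mulr_ge0//; lra.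
  have : 0 <= (V - 1) * lj by rewrite mulr_ge0 ?subr_ge0//; lra.
  by rewrite !mulrDl; lra.
rewrite -[leLHS]add0r lerD//.
  by rewrite mulr_ge0 ?(ltW D0)// invr_ge0 exprn_ge0.
apply: (@le_trans _ _ ((2 + ld) * (eta * j%:R `^ (t - 1) / al * expR 4))).
  by rewrite ler_wpM2l ?(ltW D0)// ler_pM ?(ltW W0)// expR_ge0.
have -> : (2 + ld) * (eta * j%:R `^ (t - 1) / al * expR 4) =
    (eta * expR 4 * j%:R `^ (t - 1)) * ((2 + ld) / al) by ring.
apply: (@le_trans _ _ ((eta * expR 4 * j%:R `^ (t - 1)) *
   (2 * decay / (1 - t) * ((3 + 2 / t) * (d%:R / j%:R) `^ (t / 2))))).
  by rewrite ler_wpM2l// mulr_ge0 ?(ltW jt0)// mulr_ge0 ?(ltW eta0) ?(ltW e4).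
have -> : (d%:R / j%:R : R) `^ (t / 2) = d%:R `^ (t / 2) * j%:R `^ (- (t / 2)).
  by rewrite powRM ?invr_ge0 ?(ltW d0) ?(ltW j0)// powRN -[j%:R^-1]powR_inv1 ?(ltW j0)//
    -powRrM mulN1r powRN.
have -> : (j%:R : R) `^ (t / 2 - 1) = j%:R `^ (t - 1) * j%:R `^ (- (t / 2)).
  by rewrite -powRD ?(gt_eqF j0) ?implybT//; congr (_ `^ _); lra.
by rewrite le_eqVlt; apply/orP; left; apply/eqP; ring.
Qed.

Lemma EXP_WT_weighted s t : 1 < s -> 0 < t < 1 ->
  (forall eta, 0 < eta -> exists N, forall j, (N <= j)%N ->
     (j%:R : R) `^ (1 - t) * a j * om `^ a j <= eta) ->
  EXP_WT om a b cls cr s t.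
Proof.
move=> s1 t01 ha; have /andP[t0 t1] := t01.
apply: (EXP_WT_upper hom ha1 hamono hb0 hb) => //; first by lra.
move=> eta eta0; have t2 : 0 < t / 2 < 1 by lra.
have [K K0 KP] := sum_ln_rho_le (ltac:(lra) : (0 : R) < 1 / 2).
pose Q := expR 4 * (2 * decay / (1 - t)) * (3 + 2 / t).
have Q0 : 0 < Q.
  rewrite mulr_gt0 ?addr_gt0 ?divr_gt0// mulr_gt0 ?expR_gt0// divr_gt0 ?mulr_gt0//.
  by lra.
(* Chosen so that 3 (K + 1) et Q d^t / (t/2) = (eta / 4) d^t. *)
pose et := eta * (t / 2) / (12 * (K + 1) * Q).
have K1 : 0 < K + 1 by lra.
have et0 : 0 < et.
  by apply: divr_gt0; [apply: mulr_gt0; lra|apply: mulr_gt0 Q0; lra].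
have [N1 N1P] := ha et et0.
(* With a_j >= a_1 this gives decay a_j >= (1 - t) ln j + ln a_1, and the threshold for [N3] makes
   the right side at least half of (1 - t) ln j. *)
have [N2 N2P] := ha 1 ltr01.
have [N3 N3P] := large_ln (Num.max 1 (- (2 * ln (a 1%N) / (1 - t)))).
pose k0 := maxn (maxn N1 N2) (maxn N3 1).
have [C1 C10 C1P] := mul_ln_small s1 t0 (ltac:(lra) : 0 < eta / 48).
have k02 : (0 : R) < k0%:R + 2 by rewrite ltr_wpDl.
have e2 : 0 < eta / (24 * (K + 1) * (k0%:R + 2)).
  by rewrite divr_gt0 ?mulr_gt0//; lra.
have [C2 C20 C2P] := ln_small t0 e2.
exists (24 * C1 + 6 * (K + 1) * (k0%:R + 2) * C2) => d eps d0 he.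
set y := 1 + ln eps^-1; have y1 : 1 <= y by exact: logeps_ge1.
have dR : (1 : R) <= d%:R by rewrite ler1n.
have dR0 : (0 : R) < d%:R by lra.
have ld0 : 0 <= ln (d%:R : R) by exact: ln_ge0.
set D := 2 + ln (d%:R : R).
have D0 : 0 < D by rewrite /D; lra.
have Di : D^-1 <= 1 / 2 by rewrite -[leLHS]mul1r ler_pdivrMr// /D; lra.
have Di0 : 0 < D^-1 by rewrite invr_gt0.
pose tau := 1 - D^-1.
pose S := \sum_(k < d) om `^ (tau * a k.+1).
have S0 : 0 <= S by apply: sumr_ge0 => k _; exact: powR_ge0.
exists tau, (K * S); split=> [|M|].
- by rewrite /tau; lra.
- by apply: KP; rewrite /tau; lra.
have SB : D * S <= D * (k0%:R + 2) + et * Q * (d%:R `^ t / (t / 2)).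
  apply: (@le_trans _ _ (\sum_(k < d) (D * (if (k < k0)%N then 1 else 0) +
     D * (k.+1%:R ^+ 2)^-1 + et * Q * (d%:R `^ (t / 2) * k.+1%:R `^ (t / 2 - 1))))).
    rewrite mulr_sumr; apply: ler_sum => k _.
    have kR : (0 : R) < k.+1%:R by rewrite ltr0n.
    have P1 : 0 <= D * (k.+1%:R ^+ 2)^-1.
      by rewrite mulr_ge0 ?(ltW D0)// invr_ge0 exprn_ge0// ltW.
    have P2 : 0 <= et * Q * (d%:R `^ (t / 2) * k.+1%:R `^ (t / 2 - 1)).
      apply: mulr_ge0; apply: mulr_ge0; try exact: powR_ge0; exact: ltW.
    case: ifPn => kk0.
      rewrite -[leLHS]addr0 -addrA lerD ?addr_ge0// ler_wpM2l ?(ltW D0)//.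
      rewrite -[leRHS](powRr0 om); apply: (powR_om_le hom).
      by rewrite mulr_ge0 ?(ltW (a_gt0 ha1 hamono (ltn0Sn k)))// /tau; lra.
    rewrite mulr0 add0r; move: kk0; rewrite -leqNgt /k0 !geq_max => /andP[/andP[n1 n2] /andP[n3 _]].
    have := N3P _ (leqW n3); rewrite ge_max => /andP[lk1 lk2].
    apply: powR_om_cutoff => //; last exact/N1P/leqW.
    have ak := a_gt0 ha1 hamono (ltn0Sn k).
    have h := N2P _ (leqW n2).
    have h2 : k.+1%:R `^ (1 - t) * a 1%N * om `^ a k.+1 <= 1.
      apply: le_trans h; rewrite ler_wpM2r ?powR_ge0// ler_wpM2l ?powR_ge0//.
      exact: a_mono.
    move: h2; rewrite (powR_decay hom) powR_ln// -{1}(@lnK _ (a 1%N)) ?posrE//.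
    rewrite -!expRD expR_le1.
    have : - ln (a 1%N) <= (1 - t) / 2 * ln k.+1%:R.
      by move: lk2; rewrite -mulNr ler_pdivrMr ?subr_gt0//; lra.
    lra.
  rewrite !big_split /= -!mulr_sumr -mulrDr; apply: lerD.
    rewrite ler_wpM2l ?(ltW D0)// lerD ?sum_indicator1_le ?sum_inv_sqr//.
  have eQ : 0 <= et * Q by apply: mulr_ge0; exact: ltW.
  rewrite ler_wpM2l//.
  have -> : d%:R `^ t / (t / 2) = d%:R `^ (t / 2) * (d%:R `^ (t / 2) / (t / 2)) :> R.
    rewrite mulrA -powRD ?(gt_eqF dR0) ?implybT//.
    by rewrite (_ : t / 2 + t / 2 = t)//; lra.
  by rewrite ler_wpM2l ?powR_ge0// sum_powR_le.
have -> : 1 - tau = D^-1 by rewrite /tau; ring.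
rewrite invrK.
have x0 : 0 <= ln eps^-1 by move: y1; rewrite /y; lra.
have hC1 := C1P y d%:R y1 dR.
have hC2 := C2P d%:R dR.
have part1 : 3 * D * (2 * tau * ln eps^-1 + 4 * tau) <= eta / 2 * (y `^ s + d%:R `^ t) + 24 * C1.
  apply: (@le_trans _ _ (24 * (y * (1 + ln d%:R)))); last by lra.
  have h1 : 2 * tau * ln eps^-1 + 4 * tau <= 4 * y.
    have : tau * ln eps^-1 <= ln eps^-1 by rewrite ler_piMl// /tau; lra.
    have : tau <= 1 by rewrite /tau; lra.
    by rewrite /y -mulrA; move: (tau * _) => V; lra.
  apply: (@le_trans _ _ (3 * D * (4 * y))); first by rewrite ler_wpM2l//; lra.
  have : D * y <= 2 * (1 + ln d%:R) * y.
    by rewrite ler_wpM2r ?(le_trans ler01)// /D; lra.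
  lra.
have part2 : 3 * (K * (D * S)) <= eta / 2 * d%:R `^ t + 6 * (K + 1) * (k0%:R + 2) * C2.
  apply: (@le_trans _ _ (3 * ((K + 1) * (D * (k0%:R + 2) + et * Q * (d%:R `^ t / (t / 2)))))).
    rewrite ler_pM2l//; apply: ler_pM => //; first by rewrite mulr_ge0// ltW.
    lra.
  have -> : 3 * ((K + 1) * (D * (k0%:R + 2) + et * Q * (d%:R `^ t / (t / 2)))) =
      3 * (K + 1) * (k0%:R + 2) * D + eta / 4 * d%:R `^ t.
    by rewrite /et; field; rewrite !gt_eqF//; lra.
  have : 3 * (K + 1) * (k0%:R + 2) * D <= 6 * (K + 1) * (k0%:R + 2) * (1 + ln d%:R).
    have -> : 6 * (K + 1) * (k0%:R + 2) * (1 + ln d%:R) =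
      3 * (K + 1) * (k0%:R + 2) * (2 * (1 + ln d%:R)) by ring.
    rewrite ler_wpM2l; [by []| |by rewrite /D; lra].
    by rewrite !mulr_ge0//; lra.
  have : 6 * (K + 1) * (k0%:R + 2) * (1 + ln d%:R) <=
      eta / 4 * d%:R `^ t + 6 * (K + 1) * (k0%:R + 2) * C2.
    have -> : eta / 4 * d%:R `^ t + 6 * (K + 1) * (k0%:R + 2) * C2 =
       6 * (K + 1) * (k0%:R + 2) * (eta / (24 * (K + 1) * (k0%:R + 2)) * d%:R `^ t + C2).
      by field; rewrite !gt_eqF//; lra.
    by rewrite ler_wpM2l// !mulr_ge0//; lra.
  by move: (d%:R `^ t) => V; move: (6 * _ * _ * (1 + _)) (3 * _ * _ * _) => V1 V2; lra.
have ys0 : 0 <= eta * y `^ s by rewrite mulr_ge0 ?powR_ge0// ltW.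
have -> : 3 * D * (2 * tau * ln eps^-1 + 4 * tau + K * S) =
  3 * D * (2 * tau * ln eps^-1 + 4 * tau) + 3 * (K * (D * S)) by ring.
move: part1 part2 ys0; move: (3 * D * _) (3 * (K * _)) (6 * _ * _ * _) => V1 V2 V3.
by lra.
Qed.

End SufficiencyLog.

(** * Necessity *)

Section Necessity.
Variables (R : realType) (om : R) (a b : nat -> R) (b0 : R).
Hypothesis hom : 0 < om < 1.
Hypothesis ha1 : 0 < a 1%N.
Hypothesis hamono : forall j : nat, (1 <= j)%N -> a j <= a j.+1.
Hypothesis hb0 : 0 < b0.
Hypothesis hb : forall j : nat, (1 <= j)%N -> b0 <= b j.
Variables (cls : info_class) (cr : criterion).

Local Notation rho := (rho om a b).
Local Notation wsum := (wsum om a b).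
Local Notation decay := (decay om).

Lemma EXP_WT_elim s t eta : EXP_WT om a b cls cr s t -> 0 < eta ->
  exists N : nat, forall d eps, (0 < d)%N -> (N <= d)%N -> 0 < eps < 1 ->
    exists n : nat, nstar om a b cls cr eps d = (n%:R)%:E /\
      ln n%:R <= eta * ((1 + ln eps^-1) `^ s + d%:R `^ t).
Proof.
move=> H /H[M HM]; have [N NP] := large_nat M; exists N => d eps d0 Nd he.
have /andP[e0 e1] := he.
have y1 := logeps_ge1 he.
have [|n [nE hn]] := HM d eps d0 he.
  by apply: le_lt_trans (NP d Nd) _; rewrite ltrDr invr_gt0.
exists n; split => //; set T := (1 + ln eps^-1) `^ s + d%:R `^ t in hn *.
have T0 : 0 < T.
  by rewrite ltr_wpDr ?powR_ge0// powR_gt0//; lra.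
by have := le_lt_trans (ler_norm _) hn; rewrite ltr_pdivrMr// => /ltW.
Qed.

Lemma not_cvg_pinftyP (f : nat -> R) : ~ (f @ \oo --> +oo) ->
  exists2 A, 1 <= A & forall N, exists2 j, (N <= j)%N & f j < A.
Proof.
move=> /cvg_pinftyP/existsNP[A /forallNP hA].
exists (Num.max A 1); first by rewrite le_max lexx orbT.
move=> N; have /existsNP[j /not_implyP[Nj /negP]] := hA N.
by rewrite -ltNge => h; exists j => //; rewrite lt_max h.
Qed.

Lemma fact_le_expn r : (r`! <= r ^ r)%N.
Proof.
elim: r => [//|r IH]; rewrite factS expnS leq_mul2l /=; apply: leq_trans IH _.
by case: r => // r; rewrite leq_exp2r.
Qed.

(** Every factor of the falling factorial is at least d - r, and r! <= r^r. *)
Lemma expn_le_binomial d r : (r <= d)%N -> ((d - r) ^ r <= 'C(d, r) * r ^ r)%N.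
Proof.
move=> rd; apply: (@leq_trans (d ^_ r)); last first.
  by rewrite -bin_ffact leq_mul2l fact_le_expn orbT.
elim: r rd => [//|r IH] rd; rewrite expnSr ffactnSr leq_mul ?leq_sub2l//.
apply: leq_trans (IH (ltnW rd)); case: r {IH rd} => // r.
by rewrite leq_exp2r// leq_sub2l.
Qed.

Lemma ln_binomial_ge d r (z : R) : (0 < r)%N -> (r <= d)%N -> 0 < z ->
  z * r%:R <= d%:R - r%:R -> r%:R * ln z <= ln ('C(d, r))%:R.
Proof.
move=> r0 rd z0 hz; have rR : (0 : R) < r%:R by rewrite ltr0n.
have C0 : (0 : R) < 'C(d, r)%:R by rewrite ltr0n bin_gt0.
rewrite mulr_natl -lnXn// ler_ln ?posrE ?exprn_gt0//.
have rp : (0 : R) < r%:R ^+ r by exact: exprn_gt0.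
rewrite -(ler_pM2r rp) -exprMn; apply: (@le_trans _ _ ((d%:R - r%:R) ^+ r)).
  by rewrite lerXn2r ?nnegrE ?subr_ge0 ?ler_nat// mulr_ge0// ltW.
by rewrite -natrB// -!natrX -natrM ler_nat expn_le_binomial.
Qed.

(** For this eps, 4 eps^2 e^L = 4 e^(-2) om^(r a_d), and 4 < e^2. *)
Lemma nstar_ge_binomial_exp d r n L : (0 < d)%N -> (r <= d)%N ->
  (forall M, wsum 1 d M <= expR L) ->
  nstar om a b cls cr (expR (- ((2 + L + decay * (r%:R * a d)) / 2))) d = (n%:R)%:E ->
  ('C(d, r) <= n)%N.
Proof.
move=> d0 rd hL nE; have e0 := expR_gt0 (- ((2 + L + decay * (r%:R * a d)) / 2)).
apply: (nstar_ge_binomial hom hamono hb0 hb rd d0 e0 hL _ nE).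
rewrite -expRM_natl (powR_decay hom) -mulrA -expRD.
have -> : 2%:R * - ((2 + L + decay * (r%:R * a d)) / 2) + L = - 1 - 1 - decay * (r%:R * a d).
  by field.
have e2 : 2 < expR 1 :> R by have := @expR_gt1Dx R 1 (oner_neq0 _); rewrite (_ : 1 + 1 = 2).
have u4 : 4 * expR (- 1 - 1) < 1 :> R.
  rewrite expRD expRN -invfM mulrC -ltr_pdivlMr// mul1r ltf_pV2 ?posrE ?mulr_gt0 ?expR_gt0//.
  by nra.
by rewrite expRD [ltLHS]mulrA gtr_pMl// expR_gt0.
Qed.

Lemma wsum_le_exp : exists2 K, 0 <= K & forall d M, wsum 1 d M <= expR (K * d%:R).
Proof.
have [p pb] := exponent_exists hb0 2.
have K0 : 0 <= rho_const om p / a 1%N ^+ p.+1.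
  by rewrite divr_ge0 ?rho_const_ge0// exprn_ge0// ltW.
exists (rho_const om p / a 1%N ^+ p.+1) => // d M.
rewrite (wsum_lnE a hom hb0 hb) ler_expR.
rewrite mulr_natr -[in leRHS](card_ord d) -sumr_const; apply: ler_sum => k _.
apply: le_trans (ln_rho_le_rho om a b _ _ _) _.
apply: le_trans (rho_le_pow hom ha1 hamono hb k M pb ltr01) _.
apply: div_exprn_le => //; first exact: rho_const_ge0.
by rewrite mul1r; exact: a_mono.
Qed.

Lemma ln2_ge : 1 / 2 <= ln 2 :> R.
Proof.
have h : - 1 < - (1 / 2) :> R by lra.
have := le_ln1Dx h.
have -> : 1 + - (1 / 2) = 2^-1 :> R by lra.
by rewrite lnV ?posrE//; lra.
Qed.

Lemma ln8_bounds : 0 <= ln (8 : R) <= 3.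
Proof.
have -> : 8 = 2 ^+ 3 :> R by ring.
rewrite lnXn//; have := ln2_le1 R; have := ln2_ge.
by move: (ln 2) => w h1 h2; rewrite -mulr_natl; apply/andP; split; lra.
Qed.

Lemma eps_exp (x : R) : 0 < x -> 0 < expR (- x) < 1.
Proof. by move=> x0; rewrite expR_gt0 expR_lt1 oppr_lt0. Qed.

Lemma ln_eps_exp (x : R) : ln (expR (- x))^-1 = x.
Proof. by rewrite -expRN opprK expRK. Qed.

(** If a_d < A d^((1-s)/s) for arbitrarily large d, take r about d/4. Then ln n >= ln C(d,r) >=
    d/16, although x = ln(1/eps) is only O(d^(1/s)), so (1 + x)^s + d^t is O(d). *)
Lemma EXP_WT_power_necessary s t : 0 < s < 1 -> 0 < t <= 1 ->
  EXP_WT om a b cls cr s t ->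
  (fun j : nat => a j / (j%:R : R) `^ ((1 - s) / s)) @ \oo --> +oo.
Proof.
move=> /andP[s0 s1] /andP[t0 t1] H; apply: contrapT => /not_cvg_pinftyP[A A1 hA].
have c0 := decay_gt0 hom.
have [K1 K10 K1P] := wsum_le_exp.
pose K2 := 2 + K1 + decay * A.
have cA : 0 < decay * A by rewrite mulr_gt0//; lra.
have K20 : 2 <= K2 by rewrite /K2; lra.
pose K3 := K2 `^ s + 1.
have K30 : 0 < K3 by rewrite ltr_wpDl ?powR_ge0.
have e0 : 0 < 1 / (32 * K3) by rewrite divr_gt0// mulr_gt0.
have [N NP] := EXP_WT_elim H e0.
have [d Nd had] := hA (maxn N 8).
have {Nd}[Nd d8] : (N <= d)%N /\ (8 <= d)%N by move: Nd; rewrite geq_max => /andP.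
have d0 : (0 < d)%N by exact: leq_trans d8.
have d8R : 8 <= d%:R :> R by rewrite ler_nat.
have dR : 0 < d%:R :> R by lra.
pose r := (d %/ 4)%N.
have rd : (r <= d)%N by exact: leq_div.
have rd8 : d%:R / 8 <= r%:R :> R.
  have := ltn_ceil d (isT : (0 < 4)%N); rewrite -/r -(ltr_nat R) natrM -natr1.
  by move=> h; lra.
have r4d : r%:R * 4 <= d%:R :> R by rewrite -natrM ler_nat leq_divM.
have r0 : (0 < r)%N by rewrite -(ltr0n R); lra.
set L := K1 * d%:R in K1P.
pose x := (2 + L + decay * (r%:R * a d)) / 2.
have ad0 := a_gt0 ha1 hamono d0.
have L0 : 0 <= L by rewrite mulr_ge0// ltW.
have ra0 : 0 < decay * (r%:R * a d) by rewrite mulr_gt0// mulr_gt0// ltr0n.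
have x0 : 0 < x by rewrite /x; lra.
have [n [nE nT]] := NP d _ d0 Nd (eps_exp x0).
have hC := nstar_ge_binomial_exp d0 rd (K1P d) nE.
have ln1 : d%:R / 16 <= ln n%:R :> R.
  have z0 : (0 : R) < 2 by [].
  have zr : 2 * r%:R <= d%:R - r%:R :> R by lra.
  have h1 := ln_binomial_ge r0 rd z0 zr.
  apply: (@le_trans _ _ (r%:R * ln 2)).
    apply: (@le_trans _ _ (d%:R / 8 * (1 / 2))); first lra.
    by apply: ler_pM; rewrite ?ln2_ge//; lra.
  apply: le_trans h1 _; have C0 : (0 < 'C(d, r))%N by rewrite bin_gt0.
  by rewrite ler_ln ?posrE ?ltr0n ?(leq_trans C0 hC)// ler_nat.
rewrite ln_eps_exp in nT.
have ds : d%:R <= d%:R `^ s^-1 :> R.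
  apply: le1r_powR; first lra.
  by rewrite -[leLHS]invr1 lef_pV2 ?posrE//; lra.
have dE : d%:R * d%:R `^ ((1 - s) / s) = d%:R `^ s^-1 :> R.
  rewrite -[X in X * _](powRr1 (ltW dR)) -powRD ?(gt_eqF dR) ?implybT//.
  by congr (_ `^ _); field; rewrite gt_eqF.
have hra : r%:R * a d <= A * d%:R `^ s^-1.
  rewrite -dE mulrCA; apply: ler_pM => //; first exact: ltW.
    by rewrite ler_nat.
  by rewrite -ler_pdivrMr ?powR_gt0// ltW.
have yK : 1 + x <= K2 * d%:R `^ s^-1.
  have h1 : L <= K1 * d%:R `^ s^-1 by rewrite ler_wpM2l.
  have h2 : decay * (r%:R * a d) <= decay * A * d%:R `^ s^-1.
    by rewrite -mulrA ler_wpM2l// ltW.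
  have h3 : 4 <= 4 * d%:R `^ s^-1 :> R by lra.
  have h4 : 0 <= (K1 + decay * A) * d%:R `^ s^-1 by rewrite mulr_ge0 ?powR_ge0//; lra.
  rewrite /x /K2; move: h1 h2 h3 h4; move: (d%:R `^ _) => V h1 h2 h3 h4.
  by rewrite !mulrDl in h4 *; lra.
have yd : (1 + x) `^ s <= K2 `^ s * d%:R.
  have {1}-> : d%:R = (d%:R `^ s^-1) `^ s :> R by rewrite -powRrM mulVf ?gt_eqF// powRr1// ltW.
  rewrite -powRM ?powR_ge0//; last by lra.
  by apply: ge0_ler_powR; rewrite ?nnegrE ?mulr_ge0 ?powR_ge0//; lra.
have dt : d%:R `^ t <= d%:R :> R by apply: ler1_powR => //; lra.
have : 1 / (32 * K3) * ((1 + x) `^ s + d%:R `^ t) <= d%:R / 32.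
  have -> : d%:R / 32 = 1 / (32 * K3) * (K3 * d%:R) by field; rewrite gt_eqF.
  rewrite ler_wpM2l ?(ltW e0)//; rewrite /K3 mulrDl mul1r; exact: lerD.
move=> h; have := le_trans ln1 (le_trans nT h); lra.
Qed.

(** Sharper than [wsum_le_exp] for t < 1; needed once r is chosen of smaller order than d. *)
Lemma EXP_WT_wsum s t : EXP_WT om a b cls cr s t ->
  exists N : nat, forall d, (0 < d)%N -> (N <= d)%N -> forall M,
    wsum 1 d M <= expR (2 + (1 + ln 8) `^ s + d%:R `^ t).
Proof.
move=> H; have [N NP] := EXP_WT_elim H ltr01.
exists N => d d0 Nd M.
have [|n [nE nT]] := NP d 8^-1 d0 Nd; first by lra.
rewrite invrK mul1r in nT.
have h := nstar_eighth_ge hom ha1 hamono hb0 hb M nE.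
have W1 := wsum_ge1 a hom hb0 hb 1 d M.
have n0 : 0 < n%:R :> R by lra.
apply: le_trans h _; rewrite -[leLHS]lnK ?posrE ?mulr_gt0// ler_expR lnM ?posrE//.
have : ln 4 <= 2 :> R.
  have -> : 4 = 2 ^+ 2 :> R by ring.
  by rewrite lnXn// mulr2n; have := ln2_le1 R; lra.
by lra.
Qed.

(** If a_d < A ln d for arbitrarily large d, take r about d^p. Then ln C(d,r) is at least of order r
    ln d, whereas ln(1/eps) and d^t are both O(r ln d), so a small eta gives a contradiction. *)
Lemma EXP_WT_log_necessary t : 0 < t < 1 -> EXP_WT om a b cls cr 1 t ->
  (fun j : nat => a j / ln (j%:R : R)) @ \oo --> +oo.
Proof.
move=> /andP[t0 t1] H; apply: contrapT => /not_cvg_pinftyP[A A1 hA].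
have c0 := decay_gt0 hom.
have [N1 N1P] := EXP_WT_wsum H.
(* As p > t, d^t and the bound for ln S_1 are O(r); as p < 1, (d - r)/r exceeds a positive power z
   of d. *)
pose p := (1 + t) / 2.
have p0 : 0 < p by rewrite /p; lra.
pose K3 := 12 + decay * A.
have cA : 0 < decay * A by rewrite mulr_gt0//; lra.
have K30 : 0 < K3 by rewrite /K3; lra.
have t18 : 0 < 1 - t by lra.
have e0 : 0 < (1 - t) / (8 * K3) by rewrite divr_gt0// mulr_gt0.
have [N2 N2P] := EXP_WT_elim H e0.
have [N3 N3P] := large_ln (1 : R).
have [N4 N4P] := large_powR 2 p0.
have t14 : 0 < (1 - t) / 4 by lra.
have [N5 N5P] := large_powR 2 t14.
have [d Nd had] := hA (maxn (maxn N1 N2) (maxn (maxn N3 N4) (maxn N5 1))).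
move: Nd; rewrite !geq_max => /andP[/andP[n1 n2] /andP[/andP[n3 n4] /andP[n5 d0]]].
have {N3P}ld1 := N3P _ n3; have {N4P}dp2 := N4P _ n4; have {N5P}dz2 := N5P _ n5.
have dR : 0 < d%:R :> R by rewrite ltr0n.
have d1 : 1 <= d%:R :> R by rewrite ler1n.
set ld := ln (d%:R : R) in had ld1.
have ad0 := a_gt0 ha1 hamono d0.
have ada : a d <= A * ld by rewrite -ler_pdivrMr ?ltW//; lra.
set z := d%:R `^ ((1 - t) / 4) in dz2.
have zz : z * z * d%:R `^ p = d%:R :> R.
  rewrite /z -!powRD ?(gt_eqF dR) ?implybT//.
  by rewrite [X in _ `^ X](_ : _ = 1) ?powRr1 ?(ltW dR)// /p; lra.
pose r := Num.truncn (d%:R `^ p : R).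
have rp : r%:R <= d%:R `^ p :> R by rewrite truncn_le powR_ge0.
have pr : d%:R `^ p < r%:R + 1 :> R by rewrite natr1; exact: truncnS_gt.
set V := d%:R `^ p in zz dp2 rp pr.
have r0 : (0 < r)%N by rewrite truncn_gt0 -/V; lra.
have r1 : 1 <= r%:R :> R by rewrite ler1n.
have Vr : V <= 2 * r%:R by lra.
have hz : z * r%:R <= d%:R - r%:R.
  have h1 : z * z * r%:R <= d%:R by rewrite -zz ler_wpM2l// mulr_ge0; lra.
  have h2 : 0 <= (z * z - z - 1) * r%:R by rewrite mulr_ge0//; nra.
  by rewrite !mulrBl in h2; lra.
have zr0 : 0 <= z * r%:R by rewrite mulr_ge0//; lra.
have rd : (r <= d)%N by rewrite -(ler_nat R); lra.
have dtV : d%:R `^ t <= V by apply: ler_powR => //; rewrite /p; lra.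
set L := 2 + (1 + ln 8) `^ 1 + d%:R `^ t.
have l8 := ln8_bounds.
have dt0 : 0 <= d%:R `^ t :> R by exact: powR_ge0.
have hL : 0 <= L <= 6 + d%:R `^ t.
  by rewrite /L powRr1; [apply/andP; split|]; lra.
pose x := (2 + L + decay * (r%:R * a d)) / 2.
have ra0 : 0 < decay * (r%:R * a d) by rewrite mulr_gt0// mulr_gt0// ltr0n.
have x0 : 0 < x by rewrite /x; lra.
have [n [nE nT]] := N2P d _ d0 n2 (eps_exp x0).
have hC := nstar_ge_binomial_exp d0 rd (N1P d d0 n1) nE.
rewrite ln_eps_exp powRr1 in nT; last by lra.
have h1 : (1 - t) / 4 * (r%:R * ld) <= ln n%:R :> R.
  have z0 : 0 < z by lra.
  have h := ln_binomial_ge r0 rd z0 hz.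
  have C0 : (0 < 'C(d, r))%N by rewrite bin_gt0.
  apply: (@le_trans _ _ (r%:R * ln z)); first by rewrite /z ln_powR mulrCA.
  apply: le_trans h _.
  by rewrite ler_ln ?posrE ?ltr0n ?(leq_trans C0 hC)// ler_nat.
have rl : r%:R <= r%:R * ld by rewrite ler_peMr//; lra.
have hT : 1 + x + d%:R `^ t <= K3 * (r%:R * ld).
  have h2 : decay * (r%:R * a d) <= decay * A * (r%:R * ld).
    rewrite -mulrA ler_wpM2l ?(ltW c0)// mulrCA ler_wpM2l//; lra.
  rewrite /x /K3 mulrDl; move: h2 rl ra0.
  move: (r%:R * ld) (decay * (_ * _)) => X Y h2 rl ra0.
  by lra.
have : (1 - t) / (8 * K3) * (1 + x + d%:R `^ t) <= (1 - t) / 8 * (r%:R * ld).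
  have -> : (1 - t) / 8 * (r%:R * ld) = (1 - t) / (8 * K3) * (K3 * (r%:R * ld)).
    by field; rewrite gt_eqF.
  by rewrite ler_wpM2l ?(ltW e0).
move=> h; have := le_trans h1 (le_trans nT h).
have := mulr_gt0 t18 (mulr_gt0 (lt_le_trans ltr01 r1) (lt_le_trans ltr01 ld1)).
by lra.
Qed.

End Necessity.

(** * Necessity of the weighted condition through the entropy bound *)

Section NecessityEntropy.
Variables (R : realType) (om : R) (a b : nat -> R) (b0 : R).
Hypothesis hom : 0 < om < 1.
Hypothesis ha1 : 0 < a 1%N.
Hypothesis hamono : forall j : nat, (1 <= j)%N -> a j <= a j.+1.
Hypothesis hb0 : 0 < b0.
Hypothesis hb : forall j : nat, (1 <= j)%N -> b0 <= b j.

Local Notation rho := (rho om a b).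
Local Notation wsum := (wsum om a b).
Local Notation decay := (decay om).

Lemma rho_ge k M : (0 < M)%N -> 2 * om `^ a k.+1 <= rho 1 k M.
Proof.
case: M => // M _; rewrite ler_pM2l// big_ord_recl /= powR1 mulr1 mul1r lerDl.
by apply: sumr_ge0 => i _; exact: powR_ge0.
Qed.

Lemma ln1D_ge (u : R) : 0 <= u -> u / (1 + u) <= ln (1 + u).
Proof.
move=> u0; have h : 0 < 1 + u by lra.
have := @le_ln1Dx R (- (u / (1 + u))).
have -> : 1 + - (u / (1 + u)) = (1 + u)^-1 by field; rewrite gt_eqF.
rewrite lnV ?posrE// lerN2; apply.
by rewrite ltrN2 ltr_pdivrMr// mul1r; lra.
Qed.

(** Each of the first k factors of S_1 is at least 1 + 2 om^(a_k). A bound for S_1 thus becomes a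
    lower bound for a_k of order ln k. *)
Lemma powR_om_le_wsum k : (0 < k)%N -> k%:R * om `^ a k <= 2 * ln (wsum 1 k 1).
Proof.
move=> k0; set p := om `^ a k.
have p0 : 0 <= p by exact: powR_ge0.
have p1 : p <= 1.
  rewrite -[leRHS](powRr0 om); apply: (powR_om_le hom).
  exact/ltW/(a_gt0 ha1 hamono).
rewrite (wsum_lnE a hom hb0 hb) expRK.
rewrite mulr_natl -[in leLHS](card_ord k) -sumr_const mulr_sumr; apply: ler_sum => i _.
have h : 2 * p <= rho 1 i 1.
  apply: le_trans (rho_ge i (ltn0Sn 0)); rewrite ler_pM2l//.
  by apply: (powR_om_le hom); exact: a_mono.
have r0 := rho_ge0 om a b 1 i 1.
apply: (@le_trans _ _ (2 * ln (1 + 2 * p))); last first.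
  by rewrite ler_pM2l// ler_ln ?posrE; lra.
have p20 : 0 <= 2 * p by lra.
apply: (@le_trans _ _ (2 * (2 * p / (1 + 2 * p)))); last by rewrite ler_pM2l// ln1D_ge.
by rewrite mulrA ler_pdivlMr; nra.
Qed.

Lemma rho_contract de ka k M : 0 <= de -> om `^ (de * a k.+1) <= ka ->
  rho (1 + de) k M <= ka * rho 1 k M.
Proof.
move=> de0 hka; rewrite /rho mulrCA ler_pM2l// mulr_sumr; apply: ler_sum => m _.
rewrite mulrDl powRD; last by have /andP[om0 _] := hom; rewrite (gt_eqF om0) implybT.
rewrite mulrC ler_wpM2r ?powR_ge0//; apply: le_trans hka.
apply: (powR_om_le hom); rewrite ler_wpM2l//.
rewrite ler_peMr ?(ltW (a_gt0 ha1 hamono (ltn0Sn k)))//.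
rewrite -[leLHS](powRr0 m.+1%:R); apply: ler_powR; first by rewrite ler1n.
by apply: ltW; apply: lt_le_trans hb0 (hb _).
Qed.

(** Uses ln v >= 1 - 1/v at v = (1 + r)/(1 + ka r), where the right side is (1 - ka) r/(1 + r). *)
Lemma ln_contract_ge (ka r r' p : R) : 0 <= ka -> ka <= 1 -> 0 <= r' -> r' <= ka * r ->
  0 <= p -> p <= 1 -> 2 * p <= r ->
  (1 - ka) * p / 2 <= ln (1 + r) - ln (1 + r').
Proof.
move=> ka0 ka1 r'0 r'r p0 p1 pr.
have r0 : 0 <= r by lra.
have h1 : 0 < 1 + r by lra.
have kr : 0 <= ka * r by exact: mulr_ge0.
apply: (@le_trans _ _ (ln (1 + r) - ln (1 + ka * r))); last first.
  by rewrite lerD2l lerN2 ler_ln ?posrE; lra.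
rewrite -ln_div ?posrE//; last by lra.
have h2 : 0 < 1 + ka * r by lra.
have kr1 : ka * r <= r by rewrite ler_piMl.
have uE : (1 + r) / (1 + ka * r) = 1 + (r - ka * r) / (1 + ka * r).
  by field; rewrite gt_eqF.
have u0 : 0 <= (r - ka * r) / (1 + ka * r) by rewrite divr_ge0 ?subr_ge0// ltW.
rewrite uE; apply: le_trans (ln1D_ge u0); rewrite -uE.
have -> : (r - ka * r) / (1 + ka * r) / ((1 + r) / (1 + ka * r)) = (1 - ka) * (r / (1 + r)).
  by field; rewrite !gt_eqF.
rewrite -mulrA ler_wpM2l ?subr_ge0//.
apply: (@le_trans _ _ (2 * p / (1 + 2 * p))).
  by rewrite ler_pdivlMr; nra.
by rewrite ler_pdivlMr// mulrAC ler_pdivrMr; nra.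
Qed.

Lemma le_rho_exponent de k M : 0 <= de -> rho (1 + de) k M <= rho 1 k M.
Proof.
move=> de0; rewrite -[leRHS]mul1r; apply: rho_contract => //.
rewrite -[leRHS](powRr0 om); apply: (powR_om_le hom).
by rewrite mulr_ge0// (ltW (a_gt0 ha1 hamono (ltn0Sn k))).
Qed.

(** Only the upper half of the coordinates is used, at least d/3 of them with equality at d = 3; the
    remaining terms are nonnegative. *)
Lemma sum_ln_contract_ge de ka d M : (1 < d)%N -> (0 < M)%N -> 0 <= de -> 0 <= ka <= 1 ->
  (forall k, (d <= 2 * k)%N -> om `^ (de * a k.+1) <= ka) ->
  d%:R * ((1 - ka) * om `^ a d) / 6 <=
    \sum_(k < d) (ln (1 + rho 1 k M) - ln (1 + rho (1 + de) k M)).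
Proof.
move=> d1 M0 de0 /andP[ka0 ka1] hka; have d0 := ltnW d1; set p := om `^ a d.
have p0 : 0 <= p by exact: powR_ge0.
have p1 : p <= 1.
  rewrite -[leRHS](powRr0 om); apply: (powR_om_le hom).
  exact/ltW/(a_gt0 ha1 hamono).
pose h := uphalf d.
have hd : (h <= d)%N by rewrite leq_uphalf_double -addnn leq_addr.
have count : d%:R / 3 <= (d - h)%:R :> R.
  by rewrite ler_pdivrMr// -natrM ler_nat /h; lia.
have c0 : 0 <= (1 - ka) * p / 2 by rewrite divr_ge0// mulr_ge0// subr_ge0.
pose F k := ln (1 + rho 1 k M) - ln (1 + rho (1 + de) k M).
apply: (@le_trans _ _ ((d - h)%:R * ((1 - ka) * p / 2))).
  have -> : d%:R * ((1 - ka) * p) / 6 = d%:R / 3 * ((1 - ka) * p / 2) by field.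
  by rewrite ler_wpM2r.
rewrite -(big_mkord xpredT F) (big_cat_nat (n := h))//=.
rewrite -[leLHS]add0r lerD//.
  apply: sumr_ge0 => k _; rewrite subr_ge0 ler_ln ?posrE.
  - by rewrite lerD2l le_rho_exponent.
  - by have := rho_ge0 om a b (1 + de) k M; lra.
  - by have := rho_ge0 om a b 1 k M; lra.
rewrite mulr_natl -sumr_const_nat; apply: ler_sum_nat => k /andP[hk kd].
have r0 := rho_ge0 om a b (1 + de) k M.
apply: ln_contract_ge => //.
- by apply: rho_contract => //; apply: hka; rewrite mul2n -leq_uphalf_double.
- apply: le_trans (rho_ge k M0); rewrite ler_pM2l//.
  by apply: (powR_om_le hom); exact: a_mono.
Qed.

(** With v = decay a_d and v/2 <= e^(v/2), the lower bound on v e^(-v) forces e^(v/2) <= (2 / (decay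
    eta)) d^(1-t). *)
Lemma a_le_ln (eta : R) t d : 0 < eta -> 0 < t < 1 -> (0 < d)%N ->
  ln (2 / (decay * eta)) <= ln (d%:R : R) ->
  eta <= (d%:R : R) `^ (1 - t) * a d * om `^ a d -> decay * a d <= 4 * ln (d%:R : R).
Proof.
move=> eta0 /andP[t0 t1] d0 hl hd.
have c0 : 0 < decay by exact: decay_gt0.
have dR : 0 < d%:R :> R by rewrite ltr0n.
have l0 : 0 <= ln (d%:R : R) by rewrite ln_ge0// ler1n.
set v := decay * a d.
have v2 : v / 2 <= expR (v / 2) by apply: le_trans (expR_ge1Dx _); lra.
have E0 : 0 < expR (v / 2) by exact: expR_gt0.
have p0 : 0 < (d%:R : R) `^ (1 - t) by exact: powR_gt0.
have key : expR (v / 2) <= 2 / (decay * eta) * d%:R `^ (1 - t).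
  have vE : om `^ a d = (expR (v / 2) * expR (v / 2))^-1.
    by rewrite (powR_decay hom) -expRD -expRN; congr expR; rewrite -/v; field.
  move: hd; rewrite vE ler_pdivlMr ?mulr_gt0// => hd.
  have {hd} : eta * decay * expR (v / 2) * expR (v / 2) <= d%:R `^ (1 - t) * 2 * expR (v / 2).
    have -> : eta * decay * expR (v / 2) * expR (v / 2) =
      decay * (eta * (expR (v / 2) * expR (v / 2))) by ring.
    apply: le_trans (ler_wpM2l (ltW c0) hd) _.
    have -> : decay * (d%:R `^ (1 - t) * a d) = d%:R `^ (1 - t) * v by rewrite /v; ring.
    by rewrite -mulrA ler_wpM2l ?(ltW p0)//; lra.
  rewrite ler_pM2r// => h.
  have ce : 0 < decay * eta by exact: mulr_gt0.
  by rewrite [leRHS]mulrAC ler_pdivlMr//; move: h; congr (_ <= _); ring.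
have : v / 2 <= ln (2 / (decay * eta)) + (1 - t) * ln d%:R.
  have q0 : 0 < 2 / (decay * eta) by rewrite divr_gt0// mulr_gt0.
  by rewrite -ln_powR -lnM ?posrE// -[leLHS]expRK ler_ln ?posrE// mulr_gt0.
have : 0 <= t * ln (d%:R : R) by rewrite mulr_ge0// ltW.
by rewrite mulrBl mul1r; lra.
Qed.

Variables (cls : info_class) (cr : criterion).

(** Only eps = 1/8 is used, so s enters just through a constant. If the condition fails at d, the
    entropy bound with de = 1/ln d gives ln n of order at least d om^(a_d) ln d up to O(ln d), and
    a_d = O(ln d) makes this at least a fixed multiple of d^t. *)
Lemma EXP_WT_weighted_necessary s t : 0 < t < 1 -> EXP_WT om a b cls cr s t ->
  forall eta, 0 < eta -> exists N, forall j, (N <= j)%N ->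
     (j%:R : R) `^ (1 - t) * a j * om `^ a j <= eta.
Proof.
move=> t01 H eta eta0; have /andP[t0 t1] := t01.
apply: contrapT => /forallNP hN.
have c0 : 0 < decay by exact: decay_gt0.
pose Y := (1 + ln 8 : R) `^ s; have Y0 : 0 <= Y by exact: powR_ge0.
have [N1 N1P] := EXP_WT_wsum hom ha1 hamono hb0 hb H.
pose C1 := 2 * (3 + Y); have C1_1 : 1 <= C1 by rewrite /C1; lra.
have aP k : (0 < k)%N -> (N1 <= k)%N -> (1 - t) * ln (k%:R : R) - ln C1 <= decay * a k.
  move=> k0 Nk; have kR : 0 < k%:R :> R by rewrite ltr0n.
  have h1 := powR_om_le_wsum k0.
  have kt : 1 <= k%:R `^ t :> R by apply: ge1_powR; rewrite ?ler1n// ltW.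
  have h2 : ln (wsum 1 k 1) <= 2 + Y + k%:R `^ t.
    rewrite -[leRHS]expRK ler_ln ?posrE ?expR_gt0//; first exact: N1P.
    by have := wsum_ge1 a hom hb0 hb 1 k 1; lra.
  have h3 : k%:R * om `^ a k <= C1 * k%:R `^ t.
    have : Y <= Y * k%:R `^ t by rewrite ler_peMr.
    by rewrite /C1; lra.
  have p0 : 0 < om `^ a k by rewrite powR_gt0//; case/andP: hom.
  have C10 : 0 < C1 by lra.
  have kt0 : 0 < k%:R `^ t :> R by exact: powR_gt0.
  have kp0 : 0 < k%:R * om `^ a k by exact: mulr_gt0.
  have Ck0 : 0 < C1 * k%:R `^ t by exact: mulr_gt0.
  have : ln (k%:R * om `^ a k) <= ln (C1 * k%:R `^ t) by rewrite ler_ln ?posrE.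
  rewrite lnM ?posrE// lnM ?posrE//.
  have -> : decay * a k = - (a k * ln om) by rewrite mulrC mulrN.
  by rewrite !ln_powR mulrBl mul1r; lra.
(* For k >= d/2, [aP] gives decay a_k >= ((1 - t)/2) ln d, so raising the exponent by 1/ln d shrinks
   rho by this fixed factor. *)
pose ka := expR (- ((1 - t) / 2)) : R.
have ka01 : 0 <= ka <= 1 by rewrite expR_ge0 expR_le1; lra.
have ka1 : 0 < 1 - ka by rewrite subr_gt0 expR_lt1; lra.
(* The 24 is the 6 of [sum_ln_contract_ge] times the 4 of [a_le_ln]. *)
pose c3 := (1 - ka) * eta * decay / 24.
have c30 : 0 < c3 by rewrite divr_gt0// mulr_gt0// mulr_gt0.
have c38 : 0 < c3 / 8 by lra.
have [N2 N2P] := EXP_WT_elim H c38.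
have [C3 C30 C3P] := ln_small t0 c38.
have [N3 N3P] := large_ln (Num.max (2 * (1 + ln C1 / (1 - t))) (Num.max (ln (2 / (decay * eta))) 1)).
have [N4 N4P] := large_powR ((2 * C3 + c3 * Y) / (c3 / 2) + 1) t0.
pose N0 := maxn (maxn (2 * N1) N2) (maxn (maxn N3 N4) 2).
have /existsNP[d /not_implyP[Nd /negP]] := hN N0.
rewrite -ltNge => hd.
move: Nd; rewrite !geq_max => /andP[/andP[n1 n2] /andP[/andP[n3 n4] d1]].
have d0 : (0 < d)%N by exact: ltnW.
have dR : 0 < d%:R :> R by rewrite ltr0n.
have d1R : 1 <= d%:R :> R by rewrite ler1n.
have := N3P _ n3; rewrite !ge_max => /andP[hl1 /andP[hl2 hl3]].
have {N4P}hdt := N4P _ n4.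
have [|n [nE nT]] := N2P d 8^-1 d0 n2; first by lra.
rewrite invrK -/Y in nT.
set ld := ln (d%:R : R) in hl1 hl2 hl3.
have ld0 : 0 < ld by lra.
have de0 : 0 < ld^-1 by rewrite invr_gt0.
have [M0 [M00 hent]] := nstar_eighth_entropy hom ha1 hamono hb0 hb de0 nE.
have hka k : (d <= 2 * k)%N -> om `^ (ld^-1 * a k.+1) <= ka.
  move=> dk; rewrite (powR_decay hom) ler_expR lerN2 [leRHS]mulrCA [leRHS]mulrC ler_pdivlMr//.
  apply: le_trans (aP k.+1 _ _) => //; last first.
    by rewrite -(leq_pmul2l (isT : (0 < 2)%N)) (leq_trans n1)// (leq_trans dk)// leq_mul2l leqnSn orbT.
  have lk : ld - 1 <= ln (k.+1%:R : R).
    apply: (@le_trans _ _ (ld - ln 2)); first by have := ln2_le1 R; lra.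
    rewrite lerBlDr -lnM ?posrE// ler_ln ?posrE ?mulr_gt0//.
    by rewrite -natrM ler_nat (leq_trans dk)// mulnC leq_mul2r leqnSn.
  have h1 : (1 - t) * (ld - 1) <= (1 - t) * ln k.+1%:R by rewrite ler_wpM2l//; lra.
  have t10 : 0 < 1 - t by lra.
  have h2 : 2 * (1 - t + ln C1) <= (1 - t) * ld.
    have -> : 2 * (1 - t + ln C1) = (1 - t) * (2 * (1 + ln C1 / (1 - t))).
      by field; rewrite gt_eqF.
    by rewrite ler_wpM2l// ltW.
  by rewrite mulrBr mulr1 in h1; lra.
have hsum := sum_ln_contract_ge d1 M00 (ltW de0) ka01 hka.
have ale := a_le_ln eta0 t01 d0 hl2 (ltW hd).
have ad0 := a_gt0 ha1 hamono d0.
set p := om `^ a d in hd hsum.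
have dp : eta * decay * d%:R `^ t <= 4 * ld * (d%:R * p).
  have dE : d%:R = d%:R `^ t * d%:R `^ (1 - t) :> R.
    by rewrite -powRD ?(gt_eqF dR) ?implybT// addrC subrK powRr1 ?ltW.
  have dt0 : 0 <= d%:R `^ t :> R by exact: powR_ge0.
  rewrite {2}dE; apply: (@le_trans _ _ (decay * d%:R `^ t * (d%:R `^ (1 - t) * a d * p))).
    rewrite -mulrA mulrC; apply: ler_wpM2l; last exact: ltW.
    by rewrite mulr_ge0// ltW.
  have -> : decay * d%:R `^ t * (d%:R `^ (1 - t) * a d * p) =
    (decay * a d) * (d%:R `^ t * d%:R `^ (1 - t) * p) by ring.
  by rewrite ler_wpM2r// !mulr_ge0// powR_ge0.
have hmain : c3 * d%:R `^ t <= ld * (d%:R * ((1 - ka) * p) / 6).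
  have -> : c3 * d%:R `^ t = (1 - ka) / 24 * (eta * decay * d%:R `^ t) by rewrite /c3; ring.
  have -> : ld * (d%:R * ((1 - ka) * p) / 6) = (1 - ka) / 24 * (4 * ld * (d%:R * p)) by field.
  by rewrite ler_wpM2l// divr_ge0// ltW.
rewrite invrK in hent.
set S := \sum_(k < d) _ in hsum hent.
have hS : c3 * d%:R `^ t <= ld * S.
  by apply: le_trans hmain _; rewrite ler_wpM2l// ltW.
have hld := C3P d%:R d1R; rewrite -/ld in hld.
have l4 : ln 4 <= 2 :> R.
  have -> : 4 = 2 ^+ 2 :> R by ring.
  by rewrite lnXn// mulr2n; have := ln2_le1 R; lra.
have hl4 : ld * ln 4 <= ld * 2 by rewrite ler_wpM2l// ltW.
have fin : (2 * C3 + c3 * Y) + c3 / 2 <= c3 / 2 * d%:R `^ t.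
  have -> : 2 * C3 + c3 * Y + c3 / 2 = c3 / 2 * ((2 * C3 + c3 * Y) / (c3 / 2) + 1).
    by field; rewrite gt_eqF.
  by rewrite ler_wpM2l//; lra.
have l2 := ln2_le1 R.
have cY : 0 <= c3 * Y by rewrite mulr_ge0// ltW.
move: hent nT; rewrite mulrBr [c3 / 8 * (_ + _)]mulrDr.
move: hS hl4 hld fin; move: (ld * S) (ld * ln 4) (ln n%:R) (d%:R `^ t) => X1 X2 X3 X4.
lra.
Qed.

End NecessityEntropy.

(** * Uniform weak tractability and reformulation of the limits *)

Section UniformWeakTractability.
Variables (R : realType) (om : R) (a b : nat -> R) (b0 : R).
Hypothesis hom : 0 < om < 1.
Hypothesis ha1 : 0 < a 1%N.
Hypothesis hamono : forall j : nat, (1 <= j)%N -> a j <= a j.+1.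
Hypothesis hb0 : 0 < b0.
Hypothesis hb : forall j : nat, (1 <= j)%N -> b0 <= b j.
Variables (cls : info_class) (cr : criterion).

Lemma exp_tends0_le (T T' : nat -> R -> R) :
  (forall d eps, (0 < d)%N -> 0 < eps < 1 -> 0 < T d eps <= T' d eps) ->
  exp_tends0 om a b cls cr T -> exp_tends0 om a b cls cr T'.
Proof.
move=> TT H eta /H[M MP]; exists M => d eps d0 he hM.
have [n [nE nT]] := MP d eps d0 he hM; exists n; split => //.
have /andP[T0 TT'] := TT d eps d0 he.
apply: le_lt_trans nT; rewrite !normrM ler_wpM2l//.
have T'0 := lt_le_trans T0 TT'.
by rewrite !ger0_norm ?invr_ge0 ?(ltW T0) ?(ltW T'0)// lef_pV2 ?posrE.
Qed.

(** The inequality ln a_j >= q ln j says a_j >= j^q. Using it with q + 1 leaves a factor j that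
    tends to infinity. *)
Lemma ln_ratio_cvg_powers :
  ((fun j : nat => ln (a j) / ln (j%:R : R)) @ \oo --> +oo) <->
  (forall q : R, 0 < q -> (fun j : nat => a j / (j%:R : R) `^ q) @ \oo --> +oo).
Proof.
split => [/cvg_pinftyP h q q0|h]; apply/cvg_pinftyP => A.
  have [N1 N1P] := h (q + 1); have [N2 N2P] := large_nat A.
  exists (maxn N1 (maxn N2 2)) => j; rewrite !geq_max => /andP[n1 /andP[n2 n3]].
  have j1 : (1 : R) < j%:R by rewrite ltr1n.
  have j0 : (0 : R) < j%:R by lra.
  have aj := a_gt0 ha1 hamono (ltnW n3).
  have := N1P _ n1; rewrite ler_pdivlMr ?ln_gt0// -ln_powR ler_ln ?posrE ?powR_gt0//.
  rewrite powRD; last by rewrite (gt_eqF j0) implybT.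
  rewrite powRr1 ?(ltW j0)// mulrC -ler_pdivlMr ?powR_gt0//.
  exact: le_trans (N2P _ n2).
pose q := Num.max A 1; have q0 : 0 < q by rewrite lt_max ltr01 orbT.
have [N NP] := (cvg_pinftyP _).1 (h q q0) 1.
exists (maxn N 2) => j; rewrite geq_max => /andP[n1 n2].
have j1 : (1 : R) < j%:R by rewrite ltr1n.
have j0 : (0 : R) < j%:R by lra.
have aj := a_gt0 ha1 hamono (ltnW n2).
apply: (@le_trans _ _ q); first by rewrite le_max lexx.
rewrite ler_pdivlMr ?ln_gt0// -ln_powR ler_ln ?posrE ?powR_gt0//.
by have := NP _ n1; rewrite ler_pdivlMr ?powR_gt0// mul1r.
Qed.

Lemma EXP_UWT_iff : EXP_UWT om a b cls cr <->
  (fun j : nat => ln (a j) / ln (j%:R : R)) @ \oo --> +oo.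
Proof.
split => [H|/ln_ratio_cvg_powers H al be al0 be0].
  apply/ln_ratio_cvg_powers => q q0; pose s := (1 + q)^-1.
  have s01 : 0 < s < 1 by rewrite invr_gt0 invf_lt1; lra.
  have -> : q = (1 - s) / s by rewrite /s; field; rewrite gt_eqF; lra.
  have one : 0 < (1 : R) <= 1 by rewrite ltr01 lexx.
  apply: (EXP_WT_power_necessary hom ha1 hamono hb0 hb s01 one).
  by case/andP: s01 => s0 _; exact: H.
(* [EXP_WT_power] needs s < 1; as 1 + ln(1/eps) >= 1, replacing al by s only lowers the
   denominator. *)
pose s := Num.min al (1 / 2).
have s0 : 0 < s by rewrite lt_min al0; lra.
have s1 : s <= 1 / 2 by rewrite ge_min lexx orbT.
have s01 : 0 < s < 1 by lra.
have q0 : 0 < (1 - s) / s by rewrite divr_gt0//; lra.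
apply: exp_tends0_le (EXP_WT_power hom ha1 hamono hb0 hb cls cr s01 be0 (H _ q0)).
move=> d eps d0 he; have y1 := logeps_ge1 he.
apply/andP; split; first by rewrite ltr_wpDr ?powR_ge0// powR_gt0//; lra.
by rewrite lerD2r; apply: ler_powR => //; rewrite ge_min lexx.
Qed.

Lemma weighted_cvgP t :
  (fun j : nat => (j%:R : R) `^ (1 - t) * a j * om `^ (a j)) @ \oo --> 0 <->
  (forall eta, 0 < eta -> exists N, forall j, (N <= j)%N ->
     (j%:R : R) `^ (1 - t) * a j * om `^ a j <= eta).
Proof.
(* Nothing is assumed about a 0, so the sign is known only from j = 1 on. *)
have pos j : (0 < j)%N -> 0 <= (j%:R : R) `^ (1 - t) * a j * om `^ a j.
  by move=> j0; rewrite !mulr_ge0 ?powR_ge0// ltW// (a_gt0 ha1 hamono j0).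
split => [/cvgr0Pnorm_le h eta /h/near_nat_infty[N NP]|h].
  by exists N => j /NP; apply: le_trans; exact: ler_norm.
apply/cvgr0Pnorm_le => eta /h[N NP]; apply/near_nat_infty.
exists (maxn N 1) => j; rewrite geq_max => /andP[Nj j0].
by rewrite ger0_norm ?pos//; exact: NP.
Qed.

End UniformWeakTractability.

Theorem theorem5p8 (R : realType) (om : R) (a b : nat -> R)
  (hom : 0 < om < 1)
  (ha1 : 0 < a 1%N)
  (hamono : forall j : nat, (1 <= j)%N -> a j <= a j.+1)
  (hb : exists b0 : R, 0 < b0 /\ forall j : nat, (1 <= j)%N -> b0 <= b j)
  (cls : info_class) (cr : criterion) :
  (EXP_UWT om a b cls cr <->
     (fun j : nat => ln (a j) / ln (j%:R : R)) @ \oo --> +oo) /\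
  (forall s t : R, 0 < s -> 1 < t -> EXP_WT om a b cls cr s t) /\
  (forall s t : R, 0 < s < 1 -> 0 < t <= 1 ->
     (EXP_WT om a b cls cr s t <->
        (fun j : nat => a j / (j%:R : R) `^ ((1 - s) / s)) @ \oo --> +oo)) /\
  (forall t : R, 0 < t < 1 ->
     (EXP_WT om a b cls cr 1 t <->
        (fun j : nat => a j / ln (j%:R : R)) @ \oo --> +oo)) /\
  (forall s t : R, 1 < s -> 0 < t < 1 ->
     (EXP_WT om a b cls cr s t <->
        (fun j : nat => (j%:R : R) `^ (1 - t) * a j * om `^ (a j)) @ \oo --> 0)).
Proof.
have [b0 [hb0 hb']] := hb; split; [exact: (EXP_UWT_iff hom ha1 hamono hb0 hb')|].
split; [|split; [|split]].
- by move=> s t; exact: (EXP_WT_always hom ha1 hamono hb0 hb').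
- move=> s t s01 t01; split.
    exact: (EXP_WT_power_necessary hom ha1 hamono hb0 hb').
  by apply: (EXP_WT_power hom ha1 hamono hb0 hb') => //; case/andP: t01.
- move=> t t01; split; first exact: (EXP_WT_log_necessary hom ha1 hamono hb0 hb').
  by apply: (EXP_WT_log hom ha1 hamono hb0 hb'); case/andP: t01.
- move=> s t s1 t01; split => [H|/(weighted_cvgP om ha1 hamono) H].
    apply/(weighted_cvgP om ha1 hamono).
    exact: (EXP_WT_weighted_necessary hom ha1 hamono hb0 hb' t01 H).
  exact: (EXP_WT_weighted hom ha1 hamono hb0 hb' cls cr s1 t01 H).
Qed.
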